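(* Let $D\subset\mathbb{R}^d$ be a bounded Lipschitz domain. There exists a constant $c=c(D)>0$ such that for every $x,y\in D$ and every $A\in\mathcal{B}(x,y)$, $$c^{-1}\,\frac{g_1(x)\,g_2(y)}{g_1(A)\,g_2(A)}\,|x-y|^{-d+2}\;\le\;G_D(x,y)\;\le\;c\,\frac{g_1(x)\,g_2(y)}{g_1(A)\,g_2(A)}\,|x-y|^{-d+2}.$$
   Context: Setting. Let $d\ge 3$. A signed measure is a difference of two nonnegative measures at most one of which has infinite total mass; $|\nu|$ is the total variation. For a signed Radon measure $\nu$ on $\mathbb{R}^d$ and $0<\alpha\le 2$ put $M^\alpha_\nu(r)=\sup_{x\in\mathbb{R}^d}\int_{|x-y|\le r}|x-y|^{\alpha-d}|\nu|(dy)$; $\nu\in\mathbf{K}_{d,\alpha}$ means $\lim_{r\downarrow0}M^\alpha_\nu(r)=0$. Fix $\mu=(\mu^1,\dots,\mu^d)$ with each $\mu^i\in\mathbf{K}_{d,1}$. Let $L$ be either $L_1=\frac12\sum_{i,j}\partial_i(a_{ij}\partial_j)$ or $L_2=\frac12\sum_{i,j}a_{ij}\partial_i\partial_j$, with $(a_{ij})$ being $C^1$ and uniformly elliptic, not necessarily symmetric. $X$ is the diffusion in $\mathbb{R}^d$ with drift $\mu$ (informally, with generator $L+\mu\cdot\nabla$): the continuous strong Markov process, unique in law, such that under $\mathbf{P}_x$, $X_t=x+N_t+\int_0^t b(X_s)ds+A^\mu_t$, where $N$ is a continuous local martingale with $\langle N^i,N^j\rangle_t=\int_0^t\frac12(a_{ij}+a_{ji})(X_s)ds$;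 $b_j=\frac12\sum_i\partial_ia_{ij}$ if $L=L_1$ and $b=0$ if $L=L_2$; and $A^\mu$ is continuous with $A^\mu_t=\lim_n\int_0^tU_n(X_s)ds$ in probability uniformly on bounded time intervals, where $U_n^i=\varphi_n*\mu^i$, $\varphi_n(x)=2^{nd}\varphi(2^nx)$, $\varphi\ge0$ smooth, radial, supported in $B(0,1)$, $\int\varphi=1$, and along some subsequence $\sup_k\int_0^t|U_{n_k}(X_s)|ds<\infty$ a.s. for all $t$. Existence and uniqueness of $X$ are known. For bounded open $U$: $\tau_U=\inf\{t>0:X_t\notin U\}$; $X^U$ is $X$ killed on exiting $U$ (sent to a cemetery $\partial$, with $f(\partial)=0$); $q^U(t,x,y)$ is its (jointly continuous) transition density; $G_U(x,y)=\int_0^\infty q^U(t,x,y)dt$ is its Green function. $a\wedge b=\min$, $a\vee b=\max$; $\rho_D(x)$ is the distance from $x$ to $\partial D$. Estimates are read for $x\ne y$ (on the diagonal both sides are $\infty$). $\mu$ and $L$ are fixed; constants may depend on them. A Borel function $u$ is harmonic with respect to $X$ in $U$ if $u(x)=\mathbf{E}_x[u(X_{\tau_B})]$, $x\in B$, for every bounded open $B$ with $\overline B\subset U$ (similarly for $X^D$). Lipschitz domains. A bounded domain $D$ is Lipschitz with characteristics $(R_0,\Lambda_0)$ if for every $Q\in\partial D$ there are a Lipschitz function $\phi_Q:\mathbb{R}^{d-1}\to\mathbb{R}$ with Lipschitz constant $\Lambda_0$ and an orthonormal coordinate system $CS_Q$ with origin at $Q$ such that $B(Q,R_0)\cap D=B(Q,R_0)\cap\{y=(\tilde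 y,y_d)\text{ in }CS_Q: y_d>\phi_Q(\tilde y)\}$. There is $\kappa_0\in(0,1/2]$ such that (decreasing $R_0$ if necessary) for each $Q\in\partial D$, $r\in(0,R_0)$, the set $D\cap B(Q,r)$ contains a ball $B(A_r(Q),\kappa_0r)$; fix $\kappa_0$. Fixed constants (known to exist). $r_1$: for some $c>1$ and all $0<r\le r_1$, $z\in\mathbb{R}^d$, $G_{B(z,r)}(x,y)\le c|x-y|^{2-d}$ on $B(z,r)$ and $G_{B(z,r)}(x,y)\ge c^{-1}|x-y|^{2-d}$ for $x,y\in\overline{B(z,2r/3)}$. $r_2$: for some $c$, every positive harmonic function $f$ for $X$ in $B(x_0,r)$, $r\in(0,r_2)$, satisfies $\sup_{B(x_0,r/2)}f\le c\inf_{B(x_0,r/2)}f$. $M_1>1,r_3>0$: for some $c>1$, for all $Q\in\partial D$, $r<r_3$ and nonnegative $u,v$ harmonic with respect to $X^D$ in $D\cap B(Q,M_1r)$ vanishing continuously on $\partial D\cap B(Q,M_1r)$, $u(x)/v(x)\le c\,u(y)/v(y)$ for $x,y\in D\cap B(Q,r)$. $M_2=2(1+M_1)\sqrt{1+\Lambda_0^2}+2$ and $r_4=M_2^{-1}(R_0\wedge r_1\wedge r_2\wedge r_3)$. $M>1/\kappa_0$ and $0<r_0\le r_4$ are fixed such that for some $c>1$, for all $Q\in\partial D$, $r<r_0$, $x,y\in D\setminus B(Q,r)$, $z_1,z_2\in D\cap B(Q,r/M)$: $\frac{G_D(x,z_1)}{G_D(y,z_1)}\le c\frac{G_D(x,z_2)}{G_D(y,z_2)}$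 and $\frac{G_D(z_1,x)}{G_D(z_1,y)}\le c\frac{G_D(z_2,x)}{G_D(z_2,y)}$. $C_0>0$ is fixed such that $G_D(x,y)\le C_0|x-y|^{-d+2}$ for all $x,y\in D$ and $G_D(x,y)\ge C_0^{-1}|x-y|^{-d+2}$ if $2|x-y|\le\rho_D(x)\vee\rho_D(y)$. Fix $z_0\in D$ with $r_0/M<\rho_D(z_0)<r_0$; let $\varepsilon_1=r_0/(12M)$, $C_1=C_02^{d-2}\rho_D(z_0)^{2-d}$, $g_1(x)=G_D(x,z_0)\wedge C_1$, $g_2(y)=G_D(z_0,y)\wedge C_1$. Let $r(x,y)=\rho_D(x)\vee\rho_D(y)\vee|x-y|$, and $\mathcal{B}(x,y)=\{A\in D:\rho_D(A)>\frac1Mr(x,y),\ |x-A|\vee|y-A|<5r(x,y)\}$ if $r(x,y)<\varepsilon_1$, $\mathcal{B}(x,y)=\{z_0\}$ otherwise. *)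

(* Defs.v *)
From HB Require Import structures.
From mathcomp Require Import all_boot all_order all_algebra.
From mathcomp Require Import all_classical all_reals all_analysis.
From mathcomp Require Import measurable_realfun.
Set Implicit Arguments.
Unset Strict Implicit.
Unset Printing Implicit Defensive.
Import Order.TTheory GRing.Theory Num.Theory.
Import numFieldNormedType.Exports.
Local Open Scope classical_set_scope.
Local Open Scope ring_scope.

(* The Borel sigma-algebra on R^d. *)
HB.instance Definition _ (R : realType) (m n : nat) :=
  @isMeasurable.Build (sigma_display (@open 'M[R]_(m, n))) 'M[R]_(m, n)
    <<s @open 'M[R]_(m, n) >> (@sigma_algebra0 _ setT _) (@sigma_algebraC _ _)
    (@sigma_algebra_bigcup _ setT _).

Section euclidean_space.
Context {R : realType}.

(* The library norm on row vectors is the sup norm, hence this one. *)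
Definition eucl_norm n (x : 'rV[R]_n) : R := Num.sqrt (\sum_(i < n) x 0 i ^+ 2).

Definition eucl_dist n (x y : 'rV[R]_n) : R := eucl_norm (x - y).

Definition eball n (x : 'rV[R]_n) (r : R) : set 'rV[R]_n :=
  [set y | eucl_dist x y < r].

Definition ecball n (x : 'rV[R]_n) (r : R) : set 'rV[R]_n :=
  [set y | eucl_dist x y <= r].

Definition boundary n (A : set 'rV[R]_n) : set 'rV[R]_n :=
  closure A `\` interior A.

Definition dist_boundary n (D : set 'rV[R]_n) (x : 'rV[R]_n) : R :=
  inf [set eucl_dist x z | z in boundary D].

(* Lebesgue measure on Borel sets, as an iterated product: compare
   product_measure1.  The set of v is the section of A at first coordinate t. *)
Fixpoint lebesgue_rV (n : nat) : set 'rV[R]_n -> \bar R :=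
  match n with
  | 0 => fun A => dirac (0 : 'rV[R]_0) A
  | n'.+1 => fun A =>
      (\int[lebesgue_measure]_t
         lebesgue_rV
           [set v : 'rV[R]_n' | A (row_mx (const_mx t : 'rV[R]_1) v)])%E
  end.

Definition pderiv n (i : 'I_n) (f : 'rV[R]_n -> R) : 'rV[R]_n -> R :=
  fun x => 'D_(delta_mx 0 i) f x.

Definition C1_fun n (f : 'rV[R]_n -> R) : Prop :=
  (forall x, differentiable f x) /\ (forall i, continuous (pderiv i f)).

Definition smooth_fun n (f : 'rV[R]_n -> R) : Prop :=
  forall (s : seq 'I_n) x, differentiable (foldr (@pderiv n) f s) x.

End euclidean_space.

Section signed_measures.
Local Open Scope ereal_scope.

(* The library's charges are finite, so they do not cover this notion. *)
Record signed_measure d (T : measurableType d) (R : realType) := SignedMeasure {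
  minuend : {measure set T -> \bar R} ;
  subtrahend : {measure set T -> \bar R} ;
  one_finite : minuend setT < +oo \/ subtrahend setT < +oo }.

Definition sm_val d (T : measurableType d) (R : realType)
  (nu : signed_measure T R) (A : set T) : \bar R :=
  minuend nu A - subtrahend nu A.

Definition sm_total_variation d (T : measurableType d) (R : realType)
  (nu : signed_measure T R) (A : set T) : \bar R :=
  ereal_sup [set s | exists n (F : 'I_n -> set T),
    [/\ forall i, measurable (F i), trivIset setT F, \bigcup_i F i = A &
        s = \sum_(i < n) `|sm_val nu (F i)|]].

Context {R : realType} {d : nat}.
Implicit Type nu : signed_measure 'rV[R]_d R.

Definition radon nu : Prop :=
  forall K : set 'rV[R]_d, compact K -> sm_total_variation nu K < +oo.

(* For alpha < d the kernel |x - y|^(alpha - d) is infinite on the diagonal,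
   whereas powR gives 0 there. *)
Definition riesz_kernel (alpha : R) (x y : 'rV[R]_d) : \bar R :=
  if x == y then +oo else (eucl_dist x y `^ (alpha - d%:R))%:E.

Definition kato_sup (alpha : R) nu (r : R) : \bar R :=
  ereal_sup (range (fun x : 'rV[R]_d =>
    \int[sm_total_variation nu]_(y in ecball x r) riesz_kernel alpha x y)).

Definition kato_class (alpha : R) nu : Prop :=
  radon nu /\ kato_sup alpha nu r @[r --> 0^'+] --> 0.

End signed_measures.

Section mollification.
Context {R : realType} {d : nat}.

Definition mollifier (phi : 'rV[R]_d -> R) : Prop :=
  [/\ forall x, 0 <= phi x,
      smooth_fun phi,
      forall x y, eucl_norm x = eucl_norm y -> phi x = phi y,
      forall x, phi x != 0 -> eball 0 1 x &
      (\int[@lebesgue_rV R d]_x (phi x)%:E = 1)%E].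

Definition mollify (phi : 'rV[R]_d -> R) (n : nat) : 'rV[R]_d -> R :=
  fun x => 2 ^+ (n * d) * phi (2 ^+ n *: x).

Definition conv_measure (f : 'rV[R]_d -> R) (nu : signed_measure 'rV[R]_d R)
    (x : 'rV[R]_d) : R :=
  \int[minuend nu]_y f (x - y) - \int[subtrahend nu]_y f (x - y).

Definition mollified_drift (phi : 'rV[R]_d -> R)
    (mu : 'I_d -> signed_measure 'rV[R]_d R) (n : nat) (x : 'rV[R]_d) :
    'rV[R]_d :=
  \row_i conv_measure (mollify phi n) (mu i) x.

End mollification.

Section generator.
Context {R : realType} {d : nat}.

(* L_1 (divergence form) and L_2 (nondivergence form). *)
Inductive generator_form := Divergence | Nondivergence.

Definition uniformly_elliptic (a : 'rV[R]_d -> 'M[R]_d) : Prop :=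
  exists2 lambda : R, 1 <= lambda & forall x xi : 'rV[R]_d,
    lambda^-1 * eucl_norm xi ^+ 2 <= \sum_i \sum_j a x i j * xi 0 i * xi 0 j
      <= lambda * eucl_norm xi ^+ 2.

Definition drift_coef (L : generator_form) (a : 'rV[R]_d -> 'M[R]_d)
    (x : 'rV[R]_d) : 'rV[R]_d :=
  match L with
  | Divergence => \row_j (2^-1 * \sum_i pderiv i (fun z => a z i j) x)
  | Nondivergence => 0
  end.

End generator.

Section processes.
Context {R : realType} {dO : measure_display} {Omega : measurableType dO}.
Implicit Types (F : R -> set (set Omega)) (P : probability Omega R).

Definition continuous_paths (T : topologicalType) (M : R -> Omega -> T) :
    Prop :=
  forall w, {within [set t : R | 0 <= t], continuous (M ^~ w)}.

Definition adapted dT (T : measurableType dT) F (M : R -> Omega -> T) : Prop :=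
  forall t : R, 0 <= t -> forall B, measurable B -> F t (M t @^-1` B).

Definition stopping_time F (S : Omega -> \bar R) : Prop :=
  (forall w, (0 <= S w)%E) /\
  (forall t : R, 0 <= t -> F t [set w | (S w <= t%:E)%E]).

Definition stopped_algebra F (S : Omega -> \bar R) : set (set Omega) :=
  [set E | measurable E /\
           forall t : R, 0 <= t -> F t (E `&` [set w | (S w <= t%:E)%E])].

Definition martingale F P (M : R -> Omega -> R) : Prop :=
  [/\ adapted F M,
      forall t : R, 0 <= t -> P.-integrable setT (EFin \o M t) &
      forall s t : R, 0 <= s -> s <= t -> forall E, F s E ->
        (\int[P]_(w in E) (M t w)%:E = \int[P]_(w in E) (M s w)%:E)%E].

Definition continuous_local_martingale F P (M : R -> Omega -> R) : Prop :=
  [/\ adapted F M,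
      continuous_paths M &
      exists S : nat -> Omega -> \bar R,
        [/\ forall k, stopping_time F (S k),
            {ae P, forall w, nondecreasing_seq (S ^~ w)},
            {ae P, forall w, S k w @[k --> \oo] --> +oo%E} &
            forall k, martingale F P
              (fun t w => M (fine (Order.min t%:E (S k w))) w - M 0 w)]].

(* V is (a version of) the bracket <M1, M2>. *)
Definition is_bracket F P (M1 M2 V : R -> Omega -> R) : Prop :=
  [/\ adapted F V, continuous_paths V, forall w, V 0 w = 0,
      forall w (t : R), 0 <= t -> bounded_variation 0 t (V ^~ w) &
      continuous_local_martingale F P (fun t w => M1 t w * M2 t w - V t w)].

End processes.

Section diffusion.
Context {R : realType} {d : nat}.
Context {dO : measure_display} {Omega : measurableType dO}.
Variables (P : 'rV[R]_d -> probability Omega R) (X : R -> Omega -> 'rV[R]_d).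

Definition natural_events (I : set R) : set (set Omega) :=
  <<s [set X s @^-1` B | s in I & B in measurable] >>.

(* The usual augmentation of the natural filtration under P_x: right-continuous,
   with the null events added. *)
Definition filtration (x : 'rV[R]_d) (t : R) : set (set Omega) :=
  [set E | measurable E /\
    exists2 E', (forall u, t < u -> natural_events [set s | 0 <= s <= u] E') &
                P x (E `+` E') = 0%E].

Definition strong_markov : Prop :=
  (forall E, natural_events [set s | 0 <= s] E ->
     measurable_fun setT (fun x => P x E)) /\
  (forall x S E (s : R) (B : set 'rV[R]_d), stopping_time (filtration x) S ->
     stopped_algebra (filtration x) S E -> 0 <= s -> measurable B ->
     let ES := E `&` [set w | (S w < +oo)%E] in
     (P x (ES `&` [set w | B (X (fine (S w) + s)%R w)])
      = \int[P x]_(w in ES) P (X (fine (S w)) w) (X s @^-1` B))%E).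

Definition time_integral (f : 'rV[R]_d -> 'rV[R]_d) (t : R) (w : Omega) :
    'rV[R]_d :=
  \row_i \int[lebesgue_measure]_(s in `[0, t]) f (X s w) 0 i.

(* A is the additive functional A^mu under the law Px. *)
Definition is_drift_functional (phi : 'rV[R]_d -> R)
    (mu : 'I_d -> signed_measure 'rV[R]_d R) (Px : probability Omega R)
    (A : R -> Omega -> 'rV[R]_d) : Prop :=
  let U := mollified_drift phi mu in
  [/\ forall t : R, 0 <= t -> measurable_fun setT (A t),
      continuous_paths A,
      forall T e : R, 0 <= T -> 0 < e ->
        Px [set w | exists2 t : R, 0 <= t <= T &
              e < eucl_dist (A t w) (time_integral (U n) t w)] @[n --> \oo]
          --> 0%E &
      exists2 k : nat -> nat, {homo k : m n / (m < n)%N} &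
        {ae Px, forall w, forall t : R, 0 <= t ->
          (ereal_sup (range (fun n =>
             \int[lebesgue_measure]_(s in `[0%R, t])
               (eucl_norm (U (k n) (X s w)))%:E))
           < +oo)%E}].

Definition is_diffusion (phi : 'rV[R]_d -> R) (L : generator_form)
    (a : 'rV[R]_d -> 'M[R]_d) (mu : 'I_d -> signed_measure 'rV[R]_d R) : Prop :=
  [/\ forall t : R, 0 <= t -> measurable_fun setT (X t),
      continuous_paths X,
      strong_markov,
      forall x, {ae P x, forall w, X 0 w = x} &
      forall x, exists (N A : R -> Omega -> 'rV[R]_d),
        [/\ {ae P x, forall w, N 0 w = 0 /\ forall t : R, 0 <= t ->
              X t w = x + N t w + time_integral (drift_coef L a) t w + A t w},
            forall i, continuous_local_martingale (filtration x) (P x)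
              (fun t w => N t w 0 i),
            forall i j, is_bracket (filtration x) (P x)
              (fun t w => N t w 0 i) (fun t w => N t w 0 j)
              (fun t w => \int[lebesgue_measure]_(s in `[0, t])
                 (2^-1 * (a (X s w) i j + a (X s w) j i))) &
            is_drift_functional phi mu (P x) A]].

(* Paths in R^d with a cemetery, which is None. *)
Definition in_state (B : set 'rV[R]_d) (o : option 'rV[R]_d) : Prop :=
  if o is Some z then B z else False.

Definition at_state (u : 'rV[R]_d -> R) (o : option 'rV[R]_d) : R :=
  if o is Some z then u z else 0.

Definition exit_time (p : R -> option 'rV[R]_d) (B : set 'rV[R]_d) : \bar R :=
  ereal_inf [set t%:E | t in [set t : R | 0 < t /\ ~ in_state B (p t)]].

Definition state_at (p : R -> option 'rV[R]_d) (t : \bar R) : option 'rV[R]_d :=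
  if t is s%:E then p s else None.

Definition unkilled (t : R) (w : Omega) : option 'rV[R]_d := Some (X t w).

Definition killed (U : set 'rV[R]_d) (t : R) (w : Omega) : option 'rV[R]_d :=
  if (t%:E < exit_time (unkilled ^~ w) U)%E then Some (X t w) else None.

Definition harmonic_in (Y : R -> Omega -> option 'rV[R]_d) (U : set 'rV[R]_d)
    (u : 'rV[R]_d -> R) : Prop :=
  measurable_fun setT u /\
  forall B : set 'rV[R]_d, open B -> bounded_set B -> closure B `<=` U ->
    forall x, B x ->
    ((u x)%:E =
     \int[P x]_w (at_state u (state_at (Y ^~ w) (exit_time (Y ^~ w) B)))%:E)%E.

Definition is_killed_density (U : set 'rV[R]_d)
    (q : R -> 'rV[R]_d -> 'rV[R]_d -> R) : Prop :=
  [/\ forall (t : R) x y, 0 < t -> U x -> U y -> 0 <= q t x y,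
      {within [set z : R * 'rV[R]_d * 'rV[R]_d |
                 [/\ 0 < z.1.1, U z.1.2 & U z.2]],
        continuous (fun z => q z.1.1 z.1.2 z.2)} &
      forall (t : R) x (B : set 'rV[R]_d), 0 < t -> U x ->
        measurable B -> B `<=` U ->
        (P x [set w | in_state B (killed U t w)]
         = \int[@lebesgue_rV R d]_(y in B) (q t x y)%:E)%E].

(* q U stands for q^U. *)
Variable q : set 'rV[R]_d -> R -> 'rV[R]_d -> 'rV[R]_d -> R.

Definition green (U : set 'rV[R]_d) (x y : 'rV[R]_d) : \bar R :=
  (\int[lebesgue_measure]_(t in `]0%R, +oo[) (q U t x y)%:E)%E.

Definition green_ball_estimates (r1 : R) : Prop :=
  exists2 c : R, 1 < c & forall (r : R) z, 0 < r -> r <= r1 ->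
    (forall x y, eball z r x -> eball z r y -> x != y ->
       (green (eball z r) x y <= (c * eucl_dist x y ^ (2 - d%:Z))%:E)%E) /\
    (forall x y, ecball z (2 * r / 3) x -> ecball z (2 * r / 3) y -> x != y ->
       ((c^-1 * eucl_dist x y ^ (2 - d%:Z))%:E <= green (eball z r) x y)%E).

Definition harnack (r2 : R) : Prop :=
  exists2 c : R, 0 < c & forall x0 (r : R) (f : 'rV[R]_d -> R),
    0 < r -> r < r2 ->
    (forall x, eball x0 r x -> 0 < f x) ->
    harmonic_in unkilled (eball x0 r) f ->
    (ereal_sup [set (f x)%:E | x in eball x0 (r / 2)]
     <= c%:E * ereal_inf [set (f x)%:E | x in eball x0 (r / 2)])%E.

(* The quotients are compared where they are defined. *)
Definition boundary_harnack (D : set 'rV[R]_d) (M1 r3 : R) : Prop :=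
  exists2 c : R, 1 < c & forall Q (r : R) (u v : 'rV[R]_d -> R),
    boundary D Q -> 0 < r -> r < r3 ->
    let W := D `&` eball Q (M1 * r) in
    let vanishing f := forall z, (boundary D `&` eball Q (M1 * r)) z ->
      f x @[x --> within D (nbhs z)] --> (0 : R) in
    (forall x, W x -> 0 <= u x /\ 0 <= v x) ->
    harmonic_in (killed D) W u -> harmonic_in (killed D) W v ->
    vanishing u -> vanishing v ->
    forall x y, (D `&` eball Q r) x -> (D `&` eball Q r) y ->
      v x != 0 -> v y != 0 -> u x / v x <= c * (u y / v y).

Definition green_quotients (D : set 'rV[R]_d) (M r0 : R) : Prop :=
  exists2 c : R, 1 < c & forall Q (r : R) x y z1 z2,
    boundary D Q -> 0 < r -> r < r0 ->
    (D `\` eball Q r) x -> (D `\` eball Q r) y ->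
    (D `&` eball Q (r / M)) z1 -> (D `&` eball Q (r / M)) z2 ->
    (green D x z1 / green D y z1 <= c%:E * (green D x z2 / green D y z2))%E /\
    (green D z1 x / green D z1 y <= c%:E * (green D z2 x / green D z2 y))%E.

Definition green_estimates (D : set 'rV[R]_d) (C0 : R) : Prop :=
  forall x y, D x -> D y -> x != y ->
    (green D x y <= (C0 * eucl_dist x y ^ (2 - d%:Z))%:E)%E /\
    (2 * eucl_dist x y <= Num.max (dist_boundary D x) (dist_boundary D y) ->
     ((C0^-1 * eucl_dist x y ^ (2 - d%:Z))%:E <= green D x y)%E).

Definition truncation_level (D : set 'rV[R]_d) (C0 : R) (z0 : 'rV[R]_d) : R :=
  C0 * 2 ^ (d%:Z - 2) * dist_boundary D z0 ^ (2 - d%:Z).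

(* The minimum is finite although the Green function is +oo at (z0, z0). *)
Definition g1 (D : set 'rV[R]_d) (C0 : R) (z0 x : 'rV[R]_d) : R :=
  fine (Order.min (green D x z0) (truncation_level D C0 z0)%:E).

Definition g2 (D : set 'rV[R]_d) (C0 : R) (z0 y : 'rV[R]_d) : R :=
  fine (Order.min (green D z0 y) (truncation_level D C0 z0)%:E).

End diffusion.

Section lipschitz_domains.
Context {R : realType} {d : nat}.
Implicit Type D : set 'rV[R]_d.

(* The columns of O followed by e are the orthonormal basis of the coordinate
   system CS_Q: a point y has coordinates (y - Q) *m O and (y - Q) *m e. *)
Definition lipschitz_chart D (Q : 'rV[R]_d) (R0 Lambda0 : R) : Prop :=
  exists (phi : 'rV[R]_d.-1 -> R) (O : 'M[R]_(d, d.-1)) (e : 'cV[R]_d),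
    [/\ forall u v, `|phi u - phi v| <= Lambda0 * eucl_dist u v,
        O^T *m O = 1%:M, O^T *m e = 0, e^T *m e = 1%:M &
        eball Q R0 `&` D =
        eball Q R0 `&` [set y | phi ((y - Q) *m O) < ((y - Q) *m e) 0 0]].

Definition lipschitz_domain D (R0 Lambda0 : R) : Prop :=
  [/\ open D, connected D, D !=set0, bounded_set D &
      0 < R0 /\ forall Q, boundary D Q -> lipschitz_chart D Q R0 Lambda0].

Definition interior_balls D (R0 kappa0 : R) : Prop :=
  forall Q (r : R), boundary D Q -> 0 < r -> r < R0 ->
    exists A, eball A (kappa0 * r) `<=` D `&` eball Q r.

Definition rmax D (x y : 'rV[R]_d) : R :=
  Num.max (Num.max (dist_boundary D x) (dist_boundary D y)) (eucl_dist x y).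

Definition Bset D (r0 M : R) (z0 x y : 'rV[R]_d) : set 'rV[R]_d :=
  if rmax D x y < r0 / (12 * M) then
    [set A | [/\ D A, M^-1 * rmax D x y < dist_boundary D A &
                 Num.max (eucl_dist x A) (eucl_dist y A) < 5 * rmax D x y]]
  else [set z0].

End lipschitz_domains.

(* Main.v *)
Require Import Defs.
From HB Require Import structures.
From mathcomp Require Import all_boot all_order all_algebra.
From mathcomp Require Import all_classical all_reals all_analysis.
From mathcomp Require Import measurable_realfun.
From mathcomp Require Import ring lra.
Import Order.TTheory GRing.Theory Num.Theory.
Import numFieldNormedType.Exports.
Local Open Scope classical_set_scope.
Local Open Scope ring_scope.

(** Write G for the Green function of D. Two facts carry the estimate.

    The first is that G x y is at least a multiple of |x - y|^(2-d) whenever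
    |x - y| is at most a multiple of the distances of x and y to the boundary
    ([green_nontangential_bound]); the upper bound of that size is a
    hypothesis. It is proved by joining x to y by boundedly many balls
    contained in D. Inside one ball of radius s the Green function of the ball
    is known, but Green functions cannot be concatenated: composing two of them
    costs an infinite amount of time. They are therefore replaced by
    occupation densities [occupation], the integrals of the transition density
    over a bounded window of time. The Chapman-Kolmogorov equation composes
    these at the price of the length of the window ([occupation_compose]), and
    in a ball a window of length K s^2 already carries half of the Green
    function, because what happens later is at most (K s^2)^-1 times the
    composition of the Green function with itself, which is of order s^2 times
    the Green function ([occupation_tail], [occupation_ball]). As all the quantities scale, a chain of a fixed number
    of balls of radius s gives a lower bound c s^(2-d) ([occupation_chain]).
    Near the boundary, such a chain runs up along the axis of a Lipschitz chart,
    across, and down ([chart_chain]); away from the boundary, connectedness of D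
    provides a chain for each pair of points and compactness makes the bound
    uniform ([reaches_all], [green_interior_bound]).

    The Chapman-Kolmogorov equation has to be derived, at every pair of points,
    from the strong Markov property. Survival in an open set over a time
    interval is a limit of events that constrain the path on finite dyadic
    grids, so it inherits the Markov property ([shift_alive]). This gives the
    equation after integration over the end point, and continuity of the
    density removes the integration ([heat_semigroup]).

    The second fact is the comparison of Green quotients near a boundary point
    Q, which is a hypothesis. Choosing its two far poles well, it gives both a
    Harnack inequality for the truncated Green functions h1 and h2 with pole z0
    ([trunc_harnack]) and the replacement of a point x close to the boundary by
    a point x' at distance comparable to |x - y| from the boundary: G x y / h1 x
    and G x' y / h1 x' are comparable ([boundary_reduction]).

    The theorem follows by distinguishing two cases. If |x - y| is small
    compared with the distance of x or y to the boundary, then G x y is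
    comparable to |x - y|^(2-d), and the ratio of truncated Green functions is
    comparable to 1 by the Harnack inequality ([near_diagonal]). Otherwise both
    poles are moved inside, where G x' y' is comparable to |x - y|^(2-d), and
    the Harnack inequality compares x' and y' to A ([off_diagonal]). *)

Set Implicit Arguments.
Unset Strict Implicit.
Unset Printing Implicit Defensive.

(** * Lebesgue measure on row vectors *)

Section countable_base.
Context {R : realType}.

(** This stands in for the equality of the product of two Borel sigma-algebras
    with the Borel sigma-algebra of the product: on second countable spaces an
    open set is a countable union of rectangles. *)
Lemma measurable_prod_countable_base d1 d2 (T1 : measurableType d1)
    (T2 : measurableType d2) (I1 I2 : countType) (B1 : I1 -> set T1)
    (B2 : I2 -> set T2) (W : set (T1 * T2)) :
  (forall i, measurable (B1 i)) -> (forall j, measurable (B2 j)) ->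
  (forall z, W z -> exists i j,
     [/\ B1 i z.1, B2 j z.2 & B1 i `*` B2 j `<=` W]) ->
  measurable W.
Proof.
move=> mB1 mB2 WB.
pose F (ij : I1 * I2) :=
  if `[< B1 ij.1 `*` B2 ij.2 `<=` W >] then B1 ij.1 `*` B2 ij.2 else set0.
have -> : W = \bigcup_ij F ij.
  apply/seteqP; split => [z /WB [i [j [Bi Bj sub]]]|z [ij _]].
    by exists (i, j) => //; rewrite /F /=; case: asboolP.
  by rewrite /F; case: asboolP => // sub /sub.
apply: countable_bigcupT_measurable => [|ij]; first exact: countableP.
by rewrite /F; case: asboolP => // _; exact: measurableX.
Qed.

Lemma open_measurable_rV n (A : set 'rV[R]_n) : open A -> measurable A.
Proof. by move=> oA; exact: sub_sigma_algebra. Qed.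

Lemma closed_measurable_rV n (A : set 'rV[R]_n) : closed A -> measurable A.
Proof.
move=> cA; rewrite -[A]setCK; apply: measurableC.
by apply: open_measurable_rV; exact: closed_openC.
Qed.

Definition rat_ball (qk : rat * nat) : set R := ball (ratr qk.1 : R) (qk.2.+1%:R^-1).

Definition rat_cube n (qk : 'rV[rat]_n * nat) : set 'rV[R]_n :=
  ball (map_mx ratr qk.1 : 'rV[R]_n) (qk.2.+1%:R^-1).

Lemma measurable_rat_ball qk : measurable (rat_ball qk : set (measurableTypeR R)).
Proof. by apply: open_measurable; exact: ball_open. Qed.

Lemma measurable_rat_cube n (qk : 'rV[rat]_n * nat) : measurable (rat_cube qk).
Proof. by apply: open_measurable_rV; exact: ball_open. Qed.

Lemma small_inv (e : R) : 0 < e -> exists k : nat, k.+1%:R^-1 < e.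
Proof.
move=> e0; have [k _ kP] := near_infty_natSinv_lt (PosNum e0).
by exists k; exact: kP k (leqnn _).
Qed.

Lemma rat_ball_base (x : R) U : nbhs x U -> exists2 qk, rat_ball qk x & rat_ball qk `<=` U.
Proof.
rewrite nbhs_ballP => -[e /= e0 xU].
have [k ke] := small_inv (divr_gt0 e0 (ltr0n _ 2)).
have k0 : 0 < (k.+1%:R^-1 : R) by rewrite invr_gt0.
have [y [xy [q _ qy]]] := @dense_rat R (ball x k.+1%:R^-1)
  (ex_intro _ x (ballxx _ k0)) (ball_open _ _).
exists (q, k); rewrite /rat_ball /= qy; first exact: ball_sym.
move=> z yz; apply: xU; apply: (le_ball _ (ball_triangle xy yz)).
by move: ke; move: (k.+1%:R^-1) => a; lra.
Qed.

Lemma rat_cube_base n (x : 'rV[R]_n) U :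
  nbhs x U -> exists2 qk, rat_cube qk x & rat_cube qk `<=` U.
Proof.
rewrite nbhs_ballP => -[e /= e0 xU].
have [k ke] := small_inv (divr_gt0 e0 (ltr0n _ 2)).
have k0 : 0 < (k.+1%:R^-1 : R) by rewrite invr_gt0.
have H i : exists q : rat, ball (x 0 i) k.+1%:R^-1 (ratr q).
  have [y [xy [q _ qy]]] := @dense_rat R (ball (x 0 i) k.+1%:R^-1)
    (ex_intro _ _ (ballxx _ k0)) (ball_open _ _).
  by exists q; rewrite qy.
have [q qP] := choice H.
have xq : ball x k.+1%:R^-1 (map_mx ratr (\row_i q i) : 'rV[R]_n).
  by split=> // i j; rewrite !mxE (ord1 i).
exists (\row_i q i, k); rewrite /rat_cube /=; first exact: ball_sym.
move=> z yz; apply: xU; apply: (le_ball _ (ball_triangle xq yz)).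
by move: ke; move: (k.+1%:R^-1) => a; lra.
Qed.

End countable_base.

Section lebesgue.
Context {R : realType}.

Definition rV_cons n (tv : R * 'rV[R]_n) : 'rV[R]_n.+1 :=
  row_mx (const_mx tv.1 : 'rV[R]_1) tv.2.

Lemma rV_cons0 n (tv : R * 'rV[R]_n) : rV_cons tv 0 ord0 = tv.1.
Proof.
have -> : (ord0 : 'I_n.+1) = lshift n (ord0 : 'I_1) by exact: val_inj.
by rewrite /rV_cons; apply: etrans (row_mxEl _ _ _ _) _; rewrite mxE.
Qed.

Lemma rV_consS n (tv : R * 'rV[R]_n) i :
  rV_cons tv 0 (lift ord0 i) = tv.2 0 i.
Proof.
have -> : (lift ord0 i : 'I_n.+1) = rshift 1 i by exact: val_inj.
exact: row_mxEr.
Qed.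

(** Balls are cubes here, the norm of a row vector being the sup norm; this is
    why they decompose along coordinates. *)
Lemma ball_rV_cons n (x : 'rV[R]_n.+1) r t v : ball x r (rV_cons (t, v)) <->
  ball (x 0 ord0) r t /\ ball (\row_i x 0 (lift ord0 i)) r v.
Proof.
split=> [[r0 xtv]|[xt [r0 xv]]].
  split; first by have := xtv 0 ord0; rewrite rV_cons0.
  split=> // i j; rewrite (ord1 i) !mxE.
  by have := xtv 0 (lift ord0 j); rewrite rV_consS.
split=> // i j; rewrite (ord1 i) ; case: (unliftP ord0 j) => [k|] ->.
  by rewrite rV_consS; have := xv 0 k; rewrite !mxE.
by rewrite rV_cons0.
Qed.

Lemma measurable_rV_cons n :
  measurable_fun setT (@rV_cons n : measurableTypeR R * 'rV[R]_n -> 'rV[R]_n.+1).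
Proof.
apply: (measurability (@open 'rV[R]_n.+1)) => //.
move=> _ [A oA <-]; rewrite setTI.
apply: (measurable_prod_countable_base (@measurable_rat_ball R)
  (@measurable_rat_cube R n)) => -[t v] /= Atv.
have : nbhs (rV_cons (t, v)) A by exact: open_nbhs_nbhs.
rewrite nbhs_ballP => -[e /= e0 sA].
have [qk qkt sqk] := rat_ball_base (nbhsx_ballx t e e0).
have [pj pjv spj] := rat_cube_base (nbhsx_ballx v e e0).
exists qk, pj; split=> // -[t' v'] /= [/sqk tt' /spj vv'].
apply: sA; apply/ball_rV_cons; rewrite rV_cons0; split => //.
rewrite (_ : (\row_i _)%R = v)//; apply/rowP => i.
by rewrite mxE rV_consS.
Qed.

(** Finiteness on cubes is how sigma-finiteness reaches the next dimension in
    [lebesgue_rV_measure]. *)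
Lemma sigma_finite_cubes n (m : {measure set 'rV[R]_n -> \bar R}) :
  (forall r : R, 0 < r -> (m (ball 0%R r) < +oo)%E) -> sigma_finite setT m.
Proof.
move=> mfin; exists (fun k => ball (0 : 'rV[R]_n) k.+1%:R); last first.
  move=> k; split; last by apply: mfin; rewrite ltr0n.
  by apply: open_measurable_rV; exact: ball_open.
apply/seteqP; split => // x _.
have xM : `|x| < (Num.truncn `|x|).+1%:R by rewrite truncnS_gt.
by exists (Num.truncn `|x|) => //; rewrite -ball_normE /= sub0r normrN.
Qed.

Section to_sigma_finite.
Variables (n : nat) (m : {measure set 'rV[R]_n -> \bar R}).
Hypothesis mfin : sigma_finite setT m.

Let m' : set 'rV[R]_n -> \bar R := m.

HB.instance Definition _ := Measure.on m'.
HB.instance Definition _ := Measure_isSigmaFinite.Build _ _ _ m' mfin.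

Lemma to_sigma_finite :
  exists m' : {sigma_finite_measure set 'rV[R]_n -> \bar R},
    (m' : set 'rV[R]_n -> \bar R) = m.
Proof. by exists m'. Qed.

End to_sigma_finite.

(** By induction on the dimension: the iterated integral is the image under
    [rV_cons] of the product of Lebesgue measure on the line with the measure one
    dimension below. Products need sigma-finiteness, which is kept along the
    induction together with the volume of the cubes that yields it. *)
Lemma lebesgue_rV_measure n :
  exists m : {sigma_finite_measure set 'rV[R]_n -> \bar R},
    @lebesgue_rV R n = m /\
    forall (x : 'rV[R]_n) (r : R), 0 < r -> m (ball x r) = ((2 * r) ^+ n)%:E.
Proof.
elim: n => [|n [m [mE mball]]].
  exists (dirac (0 : 'rV[R]_0)); split=> // x r r0 /=.
  rewrite expr0 diracE mem_set//; split => // i j.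
  by case: j.
pose m0 : {measure set 'rV[R]_n.+1 -> \bar R} :=
  pushforward ((@lebesgue_measure R) \x m)%E (@rV_cons n).
pose m' : {measure set 'rV[R]_n.+1 -> \bar R} := m0 (@measurable_rV_cons n).
have m'E : @lebesgue_rV R n.+1 = m'.
  apply/funext => A /=.
  rewrite /m' /m0 /pushforward /product_measure1 /=.
  apply: eq_integral => t _ /=; rewrite mE; congr (m _).
  by apply/seteqP; split => v /=; rewrite /xsection/= inE.
have m'ball (x : 'rV[R]_n.+1) (r : R) : 0 < r -> m' (ball x r) = ((2 * r) ^+ n.+1)%:E.
  move=> r0; pose x' := \row_i x 0 (lift ord0 i).
  have -> : m' (ball x r) =
      ((@lebesgue_measure R) \x m)%E (ball (x 0 ord0) r `*` ball x' r).
    rewrite [LHS]/=; congr (product_measure1 _ _ _).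
    by apply/seteqP; split => -[t v] /= /ball_rV_cons.
  rewrite product_measure1E; last 2 first.
    by apply: open_measurable; exact: ball_open.
    by apply: open_measurable_rV; exact: ball_open.
  rewrite mball//; transitivity ((r *+ 2)%:E * ((2 * r) ^+ n)%:E)%E.
    by congr (_ * _)%E; exact: lebesgue_measure_ball (ltW r0).
  by rewrite -EFinM exprS mulr_natl.
have /to_sigma_finite[m'' m''E] : sigma_finite setT m'.
  by apply: sigma_finite_cubes => r r0; rewrite m'ball// ltry.
by exists m''; rewrite m''E.
Qed.

Lemma lebesgue_rV0 n : lebesgue_rV (set0 : set 'rV[R]_n) = 0%E.
Proof. by have [m [-> _]] := lebesgue_rV_measure n; rewrite measure0. Qed.

Lemma lebesgue_rV_ge0 n (A : set 'rV[R]_n) : (0 <= lebesgue_rV A)%E.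
Proof. by have [m [-> _]] := lebesgue_rV_measure n; rewrite measure_ge0. Qed.

Lemma lebesgue_rV_sigma_additive n :
  semi_sigma_additive (@lebesgue_rV R n).
Proof. by have [m [-> _]] := lebesgue_rV_measure n; exact: measure_semi_sigma_additive. Qed.

HB.instance Definition _ n := isMeasure.Build _ _ _ (@lebesgue_rV R n)
  (lebesgue_rV0 n) (@lebesgue_rV_ge0 n) (@lebesgue_rV_sigma_additive n).

Lemma lebesgue_rV_sigma_finite n : sigma_finite setT (@lebesgue_rV R n).
Proof.
by have [m [-> _]] := lebesgue_rV_measure n; exact: sigma_finiteT.
Qed.

HB.instance Definition _ n := Measure_isSigmaFinite.Build _ _ _ (@lebesgue_rV R n)
  (@lebesgue_rV_sigma_finite n).

Lemma lebesgue_rV_ball n (x : 'rV[R]_n) (r : R) : 0 < r ->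
  lebesgue_rV (ball x r) = ((2 * r) ^+ n)%:E.
Proof. by have [m [-> ]] := lebesgue_rV_measure n; apply. Qed.

Lemma lebesgue_rV_set1 n (x : 'rV[R]_n.+1) : lebesgue_rV [set x] = 0%E.
Proof.
apply/eqP; rewrite eq_le measure_ge0 andbT; apply/lee_addgt0Pr => e e0.
rewrite add0e; pose r := Num.min 1 e : R.
have r0 : 0 < r by rewrite lt_min ltr01.
apply: (@le_trans _ _ (lebesgue_rV (ball x (r / 2)))).
  apply: le_measure; rewrite ?inE; last first.
  - by move=> _ ->; apply: ballxx; rewrite divr_gt0.
  - by apply: open_measurable_rV; exact: ball_open.
  - apply: closed_measurable_rV.
    by apply: accessible_closed_set1; exact: hausdorff_accessible.
rewrite lebesgue_rV_ball ?divr_gt0// mulrC divfK// lee_fin.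
apply: (@le_trans _ _ r); last by rewrite ge_min lexx orbT.
rewrite exprS ler_piMr ?(ltW r0)// exprn_ile1 ?(ltW r0)//.
by rewrite ge_min lexx.
Qed.
End lebesgue.

(** * Euclidean distance and balls *)

Section euclid.
Context {R : realType}.

Lemma cauchy_schwarz (I : finType) (a b : I -> R) :
  (\sum_i a i * b i) ^+ 2 <= (\sum_i a i ^+ 2) * (\sum_i b i ^+ 2).
Proof.
set C := \sum_i a i * b i; set A := \sum_i _; set B := \sum_i b i ^+ 2.
have B0 : 0 <= B by apply: sumr_ge0 => i _; exact: sqr_ge0.
have [B00|Bn0] := eqVneq B 0.
  have b0 i : b i = 0.
    apply/eqP; rewrite -sqrf_eq0; apply/eqP.
    have /psumr_eq0P : \sum_i b i ^+ 2 = 0 by [].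
    by apply => // j _; exact: sqr_ge0.
  rewrite B00 mulr0 /C big1 ?expr0n// => i _.
  by rewrite b0 mulr0.
have Bp : 0 < B by rewrite lt_neqAle eq_sym Bn0.
have : 0 <= \sum_i (B * a i - C * b i) ^+ 2.
  by apply: sumr_ge0 => i _; exact: sqr_ge0.
rewrite (eq_bigr (fun i => B ^+ 2 * a i ^+ 2 - 2 * B * C * (a i * b i)
    + C ^+ 2 * b i ^+ 2)); last by move=> i _; ring.
rewrite big_split sumrB /= -!mulr_sumr -/A -/B -/C.
rewrite (_ : _ + _ = B * (A * B - C ^+ 2)); last by ring.
by rewrite pmulr_rge0// subr_ge0.
Qed.

Section norm.
Variable n : nat.
Implicit Types x y z : 'rV[R]_n.

Lemma eucl_norm_ge0 x : 0 <= eucl_norm x.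
Proof. exact: sqrtr_ge0. Qed.

Lemma eucl_norm_sqr x : eucl_norm x ^+ 2 = \sum_i x 0 i ^+ 2.
Proof. by rewrite sqr_sqrtr// sumr_ge0// => i _; exact: sqr_ge0. Qed.

Lemma eucl_norm0 : eucl_norm (0 : 'rV[R]_n) = 0.
Proof.
by rewrite /eucl_norm big1 ?sqrtr0// => i _; rewrite mxE expr0n.
Qed.

Lemma eucl_normN x : eucl_norm (- x) = eucl_norm x.
Proof.
by rewrite /eucl_norm; congr Num.sqrt; apply: eq_bigr => i _; rewrite mxE sqrrN.
Qed.

Lemma eucl_normZ (k : R) x : eucl_norm (k *: x) = `|k| * eucl_norm x.
Proof.
rewrite /eucl_norm -sqrtr_sqr -sqrtrM ?sqr_ge0//; congr Num.sqrt.
by rewrite mulr_sumr; apply: eq_bigr => i _; rewrite mxE exprMn.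
Qed.

Lemma eucl_normD x y : eucl_norm (x + y) <= eucl_norm x + eucl_norm y.
Proof.
rewrite -(ler_pXn2r (ltn0Sn 1)) ?nnegrE ?addr_ge0 ?eucl_norm_ge0//.
rewrite sqrrD !eucl_norm_sqr.
rewrite (eq_bigr (fun i => x 0 i ^+ 2 + 2 * (x 0 i * y 0 i) + y 0 i ^+ 2)); last first.
  by move=> i _; rewrite mxE; ring.
rewrite !big_split /= -mulr_sumr lerD2r lerD2l -[leRHS]mulr_natl ler_pM2l//.
apply: (le_trans (ler_norm _)); rewrite -sqrtr_sqr -sqrtrM; last first.
  by rewrite sumr_ge0// => i _; exact: sqr_ge0.
by apply: ler_wsqrtr; exact: cauchy_schwarz.
Qed.

Lemma coord_le_eucl_norm x i : `|x 0 i| <= eucl_norm x.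
Proof.
rewrite -sqrtr_sqr; apply: ler_wsqrtr.
by rewrite (bigD1 i)//= lerDl sumr_ge0// => j _; exact: sqr_ge0.
Qed.

Lemma eucl_norm_le_coord x (r : R) : (forall i, `|x 0 i| <= r) ->
  eucl_norm x <= n%:R * r.
Proof.
move=> xr; case: (posnP n) => [n0|n0].
  rewrite /eucl_norm big1 ?sqrtr0; last first.
    move=> i; have := leq_ltn_trans (leq0n i) (ltn_ord i).
    by move=> np; exfalso; move: np; rewrite n0.
  by rewrite n0 mul0r.
have r0 : 0 <= r by exact: le_trans (normr_ge0 _) (xr (Ordinal n0)).
rewrite -(ler_pXn2r (ltn0Sn 1)) ?nnegrE ?mulr_ge0 ?eucl_norm_ge0//.
rewrite eucl_norm_sqr.
apply: (@le_trans _ _ (\sum_(i < n) r ^+ 2)).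
  by apply: ler_sum => i _; rewrite -real_normK ?num_real// ler_pXn2r// nnegrE.
rewrite sumr_const card_ord exprMn -[leLHS]mulr_natl ler_wpM2r ?sqr_ge0//.
by rewrite expr2 ler_peMr// ler1n.
Qed.

Lemma eucl_norm_eq0 x : (eucl_norm x == 0) = (x == 0).
Proof.
apply/idP/idP => [/eqP x0|/eqP ->]; last by rewrite eucl_norm0.
apply/eqP/rowP => i; rewrite mxE; apply/eqP; rewrite -normr_le0 -x0.
exact: coord_le_eucl_norm.
Qed.

Lemma eucl_dist_ge0 x y : 0 <= eucl_dist x y.
Proof. exact: eucl_norm_ge0. Qed.

Lemma eucl_distxx x : eucl_dist x x = 0.
Proof. by rewrite /eucl_dist subrr eucl_norm0. Qed.

Lemma eucl_distC x y : eucl_dist x y = eucl_dist y x.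
Proof. by rewrite /eucl_dist -eucl_normN opprB. Qed.

Lemma eucl_dist_tri y x z : eucl_dist x z <= eucl_dist x y + eucl_dist y z.
Proof. by rewrite /eucl_dist (le_trans _ (eucl_normD _ _))// addrA subrK. Qed.

Lemma eucl_dist_gt0 x y : (0 < eucl_dist x y) = (x != y).
Proof. by rewrite lt_neqAle eucl_dist_ge0 andbT eq_sym eucl_norm_eq0 subr_eq0. Qed.

Lemma eball_sub_ball x (r : R) : eball x r `<=` ball x r.
Proof.
move=> y xy; have r0 : 0 < r by exact: le_lt_trans (eucl_dist_ge0 _ _) xy.
split=> // i j; rewrite (ord1 i) -ball_normE /=.
by rewrite (le_lt_trans _ xy)// (le_trans _ (coord_le_eucl_norm _ j))// !mxE.
Qed.

(** The factor is n + 1 rather than n so that the inclusion survives in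
    dimension 0. *)
Lemma ball_sub_eball x (r : R) : ball x r `<=` eball x (n.+1%:R * r).
Proof.
move=> y [r0 xy]; apply: (@le_lt_trans _ _ (n%:R * r)); last first.
  by rewrite ltr_pM2r// ltr_nat.
apply: eucl_norm_le_coord => i.
by have := xy 0 i; rewrite -ball_normE /= !mxE => /ltW.
Qed.

Lemma eballxx x (r : R) : 0 < r -> eball x r x.
Proof. by rewrite /eball /= eucl_distxx. Qed.

Lemma le_eball x (r s : R) : r <= s -> eball x r `<=` eball x s.
Proof. by move=> rs y xy; exact: lt_le_trans xy rs. Qed.

Lemma sub_eball x y (r s : R) : eucl_dist x y + r <= s ->
  eball y r `<=` eball x s.
Proof.
move=> xyr z yz; apply: le_lt_trans (eucl_dist_tri y _ _) _.
by apply: lt_le_trans xyr; rewrite ltrD2l.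
Qed.

Lemma nbhs_eball x (r : R) : 0 < r -> nbhs x (eball x r).
Proof.
move=> r0; rewrite nbhs_ballP; exists (r / n.+1%:R); first by rewrite /= divr_gt0.
by apply: subset_trans (@ball_sub_eball _ _) _; rewrite mulrC divfK// pnatr_eq0.
Qed.

Lemma nbhs_eballP x (A : set 'rV[R]_n) :
  nbhs x A <-> exists2 r : R, 0 < r & eball x r `<=` A.
Proof.
split=> [|[r r0 rA]]; last exact: filterS (nbhs_eball _ r0).
rewrite nbhs_ballP => -[r r0 rA]; exists r => //.
by apply: subset_trans rA; exact: eball_sub_ball.
Qed.

Lemma open_eball x (r : R) : open (eball x r).
Proof.
rewrite openE => y xy; apply/nbhs_eballP; exists (r - eucl_dist x y).
  by rewrite subr_gt0.
by apply: sub_eball; rewrite addrC subrK.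
Qed.

Lemma eucl_dist_continuous x : continuous (eucl_dist x).
Proof.
move=> y; apply/(@cvgrPdist_lt _ _ _ _ (nbhs_filter y)) => e e0.
apply: filterS (nbhs_eball y e0) => z yz.
rewrite ltr_norml; apply/andP; split.
- by rewrite ltrBrDl ltrBlDr; apply: (le_lt_trans (eucl_dist_tri y _ _)); rewrite ltrD2l.
- rewrite ltrBlDr; apply: (le_lt_trans (eucl_dist_tri z _ _)).
  by rewrite addrC ltrD2r eucl_distC.
Qed.

Lemma bounded_set_eball (A : set 'rV[R]_n) :
  bounded_set A -> exists2 r : R, 0 < r & A `<=` eball 0 r.
Proof.
move=> [M [_ AM]]; pose B := Num.max 1 (M + 1).
have B0 : 0 < B by rewrite lt_max ltr01.
have MB : M < B by rewrite lt_max ltrDl ltr01 orbT.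
exists (n.+1%:R * (B + 1)); first by rewrite mulr_gt0// addr_gt0.
move=> x Ax; apply: ball_sub_eball; rewrite -ball_normE /= sub0r normrN.
by rewrite (le_lt_trans (AM B MB x Ax))// ltrDl.
Qed.

Lemma eball_bounded x (r : R) : bounded_set (eball x r).
Proof.
exists (`|x| + r); split; first exact: num_real.
move=> s xs y /eball_sub_ball; rewrite -ball_normE /= => xy.
rewrite (le_trans _ (ltW xs))// -[y](subKr x) (le_trans (ler_normB _ _))//.
by rewrite lerD2l ltW.
Qed.

End norm.
End euclid.

(** * Integrals of the Newtonian kernel *)

Section newton.
Context {R : realType} {d : nat}.
Hypothesis hd : (2 < d)%N.
Implicit Types (x y w : 'rV[R]_d) (r s : R).

Definition newton x y : R := eucl_dist x y ^ (2 - d%:Z).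

Lemma exprz_newton s : s ^ (2 - d%:Z) = (s ^+ (d - 2))^-1.
Proof.
rewrite -[LHS]/(s ^ (2 - d%:Z)) (_ : 2 - d%:Z = - (d - 2)%N%:Z) -?exprnN//.
by rewrite -subzn ?opprB// ltnW.
Qed.

Lemma newton_antimono r s : 0 < r -> r <= s -> s ^ (2 - d%:Z) <= r ^ (2 - d%:Z).
Proof.
move=> r0 rs; have s0 := lt_le_trans r0 rs; rewrite !exprz_newton lef_pV2 ?posrE ?exprn_gt0//.
by rewrite lerXn2r ?nnegrE// ltW.
Qed.

Lemma newtonC x y : newton x y = newton y x.
Proof. by rewrite /newton eucl_distC. Qed.

Lemma newton_ge0 x y : 0 <= newton x y.
Proof. by rewrite /newton exprz_newton invr_ge0 exprn_ge0// eucl_dist_ge0. Qed.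

Lemma newton_gt0 x y : x != y -> 0 < newton x y.
Proof. by move=> xy; rewrite /newton exprz_newton invr_gt0 exprn_gt0// eucl_dist_gt0. Qed.

Lemma measurable_eball x r : measurable (eball x r).
Proof. by apply: open_measurable_rV; exact: open_eball. Qed.

Lemma measurable_set1_rV x : measurable [set x].
Proof.
apply: closed_measurable_rV.
by apply: accessible_closed_set1; exact: hausdorff_accessible.
Qed.

Lemma lebesgue_rV_point x : lebesgue_rV [set x] = 0%E.
Proof. by case: d hd x => // n _ x; exact: lebesgue_rV_set1. Qed.

Lemma continuous_measurable_rV (f : 'rV[R]_d -> R) :
  continuous f -> measurable_fun setT f.
Proof.
move=> /continuousP cf; apply: (measurability _ (RGenOpens.measurableE R)).
move=> _ [_ [a [b ->] <-]]; rewrite setTI.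
by apply: open_measurable_rV; apply: cf; exact: interval_open.
Qed.

Lemma measurable_invr : measurable_fun setT (fun s : R => s^-1).
Proof.
rewrite -(setvU [set (0 : R)]).
have m0 : measurable [set (0 : R)] by exact: measurable_set1.
apply/measurable_funU => //; first exact: measurableC.
split; last exact: measurable_fun_set1.
apply: open_continuous_measurable_fun => [|s].
  apply: closed_openC; apply: accessible_closed_set1; exact: hausdorff_accessible.
rewrite inE => /eqP s0; exact: inv_continuous.
Qed.

Lemma measurable_newton x : measurable_fun setT (newton x).
Proof.
have -> : newton x = (fun s : R => s^-1) \o (fun y => eucl_dist x y ^+ (d - 2)).
  by apply/funext => y; rewrite /newton exprz_newton.
apply: measurableT_comp; first exact: measurable_invr.
by apply: measurable_funX; apply: continuous_measurable_rV; exact: eucl_dist_continuous.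
Qed.

Lemma lebesgue_rV_eball_le x r : 0 < r ->
  (lebesgue_rV (eball x r) <= ((2 * r) ^+ d)%:E)%E.
Proof.
move=> r0; rewrite -(lebesgue_rV_ball x)//; apply: le_measure; rewrite ?inE.
- exact: measurable_eball.
- by apply: open_measurable_rV; exact: ball_open.
- exact: eball_sub_ball.
Qed.

Lemma lebesgue_rV_eball_ge x r : 0 < r ->
  (((2 * (r / d.+1%:R)) ^+ d)%:E <= lebesgue_rV (eball x r))%E.
Proof.
move=> r0; rewrite -(lebesgue_rV_ball x); last by rewrite divr_gt0.
apply: le_measure; rewrite ?inE.
- by apply: open_measurable_rV; exact: ball_open.
- exact: measurable_eball.
- apply: subset_trans (@ball_sub_eball _ _ _ _) _.
  by rewrite mulrC divfK ?pnatr_eq0.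
Qed.

Definition shell x r (k : nat) : set 'rV[R]_d :=
  eball x (r / 2 ^+ k) `\` eball x (r / 2 ^+ k.+1).

Lemma shell_trivIset x r : 0 < r -> trivIset setT (shell x r).
Proof.
move=> r0.
have H i j z : (i < j)%N -> shell x r i z -> shell x r j z -> False.
  move=> ij [_ zi] [zj _]; apply: zi; apply: le_eball zj.
  rewrite ler_pM2l// lef_pV2 ?posrE ?exprn_gt0//.
  by rewrite ler_eXn2l// ltr1n.
move=> i j _ _ [z [zi zj]]; case: (ltngtP i j) => // ij; exfalso.
  exact: H ij zi zj.
exact: H ij zj zi.
Qed.

Lemma eball_shells x r : 0 < r -> eball x r `\ x = \bigcup_k shell x r k.
Proof.
move=> r0; apply/seteqP; split => [y [xy yx]|y [k _ [yk nyk]]]; last first.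
  split; last by move=> yx; apply: nyk; rewrite yx; apply: eballxx; rewrite divr_gt0// exprn_gt0.
  apply: le_eball yk; rewrite ler_pdivrMr ?exprn_gt0// ler_peMr ?(ltW r0)//.
  by rewrite exprn_ege1// ler1n.
have xy0 : 0 < eucl_dist x y by rewrite eucl_dist_gt0; apply/eqP => /esym.
have ex : exists k : nat, r / 2 ^+ k.+1 <= eucl_dist x y.
  have [k kP] := small_inv (divr_gt0 xy0 r0).
  exists k; rewrite ler_pdivrMr ?exprn_gt0//.
  rewrite -ler_pdivrMl//; apply: (@le_trans _ _ k.+1%:R).
    rewrite ler_pdivrMl// mulrC.
    by move: kP; rewrite ltr_pdivlMr// ltr_pdivrMl// => /ltW.
  by rewrite -natrX ler_nat; apply: ltnW; exact: ltn_expl.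
case: (ex_minnP ex) => k kx kmin; exists k => //; split; last first.
  by rewrite /eball /= => yk; move: (le_lt_trans kx yk); rewrite ltxx.
case: k kx kmin => [|k] _ kmin; first by rewrite expr0 divr1.
rewrite /eball /= ltNge; apply/negP => /kmin; by rewrite ltnn.
Qed.

Lemma integral_newton_eball x r : 0 < r ->
  (\int[@lebesgue_rV R d]_(w in eball x r) (newton x w)%:E <= (4 ^+ d * r ^+ 2)%:E)%E.
Proof.
move=> r0.
have mN A : measurable_fun A (EFin \o newton x).
  by apply/measurable_EFinP; apply: measurable_funTS; exact: measurable_newton.
have msh k : measurable (shell x r k) by apply: measurableD; exact: measurable_eball.
rewrite (@ge0_negligible_integral _ _ _ _ _ [set x])//; last 4 first.
- exact: measurable_set1_rV.
- exact: measurable_eball.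
- by move=> y _; rewrite lee_fin newton_ge0.
- exact: lebesgue_rV_point.
rewrite eball_shells//.
have E0 y : (\bigcup_k shell x r k) y -> (0 <= (newton x y)%:E)%E.
  by rewrite lee_fin newton_ge0.
rewrite (ge0_integral_bigcup _ msh (mN _) E0 (shell_trivIset r0)).
have cr0 : 0 <= 4 ^+ d * r ^+ 2 by rewrite mulr_ge0 ?exprn_ge0// ltW.
(* The shells contribute a geometric series; it is compared termwise with
   the terms 2^-(k+1) times the total. *)
apply: le_trans (epsilon_trick0 xpredT cr0); apply: lee_nneseries => [k _ _|k _].
  by apply: integral_ge0 => y _; rewrite lee_fin newton_ge0.
pose s := r / 2 ^+ k.+1.
have s0 : 0 < s by rewrite divr_gt0// exprn_gt0.
apply: (@le_trans _ _ (\int[@lebesgue_rV R d]_(w in shell x r k) cst (s ^ (2 - d%:Z))%:E w)%E).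
  apply: ge0_le_integral => //.
  - by move=> y _; rewrite lee_fin newton_ge0.
  - by move=> y [_ /negP]; rewrite -leNgt lee_fin; exact: newton_antimono.
rewrite integral_cst//.
(* On the shell between s and 2 s the kernel is at most s^(2-d) and the
   volume at most (4 s)^d. *)
have -> : 4 ^+ d * r ^+ 2 / (2 ^ k.+1)%:R = (s ^ (2 - d%:Z)) * (4 ^+ d * s ^+ d) * 2 ^+ k.+1.
  rewrite exprz_newton natrX.
  have -> : s ^+ d = s ^+ (d - 2) * s ^+ 2 by rewrite -exprD subnK// ltnW.
  rewrite /s -[r in LHS](@divfK _ (2 ^+ k.+1)); last by rewrite expf_neq0.
  by field; rewrite !expf_neq0 ?gt_eqF ?divr_gt0 ?exprn_gt0.
apply: (@le_trans _ _ ((s ^ (2 - d%:Z)) * (4 ^+ d * s ^+ d))%:E); last first.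
  rewrite lee_fin ler_peMr// ?exprn_ege1 ?ler1n//.
  by rewrite !mulr_ge0 ?exprn_ge0 ?exprz_newton ?invr_ge0 ?exprn_ge0// ltW.
rewrite EFinM; apply: lee_wpmul2l.
  by rewrite lee_fin exprz_newton invr_ge0 exprn_ge0// ltW.
apply: (@le_trans _ _ (lebesgue_rV (eball x (r / 2 ^+ k)))).
  apply: le_measure; rewrite ?inE //; first exact: measurable_eball.
  by move=> y [].
apply: le_trans (lebesgue_rV_eball_le _ _) _; first by rewrite divr_gt0// exprn_gt0.
rewrite lee_fin -exprMn (_ : 4 * s = 2 * (r / 2 ^+ k))// /s exprS.
by field; rewrite expf_neq0.
Qed.

(** Each point is at distance at least half of |x - y| from one of the two poles.
    The kernel at that pole is at most a multiple of newton x y, so that only the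
    other one is left to integrate. *)
Lemma integral_newton_mul w x y s : 0 < s -> eball w s x -> eball w s y ->
  x != y ->
  (\int[@lebesgue_rV R d]_(v in eball w s) (newton x v * newton v y)%:E
   <= (8 * 8 ^+ d * newton x y * s ^+ 2)%:E)%E.
Proof.
move=> s0 wx wy xy.
pose h := eucl_dist x y / 2.
have h0 : 0 < h by rewrite divr_gt0// eucl_dist_gt0.
have hn : h ^ (2 - d%:Z) <= 2 ^+ d * newton x y.
  rewrite /newton !exprz_newton /h expr_div_n invf_div ler_wpM2r//.
    by rewrite invr_ge0 exprn_ge0// eucl_dist_ge0.
  by rewrite ler_eXn2l ?ltr1n// leq_subr.
have hn0 : 0 <= h ^ (2 - d%:Z) by rewrite exprz_newton invr_ge0 exprn_ge0// ltW.
have mN z A : measurable_fun A (EFin \o newton z).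
  by apply/measurable_EFinP; apply: measurable_funTS; exact: measurable_newton.
have mN' z A : measurable_fun A (newton z).
  by apply: measurable_funTS; exact: measurable_newton.
have NE : newton^~ y = newton y by apply/funext => v; exact: newtonC.
have half z : eball w s z ->
    (\int[@lebesgue_rV R d]_(v in eball w s) (newton z v)%:E
     <= (4 ^+ d * (2 * s) ^+ 2)%:E)%E.
  move=> wz; apply: le_trans (integral_newton_eball z (_ : 0 < 2 * s)); last by rewrite mulr_gt0.
  apply: ge0_subset_integral; [exact: measurable_eball..|exact: mN| |].
  - by move=> v _; rewrite lee_fin newton_ge0.
  - by apply: sub_eball; rewrite mulr_natl mulr2n lerD2r eucl_distC ltW.
apply: (@le_trans _ _ (\int[@lebesgue_rV R d]_(v in eball w s)
   ((h ^ (2 - d%:Z))%:E * ((newton x v)%:E + (newton y v)%:E)))%E).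
  apply: ge0_le_integral; first exact: measurable_eball.
  - by move=> v _; rewrite lee_fin mulr_ge0 ?newton_ge0.
  - by apply/measurable_EFinP; apply: measurable_funM; rewrite ?NE; exact: mN'.
  - apply: emeasurable_funM; first exact: measurable_cst.
    by apply: emeasurable_funD; exact: mN.
  - move=> v _; rewrite -EFinD -EFinM lee_fin (newtonC v y).
    have [vx|vx] := leP h (eucl_dist x v).
      rewrite mulrDr; apply: (@le_trans _ _ (h ^ (2 - d%:Z) * newton y v)).
        by rewrite ler_wpM2r ?newton_ge0//; exact: newton_antimono.
      by rewrite lerDr mulr_ge0// newton_ge0.
    have vy : h <= eucl_dist y v.
      rewrite leNgt; apply/negP => vy.
      have := eucl_dist_tri v x y; rewrite (eucl_distC v y) leNgt => /negP; apply.
      by move: vx vy; rewrite /h; lra.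
    rewrite mulrDr; apply: (@le_trans _ _ (h ^ (2 - d%:Z) * newton x v)).
      by rewrite mulrC ler_wpM2r ?newton_ge0//; exact: newton_antimono.
    by rewrite lerDl mulr_ge0// newton_ge0.
rewrite ge0_integralZl_EFin//; last 3 first.
- exact: measurable_eball.
- by move=> v _; rewrite adde_ge0// lee_fin newton_ge0.
- by apply: emeasurable_funD; exact: mN.
rewrite ge0_integralD; last 5 first.
- exact: measurable_eball.
- by move=> v _; rewrite lee_fin newton_ge0.
- exact: mN.
- by move=> v _; rewrite lee_fin newton_ge0.
- exact: mN.
apply: (@le_trans _ _ ((2 ^+ d * newton x y)%:E *
    ((4 ^+ d * (2 * s) ^+ 2)%:E + (4 ^+ d * (2 * s) ^+ 2)%:E))%E).
  apply: lee_pmul; [by rewrite lee_fin| |by rewrite lee_fin|by apply: leeD; exact: half].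
  by apply: adde_ge0; apply: integral_ge0 => v _; rewrite lee_fin newton_ge0.
rewrite -EFinD -EFinM lee_fin le_eqVlt; apply/orP; left; apply/eqP.
rewrite (_ : 8 ^+ d = 2 ^+ d * 4 ^+ d); last by rewrite -exprMn; congr (_ ^+ _); ring.
by ring.
Qed.

End newton.

(** * Integrals against mixtures of measures *)

Section mixtures.
Context {R : realType} d (T : measurableType d).
Local Open Scope ereal_scope.
Import HBNNSimple.

Section one_mixture.
Context dS (S : measurableType dS) (m : {measure set S -> \bar R}) (E : set S).
Variable k : S -> {measure set T -> \bar R}.
Hypotheses (mE : measurable E)
  (mk : forall B, measurable B -> measurable_fun E (fun z => k z B)).

Lemma integral_nnsfun_sum (nu : {measure set T -> \bar R}) (f : {nnsfun T >-> R}) :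
  \int[nu]_y (f y)%:E =
  \sum_(r \in range f) (Num.max r 0%R)%:E * nu (f @^-1` [set r]).
Proof.
under eq_integral do rewrite fimfunE -fsumEFin//.
rewrite ge0_integral_fsum//; last 2 first.
  - by move=> r; exact/measurable_EFinP/measurableT_comp.
  - by move=> r z _; rewrite EFinM nnfun_muleindic_ge0.
apply: eq_fsbigr => r; rewrite inE => -[z _ <-].
rewrite (integralZl_indic _ (fun r => f @^-1` [set r]))//; last first.
  by move=> r0; rewrite preimage_nnfun0.
by rewrite integral_indic// setIT; congr (_%:E * _); rewrite max_l.
Qed.

Lemma measurable_integral_nnsfun (f : {nnsfun T >-> R}) :
  measurable_fun E (fun z => \int[k z]_y (f y)%:E).
Proof.
under eq_fun do rewrite integral_nnsfun_sum.
apply: emeasurable_fsum => // r; apply: measurable_funeM; exact: mk.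
Qed.

Lemma integral_mixture_nnsfun (f : {nnsfun T >-> R}) :
  \int[m]_(z in E) \int[k z]_y (f y)%:E =
  \sum_(r \in range f) (Num.max r 0%R)%:E * \int[m]_(z in E) k z (f @^-1` [set r]).
Proof.
under eq_integral do rewrite integral_nnsfun_sum.
rewrite ge0_integral_fsum//; last 2 first.
- by move=> r; apply: measurable_funeM; exact: mk.
- by move=> r z _; rewrite mule_ge0// lee_fin le_max lexx orbT.
apply: eq_fsbigr => r _; rewrite ge0_integralZl//; first exact: mk.
by rewrite lee_fin le_max lexx orbT.
Qed.

Lemma integral_mixture_lim (f : T -> \bar R) (f0 : forall y, 0 <= f y)
    (mf : measurable_fun setT f) :
  \int[m]_(z in E) \int[k z]_y f y =
  limn (fun n => \int[m]_(z in E) \int[k z]_y (nnsfun_approx measurableT mf n y)%:E).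
Proof.
pose f_ := nnsfun_approx measurableT mf.
have fE (nu : {measure set T -> \bar R}) :
    \int[nu]_y f y = limn (fun n => \int[nu]_y (f_ n y)%:E).
  rewrite -monotone_convergence//; last 3 first.
  - by move=> n; exact/measurable_EFinP.
  - by move=> n y _; rewrite lee_fin.
  - by move=> y _ a b ab; rewrite lee_fin; exact/lefP/nd_nnsfun_approx.
  by apply: eq_integral => y _; apply/esym/cvg_lim => //; exact: cvg_nnsfun_approx.
under eq_integral do rewrite fE.
rewrite monotone_convergence//.
- by move=> n; exact: measurable_integral_nnsfun.
- by move=> n z _; apply: integral_ge0 => y _; rewrite lee_fin.
- move=> z _ a b ab; apply: ge0_le_integral => //.
  + by move=> y _; rewrite lee_fin.
  + exact/measurable_EFinP.
  + exact/measurable_EFinP.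
  + by move=> y _; rewrite lee_fin; exact/lefP/nd_nnsfun_approx.
Qed.

End one_mixture.

(** Equality on sets passes to simple functions by linearity and to nonnegative
    measurable functions by two monotone limits, one under each integral sign. *)
Lemma eq_integral_mixture dS (S : measurableType dS) (m : {measure set S -> \bar R})
    (E : set S) (k : S -> {measure set T -> \bar R})
    dS' (S' : measurableType dS') (m' : {measure set S' -> \bar R})
    (E' : set S') (k' : S' -> {measure set T -> \bar R}) (f : T -> \bar R) :
  measurable E -> (forall B, measurable B -> measurable_fun E (fun z => k z B)) ->
  measurable E' -> (forall B, measurable B -> measurable_fun E' (fun z => k' z B)) ->
  (forall B, measurable B -> \int[m]_(z in E) k z B = \int[m']_(z in E') k' z B) ->
  (forall y, 0 <= f y) -> measurable_fun setT f ->
  \int[m]_(z in E) \int[k z]_y f y = \int[m']_(z in E') \int[k' z]_y f y.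
Proof.
move=> mE mk mE' mk' kk' f0 mf.
rewrite (integral_mixture_lim m mE mk f0 mf) (integral_mixture_lim m' mE' mk' f0 mf).
apply: (congr1 (fun u : (\bar R)^nat => limn u)); apply/funext => n; rewrite !integral_mixture_nnsfun//.
by apply: eq_fsbigr => r _; rewrite kk'.
Qed.

(** The special case in which one of the two mixtures is the law of a random
    variable Y restricted to an event, which is the mixture of the Dirac masses
    at the values of Y. *)
Lemma eq_integral_law dS (S : measurableType dS) (m : {measure set S -> \bar R})
    (E : set S) (Y : S -> T)
    dS' (S' : measurableType dS') (m' : {measure set S' -> \bar R})
    (E' : set S') (k' : S' -> {measure set T -> \bar R}) (f : T -> \bar R) :
  measurable E -> measurable_fun setT Y ->
  measurable E' -> (forall B, measurable B -> measurable_fun E' (fun z => k' z B)) ->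
  (forall B, measurable B -> m (E `&` Y @^-1` B) = \int[m']_(z in E') k' z B) ->
  (forall y, 0 <= f y) -> measurable_fun setT f ->
  \int[m]_(z in E) f (Y z) = \int[m']_(z in E') \int[k' z]_y f y.
Proof.
move=> mE mY mE' mk' Yk' f0 mf.
have dE B z : dirac (Y z) B = (\1_(Y @^-1` B) z)%:E :> \bar R.
  by rewrite /dirac !indicE.
have mYB B : measurable B -> measurable (Y @^-1` B).
  by move=> mB; rewrite -[X in measurable X]setTI; exact: mY.
rewrite -(@eq_integral_mixture _ _ m E (fun z => dirac (Y z)))//.
- by apply: eq_integral => z _; rewrite integral_dirac// diracT mul1e.
- move=> B mB; rewrite (_ : (fun z => _) = fun z => (\1_(Y @^-1` B) z)%:E); last first.
    by apply/funext => z; exact: dE.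
  by apply/measurable_EFinP; apply: measurable_indic; exact: mYB.
- move=> B mB; transitivity (\int[m]_(z in E) (\1_(Y @^-1` B) z)%:E).
    by apply: eq_integral => z _; exact: dE.
  by rewrite (integral_indic _ mE (mYB _ mB)) setIC (Yk' _ mB).
Qed.

End mixtures.

(** * The Markov property for cylinder events *)

Section markov.
Context {R : realType} {d : nat}.
Context {dO : measure_display} {Omega : measurableType dO}.
Variables (P : 'rV[R]_d -> probability Omega R) (X : R -> Omega -> 'rV[R]_d).
Hypotheses (Xm : forall t : R, 0 <= t -> measurable_fun setT (X t))
  (XM : strong_markov P X).
Implicit Types (t s : R) (x z : 'rV[R]_d) (B : set 'rV[R]_d).

Lemma natural_events_mono (I J : set R) : I `<=` J ->
  natural_events X I `<=` natural_events X J.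
Proof.
move=> IJ; apply: sub_sigma_algebra2 => _ [t It [B mB <-]].
by exists t; [exact: IJ|exists B].
Qed.

Lemma natural_eventsX (I : set R) t B : I t -> measurable B ->
  natural_events X I (X t @^-1` B).
Proof. by move=> It mB; apply: sub_sigma_algebra; exists t => //; exists B. Qed.

Lemma natural_eventsT (I : set R) : natural_events X I setT.
Proof. exact: (@measurableT _ (g_sigma_algebraType
  [set X s @^-1` B | s in I & B in measurable])). Qed.

Lemma natural_eventsI (I : set R) E F : natural_events X I E ->
  natural_events X I F -> natural_events X I (E `&` F).
Proof. exact: (@measurableI _ (g_sigma_algebraType
  [set X s @^-1` B | s in I & B in measurable])). Qed.

Lemma natural_events_bigcap (I : set R) (E : nat -> set Omega) :
  (forall n, natural_events X I (E n)) -> natural_events X I (\bigcap_n E n).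
Proof. exact: (@bigcapT_measurable _ (g_sigma_algebraType
  [set X s @^-1` B | s in I & B in measurable])). Qed.

Lemma natural_events_bigcup (I : set R) (E : nat -> set Omega) :
  (forall n, natural_events X I (E n)) -> natural_events X I (\bigcup_n E n).
Proof. exact: (@bigcupT_measurable _ (g_sigma_algebraType
  [set X s @^-1` B | s in I & B in measurable])). Qed.

Lemma measurable_preimageX t B : 0 <= t -> measurable B -> measurable (X t @^-1` B).
Proof. by move=> t0 mB; rewrite -[X in measurable X]setTI; exact: Xm. Qed.

Lemma natural_events_measurable (I : set R) : I `<=` [set t | 0 <= t] ->
  natural_events X I `<=` measurable.
Proof.
move=> I0; apply: smallest_sub; first exact: sigma_algebra_measurable.
by move=> _ [t /I0 t0 [B mB <-]]; exact: measurable_preimageX.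
Qed.

Lemma itv_sub_nneg t : [set s : R | 0 <= s <= t] `<=` [set s | 0 <= s].
Proof. by move=> s /andP[]. Qed.

Lemma natural_filtration x t E : natural_events X [set s | 0 <= s <= t] E ->
  filtration P X x t E.
Proof.
move=> nE; split; first exact: natural_events_measurable (@itv_sub_nneg t) _ nE.
exists E; last by rewrite setYK measure0.
move=> u tu; apply: natural_events_mono nE => s /andP[s0 st] /=.
by rewrite s0 (le_trans st (ltW tu)).
Qed.

Lemma measurable_law E : natural_events X [set s | 0 <= s] E ->
  measurable_fun setT (fun z => P z E).
Proof. exact: XM.1. Qed.

(** A constant time is a stopping time, and the events that are natural up to
    that time belong to its stopped sigma-algebra. *)
Lemma markov_one x t s E B : 0 <= t -> 0 <= s -> measurable B ->
  natural_events X [set s | 0 <= s <= t] E ->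
  (P x (E `&` X (t + s)%R @^-1` B) = \int[P x]_(w in E) P (X t w) (X s @^-1` B))%E.
Proof.
move=> t0 s0 mB nE.
have nat0 u : filtration P X x u set0.
  by apply: natural_filtration; exact: (@measurable0 _ (g_sigma_algebraType
  [set X s @^-1` B | s in _ & B in measurable])).
have natT u : filtration P X x u setT by apply: natural_filtration; exact: natural_eventsT.
have ST : stopping_time (filtration P X x) (fun=> t%:E).
  split=> [w|u u0]; first by rewrite lee_fin.
  have [tu|tu] := leP t u.
    by rewrite [X in filtration _ _ _ _ X](_ : _ = setT)//; apply/seteqP; split.
  rewrite [X in filtration _ _ _ _ X](_ : _ = set0)//.
  by apply/seteqP; split => // w /=; rewrite lee_fin leNgt tu.
have SE : stopped_algebra (filtration P X x) (fun=> t%:E) E.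
  split; first exact: natural_events_measurable (@itv_sub_nneg t) _ nE.
  move=> u u0; have [tu|tu] := leP t u.
    rewrite [X in filtration _ _ _ _ X](_ : _ = E).
      apply: natural_filtration; apply: natural_events_mono nE => r /andP[r0 rt] /=.
      by rewrite r0 (le_trans rt tu).
    by apply/seteqP; split => [w []|w Ew] //; split => //=; rewrite lee_fin.
  rewrite [X in filtration _ _ _ _ X](_ : _ = set0)//.
  by apply/seteqP; split => // w [_ /=]; rewrite lee_fin leNgt tu.
have /= := XM.2 x (fun=> t%:E) E s B ST SE s0 mB.
by rewrite [X in E `&` X](_ : _ = setT) ?setIT//; apply/seteqP; split => // w _ /=; rewrite ltry.
Qed.

Lemma markov_fun x t s E (f : 'rV[R]_d -> \bar R) : 0 <= t -> 0 <= s ->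
  natural_events X [set s | 0 <= s <= t] E ->
  (forall z, (0 <= f z)%E) -> measurable_fun setT f ->
  (\int[P x]_(w in E) f (X (t + s)%R w)
   = \int[P x]_(w in E) \int[P (X t w)]_w' f (X s w'))%E.
Proof.
move=> t0 s0 nE f0 mf.
have mE : measurable E by exact: natural_events_measurable (@itv_sub_nneg t) _ nE.
pose k0 (w : Omega) : {measure set 'rV[R]_d -> \bar R} := pushforward (P (X t w)) (X s).
pose k := k0 (Xm s0).
have ts0 : 0 <= t + s by exact: addr_ge0.
rewrite (@eq_integral_law _ _ _ _ _ (P x) E (X (t + s)) _ _ (P x) E k)//; first last.
- by move=> B mB; rewrite /k /= /pushforward /=; exact: markov_one.
- move=> B mB; apply: measurable_funTS.
  apply: (measurableT_comp (measurable_law (natural_eventsX s0 mB))).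
  exact: Xm.
- exact: Xm.
apply: eq_integral => w _; rewrite /k /= ge0_integral_pushforward//.
exact: Xm.
Qed.

(** The entries of the list are pairs of a waiting time and of a set that is to
    be visited at the end of the wait. *)
Fixpoint cylinder t (l : seq (R * set 'rV[R]_d)) : set Omega :=
  if l is sB :: l' then
    X (t + sB.1) @^-1` sB.2 `&` cylinder (t + sB.1) l'
  else setT.

Fixpoint valid_steps (l : seq (R * set 'rV[R]_d)) : Prop :=
  if l is sB :: l' then [/\ 0 <= sB.1, measurable sB.2 & valid_steps l'] else True.

Definition duration (l : seq (R * set 'rV[R]_d)) : R := \sum_(sB <- l) sB.1.

Lemma duration_ge0 l : valid_steps l -> 0 <= duration l.
Proof.
rewrite /duration; elim: l => [_|sB l IH [s0 _ /IH l0]]; rewrite ?big_nil//.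
by rewrite big_cons addr_ge0.
Qed.

Lemma natural_cylinder t l : 0 <= t -> valid_steps l ->
  natural_events X [set u | 0 <= u <= t + duration l] (cylinder t l).
Proof.
rewrite /duration; elim: l t => [t _ _|sB l IH t t0 [s0 mB vl]] /=; first exact: natural_eventsT.
rewrite big_cons addrA; apply: natural_eventsI; last by apply: IH => //; exact: addr_ge0.
apply: natural_eventsX => //=; rewrite addr_ge0//= lerDl.
exact: duration_ge0.
Qed.

Lemma measurable_cylinder t l : 0 <= t -> valid_steps l -> measurable (cylinder t l).
Proof.
move=> t0 vl; exact: natural_events_measurable (@itv_sub_nneg _) _ (natural_cylinder t0 vl).
Qed.

(** Both sides are reduced to the time of the first visit: on the left the
    induction hypothesis applies at time t + s, on the right, under the law
    started afresh, at time s. The Markov property then moves the weight f, the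
    probability of the remaining visits, from time t + s to time t. *)
Lemma markov_cylinder l x t E : valid_steps l -> 0 <= t ->
  natural_events X [set s | 0 <= s <= t] E ->
  (P x (E `&` cylinder t l) = \int[P x]_(w in E) P (X t w) (cylinder 0 l))%E.
Proof.
elim: l x t E => [|[s B] l IH] x t E; first move=> _ t0 nE.
  have mE : measurable E by exact: natural_events_measurable (@itv_sub_nneg t) _ nE.
  rewrite /= setIT; under eq_integral do rewrite probability_setT.
  by rewrite integral_cst// mul1e.
move=> [/= s0 mB vl] t0 nE.
have mE : measurable E by exact: natural_events_measurable (@itv_sub_nneg t) _ nE.
have ts0 : 0 <= t + s by exact: addr_ge0.
pose f := (fun z => P z (cylinder 0 l)) \_ B.
have mp : measurable_fun setT (fun z => P z (cylinder 0 l)).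
  apply: measurable_law; apply: natural_events_mono (natural_cylinder (lexx 0) vl).
  exact: itv_sub_nneg.
have f0 z : (0 <= f z)%E by rewrite /f /patch; case: ifP.
have mf : measurable_fun setT f.
  by apply/(measurable_restrictT _ mB); exact: measurable_funTS.
have fE (Q : probability Omega R) u F : 0 <= u -> measurable F ->
    (\int[Q]_(w in F `&` X u @^-1` B) P (X u w) (cylinder 0 l)
     = \int[Q]_(w in F) f (X u w))%E.
  move=> u0 mF; rewrite integral_mkcondr; apply: eq_integral => w _.
  by rewrite /f /patch; congr (if _ then _ else _); rewrite mem_setE /=; apply/asboolP/asboolP.
rewrite setIA IH//; last first.
  apply: natural_eventsI; last by apply: natural_eventsX => //=; rewrite ts0 lexx.
  apply: natural_events_mono nE => u /andP[u0 ut] /=.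
  by rewrite u0 (le_trans ut)// lerDl.
rewrite fE// (markov_fun _ _ s0 nE)//; apply: eq_integral => w _.
rewrite !add0r IH//; last by apply: natural_eventsX => //=; rewrite s0 lexx.
by rewrite -(fE _ _ setT)// setTI.
Qed.

End markov.

(** * The Markov property for survival events *)

Section survival.
Context {R : realType} {d : nat}.
Context {dO : measure_display} {Omega : measurableType dO}.
Variables (P : 'rV[R]_d -> probability Omega R) (X : R -> Omega -> 'rV[R]_d).
Hypotheses (Xm : forall t : R, 0 <= t -> measurable_fun setT (X t))
  (XM : strong_markov P X) (Xc : continuous_paths X).
Implicit Types (t s : R) (x z : 'rV[R]_d) (B : set 'rV[R]_d).

(** C t should be thought of as the event C 0 read off the path shifted by t;
    the last clause is the Markov property at time t for that event. *)
Definition shift_event (C : R -> set Omega) : Prop :=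
  [/\ natural_events X [set t | 0 <= t] (C 0),
      forall t, 0 <= t -> measurable (C t) &
      forall x t E, 0 <= t -> natural_events X [set s | 0 <= s <= t] E ->
        (P x (E `&` C t) = \int[P x]_(w in E) P (X t w) (C 0%R))%E].

Lemma shift_cylinder l : valid_steps l -> shift_event ((cylinder X)^~ l).
Proof.
move=> vl; split.
- exact: (natural_events_mono (@itv_sub_nneg _ _) (natural_cylinder (lexx 0) vl)).
- by move=> t t0; exact: measurable_cylinder.
- by move=> x t E t0 nE; exact: markov_cylinder.
Qed.

Lemma shift_event_measurable C t : shift_event C -> 0 <= t ->
  measurable_fun setT (fun w => P (X t w) (C 0)).
Proof.
move=> [nC _ _] t0; apply: (measurableT_comp (measurable_law XM nC)).
exact: Xm.
Qed.

(** The law of C n after time t converges for every starting point, so the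
    integral on the right-hand side of the Markov property converges by
    dominated convergence, probabilities being bounded by 1. *)
Lemma shift_event_lim (C : nat -> R -> set Omega) (D : R -> set Omega) :
  (forall n, shift_event (C n)) ->
  natural_events X [set t | 0 <= t] (D 0) ->
  (forall t, 0 <= t -> measurable (D t)) ->
  (forall z t E, 0 <= t -> measurable E ->
     P z (E `&` C n t) @[n --> \oo] --> P z (E `&` D t)) ->
  shift_event D.
Proof.
move=> sC nD mD CD; split=> // x t E t0 nE.
have mE : measurable E by exact: (natural_events_measurable Xm (@itv_sub_nneg _ t)).
have lhs := CD x t E t0 mE.
have CD0 z : P z (C n 0) @[n --> \oo] --> P z (D 0).
  have := CD z 0 setT (lexx 0) measurableT; rewrite setTI.
  by under eq_fun do rewrite setTI.
have rhs := @dominated_cvg _ _ _ (P x) E mE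
   (fun n w => P (X t w) (C n 0)) (fun w => P (X t w) (D 0)) (fun=> 1%E)
   (fun n => measurable_funTS (shift_event_measurable (sC n) t0))
   (fun w _ => CD0 _) _ _ _.
apply: (cvg_unique _ lhs) => //.
rewrite (_ : (fun n => _) = (fun n => (\int[P x]_(w in E) P (X t w) (C n 0%R))%E)).
  apply: rhs => //.
    by apply: finite_measure_integrable_cst.
  move=> n w _; rewrite gee0_abs//; apply: probability_le1.
  by have [_ + _] := sC n; apply.
by apply/funext => n; have [_ _] := sC n; apply.
Qed.

Lemma shift_event_bigcap (C : nat -> R -> set Omega) :
  (forall n, shift_event (C n)) ->
  (forall t, nonincreasing_seq (fun n => C n t)) ->
  shift_event (fun t => \bigcap_n C n t).
Proof.
move=> sC ni.
have mC t n : 0 <= t -> measurable (C n t) by move=> t0; have [_ + _] := sC n; apply.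
apply: (shift_event_lim sC).
- by apply: natural_events_bigcap => n; have [] := sC n.
- by move=> t t0; apply: bigcapT_measurable => n; exact: mC.
- move=> z t E t0 mE;
  rewrite (_ : E `&` _ = \bigcap_n (E `&` C n t)); last first.
    apply/seteqP; split=> w; first by move=> [Ew Cw] n _; split => //; exact: Cw.
    by move=> ECw; split=> [|n _]; [have [] := ECw 0%N I|have [] := ECw n I].
  apply: nonincreasing_cvg_mu => [|n||m n mn].
  + by rewrite -ge0_fin_numE// fin_num_measure//; apply: measurableI => //; exact: mC.
  + by apply: measurableI => //; exact: mC.
  + by apply: bigcapT_measurable => n; apply: measurableI => //; exact: mC.
  + apply/subsetPset; apply: setIS; apply/subsetPset; exact: ni.
Qed.

Lemma shift_event_bigcup (C : nat -> R -> set Omega) :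
  (forall n, shift_event (C n)) ->
  (forall t, nondecreasing_seq (fun n => C n t)) ->
  shift_event (fun t => \bigcup_n C n t).
Proof.
move=> sC nd.
have mC t n : 0 <= t -> measurable (C n t) by move=> t0; have [_ + _] := sC n; apply.
apply: (shift_event_lim sC).
- by apply: natural_events_bigcup => n; have [] := sC n.
- by move=> t t0; apply: bigcupT_measurable => n; exact: mC.
- move=> z t E t0 mE; rewrite setI_bigcupr//.
  apply: nondecreasing_cvg_mu => [n||m n mn].
  + by apply: measurableI => //; exact: mC.
  + by apply: bigcupT_measurable => n; apply: measurableI => //; exact: mC.
  + apply/subsetPset; apply: setIS; apply/subsetPset; exact: nd.
Qed.

(** These closed sets exhaust an open U. A path that stays in U during a compact
    time interval stays in one of them, and for a closed set it is enough to
    look at a dense set of times. *)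
Definition inner_closed (U : set 'rV[R]_d) (k : nat) : set 'rV[R]_d :=
  [set x | forall z, ~ U z -> k.+1%:R^-1 <= `|x - z|].

Lemma inner_closed_mono U (k k' : nat) : (k <= k')%N -> inner_closed U k `<=` inner_closed U k'.
Proof.
move=> kk' x xU z /xU; apply: le_trans.
by rewrite lef_pV2 ?posrE ?ltr0n// ler_nat.
Qed.

Lemma inner_closed_sub U k : inner_closed U k `<=` U.
Proof.
move=> x xU; apply: contrapT => /xU; rewrite subrr normr0.
by rewrite leNgt invr_gt0 ltr0n.
Qed.

Lemma closed_inner_closed U k : closed (inner_closed U k).
Proof.
move=> x clx z nUz; rewrite leNgt; apply/negP; rewrite -subr_gt0 => e0.
have [y [yU xy]] := clx _ (nbhsx_ballx x _ e0).
have := yU z nUz; apply/negP; rewrite -ltNge.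
have := ballxx z (ltr01 : 0 < 1 :> R); move: xy; rewrite -!ball_normE /= => xy _.
rewrite -(subrKA x) (le_lt_trans (ler_normD _ _))// -ltrBrDr.
by rewrite distrC.
Qed.

Lemma near_inner_closed U x : open U -> U x ->
  exists k, \forall y \near nbhs x, inner_closed U k y.
Proof.
move=> oU Ux; have : nbhs x U by exact: open_nbhs_nbhs.
rewrite nbhs_ballP => -[e /= e0 xU].
have [k ke] := small_inv (divr_gt0 e0 (ltr0n _ 2)); exists k.
apply/nbhs_ballP; exists (e / 2) => /=; first by rewrite divr_gt0.
move=> y xy z nUz; rewrite leNgt; apply/negP => yz; apply: nUz; apply: xU.
rewrite (splitr e); apply: (ball_triangle xy).
by rewrite -ball_normE /=; apply: lt_trans yz ke.
Qed.

(** The two extreme waits are 0: one for the starting time, one for the set B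
    that is imposed at the final time only. *)
Definition grid (F : set 'rV[R]_d) s (n : nat) B : seq (R * set 'rV[R]_d) :=
  (0, F) :: nseq (2 ^ n) (s / 2 ^+ n, F) ++ [:: (0, B)].

Lemma valid_grid F s n B : 0 <= s -> measurable F -> measurable B ->
  valid_steps (grid F s n B).
Proof.
move=> s0 mF mB; rewrite /grid /=; split => //.
have h0 : 0 <= s / 2 ^+ n by rewrite divr_ge0// exprn_ge0.
by elim: (2 ^ n)%N => //= m IH; split.
Qed.

Lemma cylinder_nseq t h F m l w : cylinder X t (nseq m (h, F) ++ l) w <->
  (forall j, (0 < j <= m)%N -> F (X (t + h *+ j) w)) /\
  cylinder X (t + h *+ m) l w.
Proof.
elim: m t => [|m IH] t /=; first by rewrite mulr0n addr0; split=> [|[]]//; split=> // -[].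
split.
  move=> [Fw /IH[Fj lw]]; rewrite mulrS addrA; split=> // -[//|[|j]] jm.
    by rewrite mulr1n.
  by rewrite mulrS addrA; apply: Fj.
move=> [Fj lw]; split; first by rewrite -[h]mulr1n; exact: Fj.
apply/IH; rewrite -addrA -mulrS; split => // j /andP[j0 jm].
by rewrite -addrA -mulrS; apply: Fj.
Qed.

Lemma cylinder_grid t F s n B w : cylinder X t (grid F s n B) w <->
  (forall j, (j <= 2 ^ n)%N -> F (X (t + (s / 2 ^+ n) *+ j) w)) /\ B (X (t + s) w).
Proof.
have sn : (s / 2 ^+ n) *+ (2 ^ n) = s.
  by rewrite -mulr_natr natrX divfK// expf_neq0.
rewrite /grid /= addr0; split.
  move=> [F0 /cylinder_nseq [Fj]]; rewrite sn /= addr0 => -[Bw _].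
  split=> // -[|j] jn; [by rewrite mulr0n addr0|exact: Fj].
move=> [Fj Bw]; split; first by have := Fj 0%N (leq0n _); rewrite mulr0n addr0.
apply/cylinder_nseq; rewrite sn /= addr0; split => // j /andP[_]; exact: Fj.
Qed.

(** The time interval is closed at both ends, which makes [path_compact]
    available; the killed process only looks at positive times, a difference
    dealt with in [killed_alive]. *)
Definition alive (U : set 'rV[R]_d) s B t : set Omega :=
  [set w | (forall u, t <= u <= t + s -> U (X u w)) /\ B (X (t + s) w)].

Lemma path_cvg w (u : R) : 0 <= u ->
  X r w @[r --> within [set r : R | 0 <= r] (nbhs u)] --> X u w.
Proof.
move=> u0.
have /subspace_continuousP H :
  {within [set r : R | 0 <= r], continuous (X^~ w)} := @Xc w.
exact: H.
Qed.

Lemma path_compact U t s w : open U -> 0 <= t ->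
  (forall u, t <= u <= t + s -> U (X u w)) ->
  exists k, forall u, t <= u <= t + s -> inner_closed U k (X u w).
Proof.
move=> oU t0 Uw.
have /compact_near_coveringP H := @segment_compact R t (t + s).
have /= := H nat \oo (fun k u => 0 <= u -> inner_closed U k (X u w)) _ _.
case=> [u|k _ kP].
  rewrite /= in_itv /= => tu.
  have u0 : 0 <= u by case/andP: tu => tu _; exact: le_trans tu.
  have [k /(path_cvg (w := w) u0)] := near_inner_closed oU (Uw u tu).
  move=> kP0; have kP : nbhs u [set r : R | 0 <= r -> inner_closed U k (X r w)] := kP0.
  exists ([set r | 0 <= r -> inner_closed U k (X r w)], [set k' | (k <= k')%N]).
    by split; [exact: kP|exists k].
  by move=> [r k'] /= [rk kk'] r0; apply: inner_closed_mono kk' _ (rk r0).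
exists k => u tu; apply: (kP k (leqnn k)); rewrite /= ?in_itv//=.
by case/andP: tu => tu _; exact: le_trans tu.
Qed.

Lemma aliveE U s B t : open U -> 0 <= s -> 0 <= t ->
  alive U s B t = \bigcup_k \bigcap_n cylinder X t (grid (inner_closed U k) s n B).
Proof.
move=> oU s0 t0; apply/seteqP; split=> w.
  move=> [/(path_compact oU t0)[k kP] Bw]; exists k => // n _.
  apply/cylinder_grid; split => // j jn; apply: kP.
  rewrite lerDl mulrn_wge0 ?divr_ge0 ?exprn_ge0//= lerD2l.
  rewrite -mulr_natr mulrAC ler_pdivrMr ?exprn_gt0// ler_wpM2l//.
  by rewrite -natrX ler_nat.
move=> [k _ kP]; split; last by have /cylinder_grid[] := kP 0%N I.
move=> u /andP[tu uts]; apply: (@inner_closed_sub _ k); apply: contrapT => nF.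
have u0 : 0 <= u by exact: le_trans tu.
(* If the path were outside the closed set at time u, it would be outside it
   at a grid point close enough to u. *)
have /(path_cvg (w := w) u0) : nbhs (X u w) (~` inner_closed U k).
  by apply: open_nbhs_nbhs; split => //; apply: closed_openC; exact: closed_inner_closed.
rewrite /= /nbhs /= /within /= near_simpl => -[e /= e0 eP].
have [s00|sn0] := eqVneq s 0.
  move: uts; rewrite s00 addr0 => ut.
  have /cylinder_grid[/(_ 0%N (leq0n _)) + _] := kP 0%N I.
  by rewrite mulr0n addr0; have -> : t = u by apply/eqP; rewrite eq_le tu.
have sp : 0 < s by rewrite lt_neqAle eq_sym sn0.
have [n ne] := small_inv (divr_gt0 e0 sp).
pose h := s / 2 ^+ n.
have h0 : 0 < h by rewrite divr_gt0// exprn_gt0.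
have he : h < e.
  rewrite /h ltr_pdivrMr ?exprn_gt0//.
  move: ne; rewrite ltr_pdivlMr// ltr_pdivrMl// mulrC => /lt_le_trans; apply.
  by rewrite ler_pM2l// -natrX ler_nat; exact: ltn_expl.
(* The last point of the n-th grid before u. *)
pose j := Num.truncn ((u - t) / h).
have uth : 0 <= (u - t) / h by rewrite divr_ge0 ?subr_ge0// ltW.
have /andP[j1 j2] := truncn_itv uth.
have jn : (j <= 2 ^ n)%N.
  rewrite -(ler_nat R) (le_trans j1)// ler_pdivrMr// natrX /h mulrC divfK ?expf_neq0//.
  by rewrite lerBlDl.
have /cylinder_grid[/(_ j jn) + _] := kP n I; apply: eP; last first.
  by rewrite addr_ge0// mulrn_wge0// ltW.
move: j1 j2; rewrite -/j ler_pdivlMr// ltr_pdivrMr// -natr1 mulrDl mul1r => j1 j2.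
rewrite -/h -mulr_natl /ball /= ger0_norm; last by lra.
by rewrite -/j; lra.
Qed.

Lemma grid_nonincreasing F s B t :
  nonincreasing_seq (fun n => cylinder X t (grid F s n B)).
Proof.
apply/nonincreasing_seqP => n; apply/subsetPset => w /cylinder_grid[Fw Bw].
apply/cylinder_grid; split => // j jn.
have -> : (s / 2 ^+ n) *+ j = (s / 2 ^+ n.+1) *+ (2 * j).
  by rewrite mulrnA exprS -[_ *+ 2]mulr_natr; congr (_ *+ _); field; rewrite expf_neq0.
by apply: Fw; rewrite expnS leq_mul2l.
Qed.

Lemma shift_alive U s B : open U -> 0 <= s -> measurable B ->
  shift_event (alive U s B).
Proof.
move=> oU s0 mB.
have mF k : measurable (inner_closed U k).
  by apply: closed_measurable_rV; exact: closed_inner_closed.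
have : shift_event
    (fun t => \bigcup_k \bigcap_n cylinder X t (grid (inner_closed U k) s n B)).
  apply: shift_event_bigcup => [k|t k k' kk'].
    apply: shift_event_bigcap => [n|t]; last exact: grid_nonincreasing.
    by apply: shift_cylinder; exact: valid_grid.
  apply/subsetPset => w kw n _; have /cylinder_grid[Fw Bw] := kw n I.
  apply/cylinder_grid; split => // j /Fw; exact: inner_closed_mono.
move=> [nC mC PC]; split.
- by rewrite aliveE.
- by move=> t t0; rewrite aliveE//; exact: mC.
- by move=> x t E t0 nE; rewrite !aliveE// PC.
Qed.

Lemma natural_alive U s B t : open U -> 0 <= s -> 0 <= t -> measurable B ->
  natural_events X [set u | 0 <= u <= t + s] (alive U s B t).
Proof.
move=> oU s0 t0 mB; rewrite aliveE//.
apply: natural_events_bigcup => k; apply: natural_events_bigcap => n.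
have mF : measurable (inner_closed U k).
  by apply: closed_measurable_rV; exact: closed_inner_closed.
have := natural_cylinder (X := X) t0 (valid_grid n s0 mF mB).
rewrite (_ : duration _ = s)// /duration /grid big_cons big_cat /= big_seq1.
rewrite add0r addr0 big_nseq iter_addr_0 -[LHS]mulr_natr natrX divfK// expf_neq0//.
Qed.

End survival.

(** * The law of the killed process *)

Section killed_law.
Context {R : realType} {d : nat}.
Context {dO : measure_display} {Omega : measurableType dO}.
Variables (P : 'rV[R]_d -> probability Omega R) (X : R -> Omega -> 'rV[R]_d).
Hypotheses (Xm : forall t : R, 0 <= t -> measurable_fun setT (X t))
  (XM : strong_markov P X) (Xc : continuous_paths X)
  (X0 : forall x, {ae P x, forall w, X 0 w = x}).
Variable U : set 'rV[R]_d.
Hypothesis oU : open U.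
Implicit Types (t s : R) (x z : 'rV[R]_d) (B : set 'rV[R]_d).

Lemma exit_time_gt w t : 0 < t ->
  (t%:E < exit_time (unkilled X ^~ w) U)%E <-> forall u, 0 < u <= t -> U (X u w).
Proof.
move=> t0; split=> [tU u /andP[u0 ut]|Uw].
  apply: contrapT => nU; move: tU; apply/negP; rewrite -leNgt.
  apply: le_trans (_ : u%:E <= _)%E; last by rewrite lee_fin.
  by apply: ereal_inf_lbound; exists u.
have : nbhs (X t w) U by apply: open_nbhs_nbhs; split => //; apply: Uw; rewrite t0 lexx.
move=> /(path_cvg Xc (w := w) (ltW t0)) H.
have {H} : nbhs t [set r : R | 0 <= r -> U (X r w)] := H.
rewrite nbhs_ballP => -[e /= e0 eU].
apply: (@lt_le_trans _ _ (t + e)%:E); first by rewrite lte_fin ltrDl.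
apply: le_ereal_inf_tmp => _ [u [u0 nU] <-]; rewrite lee_fin leNgt; apply/negP => ute.
apply: nU => /=; have [ut|tu] := leP u t; first by apply: Uw; rewrite u0 ut.
apply: (eU u); last exact: ltW.
by rewrite /ball /= ltr_norml; apply/andP; split; lra.
Qed.

Lemma in_state_killed w t B : 0 < t ->
  in_state B (killed X U t w) <-> (forall u, 0 < u <= t -> U (X u w)) /\ B (X t w).
Proof.
move=> t0; rewrite /killed; case: ifPn => [/exit_time_gt tU|ntU] /=.
  by split=> [Bw|[]]//; split => //; exact: tU.
by split=> // -[/(exit_time_gt w t0)]; rewrite (negbTE ntU).
Qed.

(** The condition bears on the half-open interval ]0, t], the increasing union
    of the intervals [t/(m+1), t], to which survival events apply. *)
Lemma measurable_killed t B : 0 < t -> measurable B ->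
  measurable [set w | in_state B (killed X U t w)].
Proof.
move=> t0 mB.
have h0 m : 0 <= t / m.+1%:R by rewrite divr_ge0// ltW.
have hm m : 0 <= t - t / m.+1%:R.
  by rewrite subr_ge0 ler_pdivrMr// ler_peMr ?(ltW t0)// ler1n.
rewrite (_ : mkset _ = \bigcap_m alive X U (t - t / m.+1%:R) B (t / m.+1%:R)).
  apply: bigcapT_measurable => m.
  by have [_ + _] := shift_alive Xm XM Xc oU (hm m) mB; apply.
apply/seteqP; split=> w.
  move=> /(in_state_killed w B t0)[Uw Bw] m _; rewrite /alive /= addrC subrK; split => //.
  by move=> u /andP[tu ut]; apply: Uw; rewrite ut (lt_le_trans _ tu)// divr_gt0.
move=> kw; apply/(in_state_killed w B t0); split; last first.
  by have [_] := kw 0%N I; rewrite addrC subrK.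
move=> u /andP[u0 ut]; have [m mu] := small_inv (divr_gt0 u0 t0).
have [+ _] := kw m I; apply; rewrite addrC subrK ut andbT.
by move: mu; rewrite ltr_pdivlMr// mulrC => /ltW.
Qed.

(** The two events differ only by the condition that X 0 belongs to U, which is
    almost sure under the law started at x. *)
Lemma killed_alive x t B : U x -> 0 < t -> measurable B ->
  P x [set w | in_state B (killed X U t w)] = P x (alive X U t B 0).
Proof.
move=> Ux t0 mB; have [N [mN N0 Nw]] := X0 x.
have mA : measurable (alive X U t B 0).
  by have [_ + _] := shift_alive Xm XM Xc oU (ltW t0) mB; apply.
have mK := measurable_killed t0 mB.
apply/eqP; rewrite eq_le; apply/andP; split.
  apply: (@le_trans _ _ (P x (alive X U t B 0 `|` N))).
    apply: le_measure; rewrite ?inE//; first exact: measurableU.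
    move=> w /(in_state_killed w B t0)[Uw Bw].
    have [X0w|nX0] := pselect (X 0 w = x); last by right; exact: Nw.
    left; split; rewrite /= add0r// => u /andP[u0 ut].
    have [->|un0] := eqVneq u 0; first by rewrite X0w.
    by apply: Uw; rewrite ut lt_neqAle eq_sym un0 u0.
  apply: (@le_trans _ _ (P x (alive X U t B 0) + P x N)%E); first exact: measureU2.
  by rewrite [X in (_ + X)%E](_ : _ = 0%E) ?adde0//; exact: N0.
apply: le_measure; rewrite ?inE// => w [Uw Bw]; apply/(in_state_killed w B t0).
move: Uw Bw; rewrite add0r => Uw Bw; split => // u /andP[u0 ut]; apply: Uw.
by rewrite (ltW u0).
Qed.

Lemma alive_split t s B : 0 <= t -> 0 <= s ->
  alive X U (t + s) B 0 = alive X U t setT 0 `&` alive X U s B t.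
Proof.
move=> t0 s0; apply/seteqP; split=> w; rewrite /alive /= !add0r.
  move=> [Uw Bw]; split; split => // u /andP[u0 ut]; apply: Uw.
    by rewrite u0 (le_trans ut)// lerDl.
  by rewrite ut (le_trans t0 u0).
move=> [[Ut _] [Us Bw]]; split => // u /andP[u0 uts].
have [ut|tu] := leP u t; first by apply: Ut; rewrite u0.
by apply: Us; rewrite (ltW tu).
Qed.

Lemma alive_setI t B : 0 <= t ->
  alive X U t setT 0 `&` X t @^-1` B = alive X U t (B `&` U) 0.
Proof.
move=> t0; apply/seteqP; split=> w; rewrite /alive /= !add0r.
  by move=> [[Uw _] Bw]; split => //; split => //; apply: Uw; rewrite t0 lexx.
by move=> [Uw [Bw _]].
Qed.

End killed_law.

(** * The killed transition density *)

(** Continuity is tested on a countable family of measurable sets rather than on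
    open sets, so that the lemma applies to a product sigma-algebra and to a
    function that is only continuous on W. *)
Lemma measurable_local {R : realType} dT (T : measurableType dT) (I : countType)
    (B : I -> set T) (W : set T) (f : T -> R) :
  (forall i, measurable (B i)) ->
  (forall z (e : R), W z -> 0 < e -> exists i, B i z /\
     forall z', B i z' -> W z' /\ `|f z - f z'| < e) ->
  measurable W /\ measurable_fun W f.
Proof.
move=> mB WB.
have mloc (V : set T) : (forall z, V z -> exists i, B i z /\ B i `<=` V) -> measurable V.
  move=> VB; pose F i := if `[< B i `<=` V >] then B i else set0.
  rewrite (_ : V = \bigcup_i F i).
    apply: countable_bigcupT_measurable => [|i]; first exact: countableP.
    by rewrite /F; case: asboolP.
  apply/seteqP; split=> [z /VB[i [Biz BiV]]|z [i _]].
    by exists i => //; rewrite /F; case: asboolP.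
  by rewrite /F; case: asboolP => // BV /BV.
have mW : measurable W.
  apply: mloc => z /WB /(_ (ltr01 : 0 < 1 :> R))[i [Biz Bi]].
  by exists i; split => // z' /Bi[].
split => //; apply: (measurability _ (RGenOpens.measurableE R)).
move=> _ [_ [a [b ->] <-]]; apply: mloc => z [Wz /=].
rewrite in_itv /= => /andP[az zb].
pose e := Num.min (f z - a) (b - f z).
have e0 : 0 < e by rewrite lt_min !subr_gt0 az.
have [i [Biz Bi]] := WB z e Wz e0; exists i; split => // z' /Bi[Wz' zz'].
split => //=; rewrite in_itv /=; move: zz'; rewrite lt_min !ltr_norml.
by move=> /andP[/andP[h1 h2] /andP[h3 h4]]; apply/andP; split; lra.
Qed.

Section heat_kernel.
Context {R : realType} {d : nat}.
Implicit Types (t s : R) (x y z v : 'rV[R]_d) (U B : set 'rV[R]_d).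
Notation TR := (measurableTypeR R).
Notation leb := (@lebesgue_rV R d).

(** Extending the density by 0 turns the integrals over the domain into integrals
    over the whole space and makes it a measurable function everywhere. *)
Definition heat (q : set 'rV[R]_d -> R -> 'rV[R]_d -> 'rV[R]_d -> R) U t x y : R :=
  if `[< [/\ 0 < t, U x & U y] >] then q U t x y else 0.

Section one_domain.
Context {dO : measure_display} {Omega : measurableType dO}.
Variables (P : 'rV[R]_d -> probability Omega R) (X : R -> Omega -> 'rV[R]_d).
Hypotheses (Xm : forall t : R, 0 <= t -> measurable_fun setT (X t))
  (XM : strong_markov P X) (Xc : continuous_paths X)
  (X0 : forall x, {ae P x, forall w, X 0 w = x}).
Variables (q : set 'rV[R]_d -> R -> 'rV[R]_d -> 'rV[R]_d -> R) (U : set 'rV[R]_d).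
Hypotheses (oU : open U) (hq : is_killed_density P X U (q U)).
Notation p := (heat q U).

Lemma heatE t x y : 0 < t -> U x -> U y -> p t x y = q U t x y.
Proof. by move=> t0 Ux Uy; rewrite /heat; case: asboolP => // -[]. Qed.

Lemma heat_out t x y : ~ [/\ 0 < t, U x & U y] -> p t x y = 0.
Proof. by move=> nU; rewrite /heat; case: asboolP. Qed.

Lemma heat_ge0 t x y : 0 <= p t x y.
Proof.
have [q0 _ _] := hq; rewrite /heat; case: asboolP => // -[t0 Ux Uy].
exact: q0.
Qed.

Lemma heat_near t x y (e : R) : 0 < t -> U x -> U y -> 0 < e ->
  exists2 del : R, 0 < del & forall t' x' y', ball t del t' -> ball x del x' ->
    ball y del y' -> [/\ 0 < t', U x', U y' & `|p t x y - p t' x' y'| < e].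
Proof.
move=> t0 Ux Uy e0; have [_ qc _] := hq.
pose S := [set z : R * 'rV[R]_d * 'rV[R]_d | [/\ 0 < z.1.1, U z.1.2 & U z.2]].
have oball (V : set 'rV[R]_d) z : open V -> V z -> exists2 r : R, 0 < r & ball z r `<=` V.
  move=> oV Vz; have /nbhs_ballP[r r0 rV] : nbhs z V by exact: open_nbhs_nbhs.
  by exists r.
have [rx rx0 xU] := oball _ _ oU Ux; have [ry ry0 yU] := oball _ _ oU Uy.
have /subspace_continuousP /(_ (t, x, y)) := qc.
move=> /(_ (And3 t0 Ux Uy)) /cvgrPdist_lt /(_ e e0).
rewrite /prop_near1 /within /= => /nbhs_ballP[r /= r0 rP].
pose del := Num.min (Num.min rx ry) (Num.min t r).
exists del; first by rewrite !lt_min rx0 ry0 t0.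
move=> t' x' y' tt' xx' yy'.
have dt : del <= t by rewrite !ge_min lexx !orbT.
have dr : del <= r by rewrite !ge_min lexx !orbT.
have drx : del <= rx by rewrite !ge_min lexx.
have dry : del <= ry by rewrite !ge_min lexx !orbT.
have t'0 : 0 < t'.
  by move: (le_ball dt tt'); rewrite /ball /= ltr_norml => /andP[_]; lra.
have Ux' : U x' by apply: xU; exact: le_ball xx'.
have Uy' : U y' by apply: yU; exact: le_ball yy'.
split => //; rewrite !heatE//.
apply: (rP (t', x', y')); last by split.
by split; [split|]; exact: le_ball dr _ _.
Qed.

Lemma heat_measurable :
  measurable_fun setT (fun z : TR * 'rV[R]_d * 'rV[R]_d => p z.1.1 z.1.2 z.2).
Proof.
pose W := [set z : TR * 'rV[R]_d * 'rV[R]_d | [/\ 0 < z.1.1, U z.1.2 & U z.2]].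
pose B (ijk : (rat * nat) * ('rV[rat]_d * nat) * ('rV[rat]_d * nat)) :
    set (TR * 'rV[R]_d * 'rV[R]_d) :=
  rat_ball ijk.1.1 `*` rat_cube ijk.1.2 `*` rat_cube ijk.2.
have [||mW] := @measurable_local R _ _ _ B W (fun z : TR * 'rV[R]_d * 'rV[R]_d => p z.1.1 z.1.2 z.2).
- move=> ijk; apply: measurableX; last exact: measurable_rat_cube.
  by apply: measurableX; [exact: measurable_rat_ball|exact: measurable_rat_cube].
- move=> [[t x] y] e [/= t0 Ux Uy] e0; have [r r0 rP] := heat_near t0 Ux Uy e0.
  have [i it iP] := rat_ball_base (nbhsx_ballx t r r0).
  have [j jx jP] := rat_cube_base (nbhsx_ballx x r r0).
  have [k ky kP] := rat_cube_base (nbhsx_ballx y r r0).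
  exists (i, j, k); split => // -[[t' x'] y'] [[/= /iP tt' /jP xx'] /kP yy'].
  by have [] := rP t' x' y' tt' xx' yy'.
move=> /(measurable_restrictT _ mW); congr measurable_fun.
apply/funext => -[[t x] y] /=; rewrite /patch; case: ifPn => //; rewrite notin_setE.
by move=> nW; apply/esym/heat_out.
Qed.

Lemma heat_measurable_tv x :
  measurable_fun setT (fun tv : TR * 'rV[R]_d => p tv.1 x tv.2).
Proof.
apply: (measurableT_comp heat_measurable (_ : measurable_fun setT
  (fun tv : TR * 'rV[R]_d => ((tv.1, x), tv.2)))).
by apply: measurable_fun_pair => //; apply: measurable_fun_pair.
Qed.

Lemma heat_measurable_tv' y :
  measurable_fun setT (fun tv : TR * 'rV[R]_d => p tv.1 tv.2 y).
Proof.
apply: (measurableT_comp heat_measurable (_ : measurable_fun setT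
  (fun tv : TR * 'rV[R]_d => (tv, y)))).
exact: measurable_fun_pair.
Qed.

Lemma heat_measurable_vy t :
  measurable_fun setT (fun vy : 'rV[R]_d * 'rV[R]_d => p t vy.1 vy.2).
Proof.
apply: (measurableT_comp heat_measurable (_ : measurable_fun setT
  (fun vy : 'rV[R]_d * 'rV[R]_d => (((t : TR), vy.1), vy.2)))).
by apply: measurable_fun_pair => //; apply: measurable_fun_pair.
Qed.

Lemma heat_measurable_t x y : measurable_fun setT (fun t : TR => p t x y).
Proof. exact: (measurable_fun_pair1 y (heat_measurable_tv x)). Qed.

Lemma heat_measurable_y t x : measurable_fun setT (p t x).
Proof. exact: (measurable_fun_pair2 x (heat_measurable_vy t)). Qed.

Lemma heat_measurable_x t y : measurable_fun setT (p t ^~ y).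
Proof. exact: (measurable_fun_pair1 y (heat_measurable_vy t)). Qed.

Lemma heat_law t x B : 0 < t -> U x -> measurable B ->
  (P x (alive X U t B 0) = \int[leb]_(y in B) (p t x y)%:E)%E.
Proof.
move=> t0 Ux mB; have [_ _ ql] := hq.
have mU : measurable U by exact: open_measurable_rV.
have mBU : measurable (B `&` U) by exact: measurableI.
have aE : alive X U t B 0 = alive X U t (B `&` U) 0.
  apply/seteqP; split=> w; rewrite /alive /= !add0r; last by move=> [Uw []].
  by move=> [Uw Bw]; split => //; split => //; apply: Uw; rewrite (ltW t0) lexx.
rewrite aE -(killed_alive Xm XM Xc X0 oU)// ql//.
rewrite [LHS]integral_mkcond [RHS]integral_mkcond; apply: eq_integral => y _.
rewrite /patch in_setI; case: ifPn => [/andP[By Uy]|].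
  by rewrite By heatE//; move: Uy; rewrite inE.
case: ifPn => //= _ nUy; rewrite heat_out// => -[_ _ Uy].
by move: nUy; rewrite notin_setE; apply.
Qed.

Lemma heat_law_mass t x B : measurable B ->
  (\int[leb]_(y in B) (p t x y)%:E <= 1)%E.
Proof.
move=> mB; have [[t0 Ux]|nt] := pselect (0 < t /\ U x).
  rewrite -heat_law//; apply: probability_le1.
  by have [_ + _] := shift_alive Xm XM Xc oU (ltW t0) mB; apply.
rewrite integral0_eq// => y _; rewrite heat_out// => -[t0 Ux _].
by apply: nt.
Qed.

Lemma heat_integrable t x : leb.-integrable setT (EFin \o p t x).
Proof.
apply/integrableP; split; first by apply/measurable_EFinP; exact: heat_measurable_y.
under eq_integral do rewrite /= ger0_norm ?heat_ge0//.
by apply: le_lt_trans (heat_law_mass t x measurableT) _; rewrite ltry.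
Qed.

(** The Markov property at time t, Chapman and Kolmogorov's argument. The density
    only determines probabilities, so that the equation comes out integrated
    over the end point y. *)
Lemma heat_semigroup_law t s x B : 0 < t -> 0 < s -> U x -> measurable B ->
  (\int[leb]_(y in B) (p (t + s)%R x y)%:E =
   \int[leb]_(y in B) \int[leb]_v ((p t x v)%:E * (p s v y)%:E))%E.
Proof.
move=> t0 s0 Ux mB.
have mU : measurable U by exact: open_measurable_rV.
have shs := shift_alive Xm XM Xc oU (ltW s0) mB.
have nE : natural_events X [set u | 0 <= u <= t] (alive X U t setT 0).
  by have := natural_alive Xc oU (ltW t0) (lexx 0) measurableT; rewrite add0r.
pose f z := P z (alive X U s B 0).
have mf : measurable_fun setT f.
  by have [nC _ _] := shs; exact: (measurable_law XM nC).
(* The law of X t on survival, written as a mixture of Dirac masses with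
   weight the density. *)
pose k' (v : 'rV[R]_d) : {measure set 'rV[R]_d -> \bar R} :=
  mscale (NngNum (heat_ge0 t x v)) (dirac v).
have k'E v B' : k' v B' = ((p t x v)%:E * (\1_B' v)%:E)%E by [].
have mE : measurable (alive X U t setT 0).
  by have [_ + _] := shift_alive Xm XM Xc oU (ltW t0) measurableT; apply.
transitivity (\int[P x]_(w in alive X U t setT 0) f (X t w))%E.
  rewrite -heat_law//; last exact: addr_gt0.
  rewrite alive_split ?(ltW t0) ?(ltW s0)//.
  by have [_ _ ->] := shs => //; exact: ltW.
transitivity (\int[leb]_v \int[k' v]_y f y)%E.
  apply: eq_integral_law => //.
  - exact: Xm (ltW t0).
  - move=> B' mB'; under eq_fun do rewrite k'E.
    apply: emeasurable_funM; apply/measurable_EFinP; first exact: heat_measurable_y.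
    exact: measurable_indic.
  - move=> B' mB'; rewrite alive_setI ?(ltW t0)//.
    apply: etrans (heat_law t0 Ux (measurableI _ _ mB' mU)) _.
    rewrite [LHS]integral_mkcond; apply: eq_integral => v _.
    rewrite k'E /patch in_setI indicE; case: (v \in B'); rewrite ?mule1 ?mule0//=.
    by case: ifPn => //; rewrite notin_setE => nUv; rewrite heat_out// => -[].
transitivity (\int[leb]_v \int[leb]_(y in B) ((p t x v)%:E * (p s v y)%:E))%E.
  apply: eq_integral => v _; rewrite ge0_integral_mscale//.
  rewrite integral_dirac// diracT mul1e /f /=.
  have [Uv|nUv] := pselect (U v); last first.
    rewrite heat_out ?mul0e//; last by case.
    by rewrite integral0_eq// => y _; rewrite mul0e.
  rewrite heat_law// ge0_integralZl_EFin//; last exact: heat_ge0.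
  - by move=> y _; rewrite lee_fin heat_ge0.
  - by apply/measurable_EFinP; apply: measurable_funTS; exact: heat_measurable_y.
pose g (vy : 'rV[R]_d * 'rV[R]_d) := ((p t x vy.1)%:E * (p s vy.1 vy.2)%:E * (\1_B vy.2)%:E)%E.
have gE v y : ((fun y => (p t x v)%:E * (p s v y)%:E) \_ B)%E y = g (v, y).
  by rewrite /patch /g /= indicE; case: (y \in B); rewrite ?mule1 ?mule0.
under eq_integral do rewrite integral_mkcond (funext (gE _)).
rewrite [RHS]integral_mkcond.
rewrite (@fubini_tonelli _ _ _ _ _ leb leb g).
- apply: eq_integral => y _; rewrite /patch /g /= indicE; case: (y \in B).
    by apply: eq_integral => v _; rewrite mule1.
  by rewrite integral0_eq// => v _; rewrite mule0.
- apply: emeasurable_funM; last first.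
    apply/measurable_EFinP; apply: (measurableT_comp (measurable_indic mB)).
    exact: measurable_snd.
  apply: emeasurable_funM; apply/measurable_EFinP; last exact: heat_measurable_vy.
  by apply: (measurableT_comp (heat_measurable_y t x)); exact: measurable_fst.
- by move=> vy; rewrite /g !mule_ge0// lee_fin ?heat_ge0.
Qed.

End one_domain.
End heat_kernel.

(** * The Chapman-Kolmogorov equation *)

Section chapman_kolmogorov.
Context {R : realType} {d : nat}.
Implicit Types (t s : R) (x y z v : 'rV[R]_d) (U B : set 'rV[R]_d).
Notation TR := (measurableTypeR R).
Notation leb := (@lebesgue_rV R d).
Context {dO : measure_display} {Omega : measurableType dO}.
Variables (P : 'rV[R]_d -> probability Omega R) (X : R -> Omega -> 'rV[R]_d).
Hypotheses (Xm : forall t : R, 0 <= t -> measurable_fun setT (X t))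
  (XM : strong_markov P X) (Xc : continuous_paths X)
  (X0 : forall x, {ae P x, forall w, X 0 w = x}).
Variables (q : set 'rV[R]_d -> R -> 'rV[R]_d -> 'rV[R]_d -> R).
Hypothesis hq : forall U : set 'rV[R]_d, open U -> bounded_set U ->
     is_killed_density P X U (q U).
Notation p := (heat q).

(** Survival in the smaller set implies survival in the larger one, so the
    densities are ordered after integration over any set; averaging over a cube
    on which both are almost constant orders them pointwise. *)
Lemma heat_mono U U' t x y : open U -> bounded_set U -> open U' -> bounded_set U' ->
  U `<=` U' -> p U t x y <= p U' t x y.
Proof.
move=> oU bU oU' bU' UU'.
have [[t0 Ux Uy]|nU] := pselect [/\ 0 < t, U x & U y]; last first.
  by rewrite heat_out// (heat_ge0 (hq oU' bU')).
rewrite leNgt; apply/negP => lt.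
pose e := (p U t x y - p U' t x y) / 3.
have e0 : 0 < e by rewrite divr_gt0// subr_gt0.
have [r r0 rP] := heat_near oU (hq oU bU) t0 Ux Uy e0.
have [r' r'0 rP'] := heat_near oU' (hq oU' bU') t0 (UU' _ Ux) (UU' _ Uy) e0.
pose r2 := Num.min r r'.
have r20 : 0 < r2 by rewrite lt_min r0.
have mB : measurable (ball y r2) by apply: open_measurable_rV; exact: ball_open.
have volE := lebesgue_rV_ball y r20.
have vol0 : 0 < (2 * r2) ^+ d by rewrite exprn_gt0// mulr_gt0.
have sub z : ball y r2 z -> p U t x y - e <= p U t x z /\ p U' t x z <= p U' t x y + e.
  move=> yz.
  have yr : ball y r z by apply: le_ball yz; rewrite ge_min lexx.
  have yr' : ball y r' z by apply: le_ball yz; rewrite ge_min lexx orbT.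
  have [_ _ _] := rP t x z (ballxx _ r0) (ballxx _ r0) yr.
  have [_ _ _] := rP' t x z (ballxx _ r'0) (ballxx _ r'0) yr'.
  rewrite !ltr_norml => /andP[h1 h2] /andP[h3 h4].
  by split; lra.
have p'0 := heat_ge0 (hq oU' bU') t x y.
have a0 : 0 <= p U t x y - e by rewrite /e; lra.
have h1 : ((p U t x y - e)%:E * leb (ball y r2) <=
    \int[leb]_(z in ball y r2) (p U t x z)%:E)%E.
  rewrite -integral_cst//; apply: ge0_le_integral => //.
  - by apply/measurable_EFinP; apply: measurable_funTS; exact: (heat_measurable_y oU (hq oU bU)).
  - by move=> z /sub[]; rewrite lee_fin.
have h2 : (\int[leb]_(z in ball y r2) (p U' t x z)%:E <=
    (p U' t x y + e)%:E * leb (ball y r2))%E.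
  rewrite -integral_cst//; apply: ge0_le_integral => //.
  - by move=> z _; rewrite lee_fin (heat_ge0 (hq oU' bU')).
  - by apply/measurable_EFinP; apply: measurable_funTS; exact: (heat_measurable_y oU' (hq oU' bU')).
  - by move=> z /sub[]; rewrite lee_fin.
have h3 : (\int[leb]_(z in ball y r2) (p U t x z)%:E <=
    \int[leb]_(z in ball y r2) (p U' t x z)%:E)%E.
  rewrite -(heat_law Xm XM Xc X0 oU (hq oU bU))//.
  rewrite -(heat_law Xm XM Xc X0 oU' (hq oU' bU'))//; last exact: UU'.
  apply: le_measure; rewrite ?inE.
  - by have [_ + _] := shift_alive Xm XM Xc oU (ltW t0) mB; apply.
  - by have [_ + _] := shift_alive Xm XM Xc oU' (ltW t0) mB; apply.
  - by move=> w [Uw Bw]; split => // u /Uw /UU'.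
have := le_trans h1 (le_trans h3 h2).
rewrite volE -!EFinM lee_fin ler_pM2r// leNgt => /negP; apply.
by rewrite /e; lra.
Qed.

Lemma closure_bounded U : bounded_set U ->
  exists2 r : R, 0 < r & closure U `<=` eball 0 r.
Proof.
move=> /bounded_set_eball[r r0 Ur]; exists (r + 1); first by rewrite addr_gt0.
move=> x /(_ _ (nbhs_eball x (ltr01 : 0 < 1 :> R)))[y [/Ur yr xy]].
apply: (le_lt_trans (eucl_dist_tri y _ _)); apply: ltrD => //.
by rewrite eucl_distC.
Qed.

Lemma compact_closure U : bounded_set U -> compact (closure U).
Proof.
move=> /closure_bounded[r _ Ur]; apply: bounded_closed_compact; last exact: closed_closure.
have [M [Mr MP]] := eball_bounded (0 : 'rV[R]_d) r; exists M; split => // B MB x /Ur.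
exact: MP.
Qed.

(** The density of U is not known to be bounded near the boundary of U. It is
    dominated by the density of a large ball, which is continuous on the compact
    closure of U. *)
Lemma heat_bound U s y : open U -> bounded_set U -> 0 < s -> U y ->
  exists C : R, exists2 del : R, 0 < del &
    forall v y', ball y del y' -> p U s v y' <= C.
Proof.
move=> oU bU s0 Uy; have [r r0 Ur] := closure_bounded bU.
have oV : open (eball (0 : 'rV[R]_d) r) by exact: open_eball.
have bV : bounded_set (eball (0 : 'rV[R]_d) r) by exact: eball_bounded.
have hqV := hq oV bV; have UV : U `<=` eball 0 r.
  by apply: subset_trans Ur; exact: subset_closure.
have /compact_near_coveringP H := compact_closure bU.
have : \forall k \near \oo, closure U `<=` (fun v => forall y', ball y k.+1%:R^-1 y' ->
    p (eball 0 r) s v y' <= k%:R).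
  apply: H => v /Ur Vv; have [e e0 eP] := heat_near oV hqV s0 Vv (UV _ Uy) (ltr01).
  have [k ke] := small_inv e0.
  pose K := maxn k (Num.truncn (p (eball 0 r) s v y + 1)).+1.
  exists (ball v e, [set k' | (K <= k')%N]); first by split; [exact: nbhsx_ballx|exists K].
  move=> [v' k'] /= [vv' Kk'] y' yy'.
  have ky : ball y e y'.
    apply: le_ball yy'; apply: le_trans (ltW ke).
    by rewrite lef_pV2 ?posrE// ler_nat ltnS (leq_trans _ Kk')// leq_maxl.
  have [_ _ _] := eP s v' y' (ballxx _ e0) vv' ky.
  rewrite ltr_norml => /andP[h _].
  apply: (@le_trans _ _ (p (eball 0 r) s v y + 1)); first by lra.
  apply: (@le_trans _ _ (Num.truncn (p (eball 0 r) s v y + 1)).+1%:R).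
    by apply: ltW; exact: truncnS_gt.
  by rewrite ler_nat (leq_trans _ Kk')// leq_maxr.
case=> k _ kP; exists k%:R, k.+1%:R^-1; first by rewrite invr_gt0.
move=> v y' yy'; have [Uv|nUv] := pselect (U v); last first.
  by rewrite heat_out ?ler0n// => -[].
apply: le_trans (kP k (leqnn k) v (subset_closure Uv) y' yy').
exact: heat_mono.
Qed.

Lemma ae_dense (A : set 'rV[R]_d) y (r : R) : {ae leb, forall z, A z} -> 0 < r ->
  exists2 z, ball y r z & A z.
Proof.
move=> [N [mN N0 AN]] r0; apply: contrapT => nA.
have : (leb (ball y r) <= leb N)%E.
  apply: le_measure; rewrite ?inE//; first by apply: open_measurable_rV; exact: ball_open.
  by move=> z yz; apply: AN => Az; apply: nA; exists z.
rewrite N0 lebesgue_rV_ball// lee_fin leNgt => /negP; apply.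
by rewrite exprn_gt0// mulr_gt0.
Qed.

Lemma heat_cvg U t x y (yn : nat -> 'rV[R]_d) : open U -> bounded_set U ->
  (forall n, ball y n.+1%:R^-1 (yn n)) -> U y ->
  p U t x (yn n) @[n --> \oo] --> p U t x y.
Proof.
move=> oU bU yyn Uy.
have [[t0 Ux]|nt] := pselect (0 < t /\ U x); last first.
  rewrite heat_out; last by move=> [? ? ?]; exact: nt.
  rewrite (_ : (fun n => _) = cst 0); first exact: cvg_cst.
  by apply/funext => n; rewrite heat_out// => -[? ? ?]; exact: nt.
apply/cvgrPdist_lt => e e0.
have [r r0 rP] := heat_near oU (hq oU bU) t0 Ux Uy e0.
have [k kr] := small_inv r0; exists k => // n /= kn.
have yr : ball y r (yn n).
  apply: le_ball (yyn n); apply: le_trans (ltW kr).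
  by rewrite lef_pV2 ?posrE// ler_nat ltnS.
by have [] := rP t x (yn n) (ballxx _ r0) (ballxx _ r0) yr.
Qed.

(** By [heat_semigroup_law] the two sides agree for almost every y. Both are
    continuous in y, the right-hand side by dominated convergence thanks to
    [heat_bound], so they agree along a sequence that tends to y and then at y. *)
Theorem heat_semigroup U t s x y : open U -> bounded_set U -> 0 < t -> 0 < s ->
  ((p U (t + s)%R x y)%:E = \int[leb]_v ((p U t x v)%:E * (p U s v y)%:E))%E.
Proof.
move=> oU bU t0 s0.
have [[Ux Uy]|nU] := pselect (U x /\ U y); last first.
  rewrite heat_out; last by move=> [_ ? ?]; exact: nU.
  rewrite integral0_eq// => v _; have [Ux|nUx] := pselect (U x).
    by rewrite (@heat_out _ _ _ _ s) ?mule0// => -[_ ? ?]; exact: nU.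
  by rewrite heat_out ?mul0e// => -[].
have ts0 : 0 < t + s by exact: addr_gt0.
have hU := hq oU bU.
pose g y := (\int[leb]_v ((p U t x v)%:E * (p U s v y)%:E))%E.
have mint z : measurable_fun setT (fun v => (p U t x v)%:E * (p U s v z)%:E)%E.
  apply: emeasurable_funM; apply/measurable_EFinP.
    exact: heat_measurable_y oU hU _ _.
  exact: heat_measurable_x oU hU _ _.
have mg : measurable_fun setT g.
  apply: (@measurable_fun_fubini_tonelli_G _ _ _ _ _ leb
     (fun vy => (p U t x vy.1)%:E * (p U s vy.1 vy.2)%:E)%E).
    apply: emeasurable_funM; apply/measurable_EFinP; last exact: heat_measurable_vy oU hU _.
    apply: (measurableT_comp (heat_measurable_y oU hU t x)); exact: measurable_fst.
  by move=> vy; rewrite mule_ge0// lee_fin (heat_ge0 hU).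
have : ae_eq leb setT (EFin \o p U (t + s) x) g.
  apply: integral_ae_eq => //; first exact: (heat_integrable Xm XM Xc X0 oU hU).
  by move=> E _ mE; exact: (heat_semigroup_law Xm XM Xc X0 oU hU).
move=> aeq.
have H (n : nat) : exists z, ball y n.+1%:R^-1 z /\ (p U (t + s) x z)%:E = g z.
  have n0 : 0 < n.+1%:R^-1 :> R by rewrite invr_gt0.
  by have [z yz /(_ I) zE] := ae_dense y aeq n0; exists z.
have [yn ynP] := choice H.
have yyn n : ball y n.+1%:R^-1 (yn n) by have [] := ynP n.
have [C [del del0 CP]] := heat_bound oU bU s0 Uy.
have [k kdel] := small_inv del0.
have yyk n : ball y n.+1%:R^-1 (yn (n + k)%N).
  by apply: le_ball (yyn _); rewrite lef_pV2 ?posrE// ler_nat ltnS leq_addr.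
have lim1 : (p U (t + s) x (yn (n + k)%N))%:E @[n --> \oo] --> (p U (t + s) x y)%:E.
  apply: cvg_EFin; first by apply: nearW.
  exact: (@heat_cvg _ _ _ _ (fun n => yn (n + k)%N)).
have C0 : 0 <= C by apply: le_trans (CP y y (ballxx _ del0)); exact: (heat_ge0 hU).
have lim2 : g (yn (n + k)%N) @[n --> \oo] --> g y.
  apply: (@dominated_cvg _ _ _ leb setT measurableT
    (fun n v => (p U t x v)%:E * (p U s v (yn (n + k)%N))%:E)%E
    (fun v => (p U t x v)%:E * (p U s v y)%:E)%E (fun v => C%:E * (p U t x v)%:E)%E) => //.
  - move=> v _; rewrite -EFinM; under eq_fun do rewrite -EFinM.
    apply: cvg_EFin; first by apply: nearW.
    by apply: cvgMr; exact: (@heat_cvg _ _ _ _ (fun n => yn (n + k)%N)).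
  - by apply: integrableZl => //; exact: (heat_integrable Xm XM Xc X0 oU hU).
  - move=> n v _; rewrite -!EFinM abse_EFin lee_fin ger0_norm ?mulr_ge0 ?(heat_ge0 hU)//.
    rewrite mulrC ler_wpM2r ?(heat_ge0 hU)//; apply: CP; apply: le_ball (yyn _).
    apply: le_trans (ltW kdel); rewrite lef_pV2 ?posrE// ler_nat ltnS; exact: leq_addl.
apply: (cvg_unique _ lim1) => //.
rewrite (_ : (fun n => _) = (fun n => g (yn (n + k)%N)))//.
by apply/funext => n; have [] := ynP (n + k)%N.
Qed.

End chapman_kolmogorov.

(** * Occupation densities over a time window *)

Section tonelli_on.
Context {R : realType} d1 d2 (T1 : measurableType d1) (T2 : measurableType d2).
Variables (m1 : {sigma_finite_measure set T1 -> \bar R})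
  (m2 : {sigma_finite_measure set T2 -> \bar R}).
Variables (A : set T1) (B : set T2) (f : T1 * T2 -> \bar R).
Hypotheses (mA : measurable A) (mB : measurable B)
  (mf : measurable_fun setT f) (f0 : forall z, (0 <= f z)%E).
Local Open Scope ereal_scope.

Lemma measurable_integral_on : measurable_fun setT (fun x => \int[m2]_(y in B) f (x, y)).
Proof.
pose g z := f z * (\1_B z.2)%:E.
have mg : measurable_fun setT g.
  apply: emeasurable_funM => //; apply/measurable_EFinP.
  by apply: (measurableT_comp (measurable_indic mB)); exact: measurable_snd.
have g0 z : 0 <= g z by rewrite mule_ge0.
have := @measurable_fun_fubini_tonelli_F _ _ _ _ _ m2 g mg g0; congr measurable_fun.
apply/funext => x; rewrite /fubini_F [RHS]integral_mkcond; apply: eq_integral => y _.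
by rewrite /g /patch /= indicE; case: (y \in B); rewrite ?mule1 ?mule0.
Qed.

Lemma tonelli_on : \int[m1]_(x in A) \int[m2]_(y in B) f (x, y) =
  \int[m2]_(y in B) \int[m1]_(x in A) f (x, y).
Proof.
pose g z := f z * ((\1_A z.1)%:E * (\1_B z.2)%:E).
have mg : measurable_fun setT g.
  apply: emeasurable_funM => //; apply: emeasurable_funM; apply/measurable_EFinP.
  - by apply: (measurableT_comp (measurable_indic mA)); exact: measurable_fst.
  - by apply: (measurableT_comp (measurable_indic mB)); exact: measurable_snd.
have g0 z : 0 <= g z by rewrite !mule_ge0.
transitivity (\int[m1]_x \int[m2]_y g (x, y)).
  rewrite integral_mkcond; apply: eq_integral => x _.
  rewrite /patch; case: ifPn => xA.
    rewrite integral_mkcond; apply: eq_integral => y _.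
    by rewrite /g /patch /= !indicE xA mul1e; case: (y \in B); rewrite ?mule1 ?mule0.
  by rewrite integral0_eq// => y _; rewrite /g /= !indicE (negbTE xA) mul0e mule0.
rewrite (@fubini_tonelli _ _ _ _ _ m1 m2 g mg g0).
rewrite [RHS]integral_mkcond; apply: eq_integral => y _.
rewrite /patch; case: ifPn => yB.
  rewrite [RHS]integral_mkcond; apply: eq_integral => x _.
  by rewrite /g /patch /= !indicE yB mule1; case: (x \in A); rewrite ?mule1 ?mule0.
by rewrite integral0_eq// => x _; rewrite /g /= !indicE (negbTE yB) !mule0.
Qed.

End tonelli_on.

Section time_shift.
Context {R : realType}.
Notation mu := (@lebesgue_measure R).
Local Open Scope ereal_scope.

Lemma measurable_shift (a : R) :
  measurable_fun setT ((fun t => (a + t)%R) : measurableTypeR R -> measurableTypeR R).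
Proof. exact: measurable_funD. Qed.

Lemma lebesgue_measure_shift (a : R) (A : set (measurableTypeR R)) : measurable A ->
  mu ((fun t => (a + t)%R) @^-1` A) = mu A.
Proof.
move=> mA; pose m0 : {measure set (measurableTypeR R) -> \bar R} :=
  pushforward mu ((fun t => (a + t)%R) : measurableTypeR R -> measurableTypeR R).
have -> : mu ((fun t => (a + t)%R) @^-1` A) = m0 (measurable_shift a) A by [].
apply/esym/lebesgue_measure_unique => //= _ [[b c]] _ <-.
rewrite /pushforward /=.
rewrite (_ : _ @^-1` _ = `](b - a)%R, (c - a)%R]%classic); last first.
  by apply/seteqP; split=> t /=; rewrite !in_itv /= ltrBlDl lerBrDl.
rewrite !lebesgue_measure_itv/= !lte_fin ltrD2r.
by case: ifP => // _; rewrite -!EFinB; congr (_%:E); ring.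
Qed.

Lemma integral_shift (f : R -> \bar R) (a : R) :
  measurable_fun setT (f : measurableTypeR R -> \bar R) -> (forall t, 0 <= f t) ->
  \int[mu]_t f (a + t)%R = \int[mu]_t f t.
Proof.
move=> mf f0.
pose m0 : {measure set (measurableTypeR R) -> \bar R} :=
  pushforward mu ((fun t => (a + t)%R) : measurableTypeR R -> measurableTypeR R).
transitivity (\int[m0 (measurable_shift a)]_t f t).
  by rewrite ge0_integral_pushforward//; exact: measurable_shift.
by apply: eq_measure_integral => A mA _; exact: lebesgue_measure_shift.
Qed.

Lemma integral_shift_on (f : R -> \bar R) (a : R) (I J : set (measurableTypeR R)) :
  measurable I -> (forall t, I t <-> J (a + t)%R) ->
  measurable J -> measurable_fun setT (f : measurableTypeR R -> \bar R) ->
  (forall t, 0 <= f t) ->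
  \int[mu]_(t in I) f (a + t)%R = \int[mu]_(t in J) f t.
Proof.
move=> mI IJ mJ mf f0; rewrite [RHS]integral_mkcond -(@integral_shift _ a); last 2 first.
- by apply/(measurable_restrictT _ mJ); exact: measurable_funTS.
- by move=> t; rewrite /patch; case: ifP.
rewrite integral_mkcond; apply: eq_integral => t _; rewrite /patch.
by congr (if _ then _ else _); apply/idP/idP; rewrite !inE => /IJ.
Qed.

End time_shift.

Section occupation.
Context {R : realType} {d : nat}.
Implicit Types (t s : R) (x y z v : 'rV[R]_d) (U B : set 'rV[R]_d).
Notation TR := (measurableTypeR R).
Notation leb := (@lebesgue_rV R d).
Notation mu := (@lebesgue_measure R).
Context {dO : measure_display} {Omega : measurableType dO}.
Variables (P : 'rV[R]_d -> probability Omega R) (X : R -> Omega -> 'rV[R]_d).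
Hypotheses (Xm : forall t : R, 0 <= t -> measurable_fun setT (X t))
  (XM : strong_markov P X) (Xc : continuous_paths X)
  (X0 : forall x, {ae P x, forall w, X 0 w = x}).
Variables (q : set 'rV[R]_d -> R -> 'rV[R]_d -> 'rV[R]_d -> R).
Hypothesis hq : forall U : set 'rV[R]_d, open U -> bounded_set U ->
     is_killed_density P X U (q U).
Notation p := (heat q).

(** The Green function is the case of the window ]0, +oo[. Bounded windows are
    kept because they can be composed with a finite loss. *)
Definition occupation U (I : set R) x y : \bar R :=
  (\int[mu]_(t in I) (p U t x y)%:E)%E.

Lemma greenE U x y : U x -> U y -> green q U x y = occupation U `]0%R, +oo[ x y.
Proof.
move=> Ux Uy; apply: eq_integral => t; rewrite inE /= in_itv /= andbT => t0.
by rewrite heatE.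
Qed.

Section domain.
Variable U : set 'rV[R]_d.
Hypotheses (oU : open U) (bU : bounded_set U).
Let hU := hq oU bU.

Lemma occupation_ge0 I x y : (0 <= occupation U I x y)%E.
Proof. by apply: integral_ge0 => t _; rewrite lee_fin (heat_ge0 hU). Qed.

Lemma heat_measurable_on (I : set TR) x y :
  measurable_fun I (fun t : TR => (p U t x y)%:E).
Proof.
by apply/measurable_EFinP; apply: measurable_funTS; exact: (heat_measurable_t oU hU).
Qed.

Lemma occupation_subset (I J : set TR) x y : measurable I -> measurable J -> I `<=` J ->
  (occupation U I x y <= occupation U J x y)%E.
Proof.
move=> mI mJ IJ; apply: ge0_subset_integral => //; first exact: heat_measurable_on.
by move=> t _; rewrite lee_fin (heat_ge0 hU).
Qed.

Lemma measurable_occupation (J : set TR) y : measurable J ->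
  measurable_fun setT ((occupation U J)^~ y).
Proof.
move=> mJ; have := @measurable_integral_on R _ _ _ _ mu J
  (fun vt : 'rV[R]_d * TR => (p U vt.2 vt.1 y)%:E) mJ.
apply; last by move=> z; rewrite lee_fin (heat_ge0 hU).
apply/measurable_EFinP.
exact: (measurableT_comp (heat_measurable_tv' oU hU y) (@measurable_swap _ _ _ _)).
Qed.

Lemma measurable_occupation' (J : set TR) x : measurable J ->
  measurable_fun setT (occupation U J x).
Proof.
move=> mJ; have := @measurable_integral_on R _ _ _ _ mu J
  (fun vt : 'rV[R]_d * TR => (p U vt.2 x vt.1)%:E) mJ.
apply; last by move=> z; rewrite lee_fin (heat_ge0 hU).
apply/measurable_EFinP.
exact: (measurableT_comp (heat_measurable_tv oU hU x) (@measurable_swap _ _ _ _)).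
Qed.

Lemma measurable_shifted_occupation (I J : set TR) x y : measurable J ->
  J `<=` [set s | 0 < s] -> I `<=` [set t | 0 < t] ->
  measurable_fun I (fun t : TR => (\int[mu]_(s in J) (p U (t + s)%R x y)%:E)%E).
Proof.
move=> mJ J0 I0; have mp : measurable_fun setT
    (fun ts : TR * TR => (p U (ts.1 + ts.2)%R x y)%:E).
  apply/measurable_EFinP; apply: (measurableT_comp (heat_measurable_t oU hU x y)).
  exact: measurable_funD.
apply: measurable_funTS.
apply: (@measurable_integral_on R _ _ _ _ mu J _ mJ mp).
by move=> z; rewrite lee_fin (heat_ge0 hU).
Qed.

(** The Chapman-Kolmogorov equation integrated over both durations, the midpoint
    being integrated last. *)
Theorem occupation_convolution (I J : set TR) x y : measurable I -> measurable J ->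
  I `<=` [set t | 0 < t] -> J `<=` [set s | 0 < s] ->
  (\int[mu]_(t in I) \int[mu]_(s in J) (p U (t + s)%R x y)%:E =
   \int[leb]_v (occupation U I x v * occupation U J v y))%E.
Proof.
move=> mI mJ I0 J0.
pose f t (sv : TR * 'rV[R]_d) := ((p U t x sv.2)%:E * (p U sv.1 sv.2 y)%:E)%E.
pose g (tv : TR * 'rV[R]_d) := ((p U tv.1 x tv.2)%:E * occupation U J tv.2 y)%E.
have msnd : measurable_fun setT (@snd TR 'rV[R]_d) by exact: measurable_snd.
transitivity (\int[mu]_(t in I) \int[leb]_v g (t, v))%E.
  apply: eq_integral => t; rewrite inE => /I0 t0.
  transitivity (\int[mu]_(s in J) \int[leb]_v f t (s, v))%E.
    apply: eq_integral => s; rewrite inE => /J0 s0.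
    exact: (heat_semigroup Xm XM Xc X0 hq).
  rewrite (@tonelli_on R _ _ _ _ mu leb J setT (f t))//; last 2 first.
  - apply: emeasurable_funM; apply/measurable_EFinP.
      exact: (measurableT_comp (heat_measurable_y oU hU t x) msnd).
    exact: (heat_measurable_tv' oU hU).
  - by move=> z; rewrite mule_ge0// lee_fin (heat_ge0 hU).
  apply: eq_integral => v _; rewrite /f /g /=.
  rewrite ge0_integralZl_EFin//; last exact: (heat_ge0 hU).
  - by move=> s _; rewrite lee_fin (heat_ge0 hU).
  - exact: heat_measurable_on.
rewrite (@tonelli_on R _ _ _ _ mu leb I setT g)//; last 2 first.
- apply: emeasurable_funM; first by apply/measurable_EFinP; exact: (heat_measurable_tv oU hU).
  exact: (measurableT_comp (measurable_occupation y mJ) msnd).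
- by move=> z; rewrite mule_ge0// ?lee_fin ?(heat_ge0 hU)// occupation_ge0.
apply: eq_integral => v _; rewrite /g /= ge0_integralZr//.
- exact: heat_measurable_on.
- by move=> t _; rewrite lee_fin (heat_ge0 hU).
- exact: occupation_ge0.
Qed.

Lemma shifted_occupation t (J K : set TR) x y : measurable J -> measurable K ->
  (forall s, J s <-> K (t + s)) ->
  (\int[mu]_(s in J) (p U (t + s)%R x y)%:E = occupation U K x y)%E.
Proof.
move=> mJ mK JK; apply: (@integral_shift_on R (fun s => (p U s x y)%:E)) => //.
- by apply/measurable_EFinP; exact: (heat_measurable_t oU hU).
- by move=> s; rewrite lee_fin (heat_ge0 hU).
Qed.

Lemma lebesgue_measure_0T (T : R) : 0 <= T -> mu `]0, T[%classic = T%:E.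
Proof.
move=> T0; rewrite lebesgue_measure_itv/= lte_fin; case: ifPn => [_|].
  by rewrite oppr0 adde0.
by rewrite -leNgt => T0'; congr (_%:E); apply/eqP; rewrite eq_le T0 T0'.
Qed.

(** For each first duration t < T1 the total duration t + s sweeps a window
    contained in ]0, T1 + T2[, so that the occupation density is counted during
    a time T1 at most. *)
Lemma occupation_compose (T1 T2 : R) x y : 0 < T1 -> 0 < T2 ->
  (\int[leb]_v (occupation U `]0%R, T1[ x v * occupation U `]0%R, T2[ v y)
   <= T1%:E * occupation U `]0%R, (T1 + T2)%R[ x y)%E.
Proof.
move=> T10 T20.
have pos T : `]0, T[%classic `<=` [set t : TR | 0 < t].
  by move=> t /=; rewrite in_itv /= => /andP[].
rewrite -occupation_convolution//.
rewrite -(lebesgue_measure_0T (ltW T10)) muleC -integral_cst//.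
apply: ge0_le_integral => //.
- by move=> t _; apply: integral_ge0 => s _; rewrite lee_fin (heat_ge0 hU).
- exact: measurable_shifted_occupation.
- move=> t /=; rewrite in_itv /= => /andP[t0 tT].
  rewrite (shifted_occupation (K := `]t, (t + T2)%R[%classic))//; last first.
    by move=> s /=; rewrite !in_itv /= ltrDl ltrD2l.
  apply: occupation_subset => // s /=; rewrite !in_itv /= => /andP[ts sT].
  by rewrite (lt_trans t0 ts) (lt_trans sT)// ltrD2r.
Qed.

(** For each first duration t < T the total duration sweeps ]t, +oo[, which
    contains [T, +oo[; the tail is thus counted at least during a time T. *)
Lemma occupation_tail (T : R) x y : 0 < T ->
  (T%:E * occupation U `[T, +oo[ x y
   <= \int[leb]_v (occupation U `]0%R, +oo[ x v * occupation U `]0%R, +oo[ v y))%E.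
Proof.
move=> T0.
have pos b : [set` Interval (BRight (0:R)) b] `<=` [set t : TR | 0 < t].
  by move=> t /=; rewrite itv_boundlr => /andP[].
rewrite -occupation_convolution//.
rewrite -(lebesgue_measure_0T (ltW T0)) muleC -integral_cst//.
apply: (@le_trans _ _ (\int[mu]_(t in `]0%R, T[%classic)
    \int[mu]_(s in `]0%R, +oo[%classic) (p U (t + s)%R x y)%:E)%E).
  apply: ge0_le_integral => //.
  - by move=> t _; exact: occupation_ge0.
  - by apply: measurable_shifted_occupation => //; exact: pos.
  - move=> t /=; rewrite in_itv /= => /andP[t0 tT].
    rewrite (shifted_occupation (K := `]t, +oo[%classic))//; last first.
      by move=> s /=; rewrite !in_itv /= !andbT ltrDl.
    apply: occupation_subset => // s /=; rewrite !in_itv /= !andbT.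
    exact: lt_le_trans.
apply: ge0_subset_integral => //.
- by apply: measurable_shifted_occupation => //; exact: pos.
- by move=> t _; apply: integral_ge0 => s _; rewrite lee_fin (heat_ge0 hU).
- by move=> t /=; rewrite !in_itv /= andbT => /andP[].
Qed.

Lemma occupation_split (T : R) x y : 0 < T ->
  (occupation U `]0%R, +oo[ x y =
   occupation U `]0%R, T[ x y + occupation U `[T, +oo[ x y)%E.
Proof.
move=> T0; rewrite /occupation -ge0_integral_setU//.
- congr (integral _ _ _); apply/seteqP; split => t /=; rewrite !in_itv /= !andbT.
    by move=> t0; have [tT|tT] := ltP t T; [left; rewrite t0|right].
  by move=> [/andP[]//|]; exact: lt_le_trans.
- exact: heat_measurable_on.
- by move=> t _; rewrite lee_fin (heat_ge0 hU).
- apply/disj_setPS => t [/=]; rewrite !in_itv /= !andbT => /andP[_ tT].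
  by rewrite leNgt tT.
Qed.

End domain.

Lemma occupation_mono U U' I x y : open U -> bounded_set U -> open U' -> bounded_set U' ->
  U `<=` U' -> measurable (I : set TR) -> (occupation U I x y <= occupation U' I x y)%E.
Proof.
move=> oU bU oU' bU' UU' mI; apply: ge0_le_integral => //.
- by move=> t _; rewrite lee_fin (heat_ge0 (hq oU bU)).
- exact: heat_measurable_on.
- exact: heat_measurable_on.
- by move=> t _; rewrite lee_fin (heat_mono Xm XM Xc X0 hq).
Qed.

End occupation.

(** * Lower bounds along chains of balls *)

Section chains.
Context {R : realType} {d : nat}.
Hypothesis hd : (2 < d)%N.
Implicit Types (t s : R) (x y z v : 'rV[R]_d) (U B D : set 'rV[R]_d).
Notation leb := (@lebesgue_rV R d).
Context {dO : measure_display} {Omega : measurableType dO}.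
Variables (P : 'rV[R]_d -> probability Omega R) (X : R -> Omega -> 'rV[R]_d).
Hypotheses (Xm : forall t : R, 0 <= t -> measurable_fun setT (X t))
  (XM : strong_markov P X) (Xc : continuous_paths X)
  (X0 : forall x, {ae P x, forall w, X 0 w = x}).
Variables (q : set 'rV[R]_d -> R -> 'rV[R]_d -> 'rV[R]_d -> R).
Hypothesis hq : forall U : set 'rV[R]_d, open U -> bounded_set U ->
     is_killed_density P X U (q U).
Variables (r1 : R) (hball : green_ball_estimates q r1).
Notation occ := (occupation q).

Lemma occupation_out U I x y : ~ (U x /\ U y) -> occ U I x y = 0%E.
Proof.
move=> nU; apply: integral0_eq => t _; rewrite heat_out// => -[_ Ux Uy].
exact: nU.
Qed.

(** Only the midpoints in a ball are kept in [occupation_compose]. The endpoints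
    x and y are excluded from them, as bounds off the diagonal are all that is
    available at first; they form a null set. *)
Lemma occupation_compose_ball U (w : 'rV[R]_d) (r a b T1 T2 : R) x y : open U -> bounded_set U ->
  0 < r -> 0 <= a -> 0 <= b -> 0 < T1 -> 0 < T2 ->
  (forall v, eball w r v -> v != x -> v != y ->
    (a%:E <= occ U `]0%R, T1[ x v)%E /\ (b%:E <= occ U `]0%R, T2[ v y)%E) ->
  ((a * b * (2 * (r / d.+1%:R)) ^+ d / T1)%:E <= occ U `]0%R, (T1 + T2)%R[ x y)%E.
Proof.
move=> oU bU r0 a0 b0 T10 T20 ab.
have occ0 := occupation_ge0 hq oU bU.
have mf : measurable_fun setT (fun v => occ U `]0%R, T1[ x v * occ U `]0%R, T2[ v y)%E.
  apply: emeasurable_funM.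
    by apply: (measurable_occupation' hq oU bU).
  by apply: (measurable_occupation hq oU bU).
have mb := measurable_eball w r.
have mb' : measurable (eball w r `\ x `\ y).
  by apply: measurableD; [apply: measurableD => //|]; exact: measurable_set1_rV.
have volE : leb (eball w r `\ x `\ y) = leb (eball w r).
  have vD (A : set 'rV[R]_d) z : measurable A -> (leb A < +oo)%E -> leb (A `\ z) = leb A.
    move=> mA finA; rewrite measureD//; last exact: measurable_set1_rV.
    rewrite [X in (_ - X)%E](_ : _ = 0%E) ?sube0//.
    apply/eqP; rewrite eq_le measure_ge0 andbT -(lebesgue_rV_point hd z).
    apply: le_measure; rewrite ?inE//; last exact: measurable_set1_rV.
    by apply: measurableI => //; exact: measurable_set1_rV.
  have finb : (leb (eball w r) < +oo)%E.
    by apply: le_lt_trans (lebesgue_rV_eball_le w r0) _; rewrite ltry.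
  have m1 : measurable (eball w r `\ x) by apply: measurableD => //; exact: measurable_set1_rV.
  by rewrite !vD// vD.
have : ((a * b)%:E * leb (eball w r) <= T1%:E * occ U `]0%R, (T1 + T2)%R[ x y)%E.
  apply: le_trans (occupation_compose Xm XM Xc X0 hq oU bU x y T10 T20).
  rewrite -volE -integral_cst//.
  apply: (@le_trans _ _ (\int[leb]_(v in eball w r `\ x `\ y)
     (occ U `]0%R, T1[ x v * occ U `]0%R, T2[ v y))%E).
    apply: ge0_le_integral => //.
    - by move=> v _; rewrite lee_fin mulr_ge0.
    - exact: measurable_funTS.
    - move=> v [[wv /= /eqP vx] /eqP vy]; have [h1 h2] := ab v wv vx vy.
      by rewrite EFinM; apply: lee_pmul.
  apply: ge0_subset_integral => //.
  by move=> v _; rewrite mule_ge0.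
move=> H; have {H} := le_trans _ H; move=> /(_ ((a * b)%:E * ((2 * (r / d.+1%:R)) ^+ d)%:E)%E).
move=> H; have {H} : ((a * b)%:E * ((2 * (r / d.+1%:R)) ^+ d)%:E <=
    T1%:E * occ U `]0%R, (T1 + T2)%R[ x y)%E.
  apply: H; apply: lee_wpmul2l; first by rewrite lee_fin mulr_ge0.
  exact: lebesgue_rV_eball_ge.
by rewrite -EFinM muleC -lee_pdivrMr// -EFinM mulrC.
Qed.

(** In a ball of radius s both bounds of the Green function are known. By
    [occupation_tail] the part of it that comes from times after K s^2 is at
    most (K s^2)^-1 times the integral of newton x v * newton v y, which is of
    order s^2 newton x y: for K large this is half of the lower bound, and the
    other half comes from times before K s^2. *)
Lemma occupation_ball_offdiag : exists K c : R, [/\ 0 < K, 0 < c &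
  forall (w : 'rV[R]_d) s x y, 0 < s -> s <= r1 -> eball w (s / 2) x -> eball w (s / 2) y -> x != y ->
   ((c * s ^ (2 - d%:Z))%:E <= occ (eball w s) `]0%R, (K * s ^+ 2)%R[ x y)%E].
Proof.
have [g g1 gP] := hball.
have g0 : 0 < g by exact: lt_trans g1.
(* g^2 comes from the upper bound of both factors of the composition, 8 * 8^d
   from integral_newton_mul, and 2 g turns the result into half of the lower
   bound. *)
pose K := 2 * g ^+ 3 * (8 * 8 ^+ d).
have K0 : 0 < K by rewrite !mulr_gt0 ?exprn_gt0.
exists K, (2 * g)^-1; split => //; first by rewrite invr_gt0 mulr_gt0.
move=> w s x y s0 sr1 wx wy xy; have [gu gl] := gP s w s0 sr1.
set U := eball w s.
have oU : open U by exact: open_eball.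
have bU : bounded_set U by exact: eball_bounded.
have sub2 : eball w (s / 2) `<=` U by apply: le_eball; lra.
have [Ux Uy] := (sub2 _ wx, sub2 _ wy).
pose n := newton x y; have n0 : 0 < n by exact: newton_gt0.
have T0 : 0 < K * s ^+ 2 by rewrite mulr_gt0// exprn_gt0.
set T := K * s ^+ 2 in T0 *.
have lower : ((g^-1 * n)%:E <= occ U `]0%R, +oo[ x y)%E.
  rewrite -greenE//; apply: gl => //; rewrite /ecball /= ltW//.
    by apply: lt_le_trans wx _; lra.
  by apply: lt_le_trans wy _; lra.
have occ0 := occupation_ge0 hq oU bU.
have mf : measurable_fun setT (fun v => occ U `]0%R, +oo[ x v * occ U `]0%R, +oo[ v y)%E.
  apply: emeasurable_funM.
    by apply: (measurable_occupation' hq oU bU).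
  by apply: (measurable_occupation hq oU bU).
have mb := measurable_eball w s.
have tail : (T%:E * occ U `[T, +oo[ x y <= (g ^+ 2 * (8 * 8 ^+ d * n * s ^+ 2))%:E)%E.
  apply: le_trans (occupation_tail Xm XM Xc X0 hq oU bU x y T0) _.
  have -> : (\int[leb]_v (occ U `]0%R, +oo[ x v * occ U `]0%R, +oo[ v y) =
     \int[leb]_(v in U) (occ U `]0%R, +oo[ x v * occ U `]0%R, +oo[ v y))%E.
    rewrite [RHS]integral_mkcond; apply: eq_integral => v _; rewrite /patch.
    case: ifPn => //; rewrite notin_setE => nUv.
    by rewrite occupation_out ?mul0e// => -[].
  apply: (@le_trans _ _ (\int[leb]_(v in U)
      ((g ^+ 2)%:E * (newton x v * newton v y)%:E))%E); last first.
    rewrite ge0_integralZl_EFin//; last 3 first.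
    - by move=> v _; rewrite lee_fin mulr_ge0// newton_ge0.
    - apply/measurable_EFinP; apply: measurable_funTS; apply: measurable_funM.
        exact: measurable_newton.
      rewrite (_ : newton^~ y = newton y); first exact: measurable_newton.
      by apply/funext => v; exact: newtonC.
    - by rewrite exprn_ge0// ltW.
    rewrite [leRHS]EFinM; apply: lee_wpmul2l; first by rewrite lee_fin exprn_ge0// ltW.
    exact: integral_newton_mul.
  apply: ae_ge0_le_integral => //.
  - by move=> v _; rewrite mule_ge0.
  - exact: measurable_funTS.
  - by move=> v _; rewrite -EFinM lee_fin !mulr_ge0 ?newton_ge0 ?exprn_ge0// ltW.
  - apply/measurable_EFinP; apply: measurable_funTS; apply: measurable_funM => //.
    apply: measurable_funM; first exact: measurable_newton.
    rewrite (_ : newton^~ y = newton y); first exact: measurable_newton.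
    by apply/funext => v; exact: newtonC.
  exists ([set x] `|` [set y]); split.
  - by apply: measurableU; exact: measurable_set1_rV.
  - apply/eqP; rewrite eq_le measure_ge0 andbT.
    apply: (@le_trans _ _ (leb [set x] + leb [set y])%E).
      by apply: measureU2; exact: measurable_set1_rV.
    by rewrite !lebesgue_rV_point// adde0.
  - move=> v /= nv; apply: contrapT => /not_orP[vx vy]; apply: nv => Uv.
    have -> : ((g ^+ 2)%:E * (newton x v * newton v y)%:E =
               (g * newton x v)%:E * (g * newton v y)%:E)%E.
      by rewrite -!EFinM; congr (_%:E); ring.
    apply: lee_pmul => //.
      by rewrite -greenE//; apply: gu => //; apply/eqP => vx'; apply: vx.
    by rewrite -greenE//; apply: gu => //; apply/eqP.
have tail' : (occ U `[T, +oo[ x y <= ((2 * g)^-1 * n)%:E)%E.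
  move: tail; rewrite -lee_pdivlMl// -EFinM; move=> /le_trans; apply.
  rewrite lee_fin /T /K le_eqVlt; apply/orP; left; apply/eqP; field.
  by rewrite !gt_eqF// exprn_gt0.
move: lower; rewrite (occupation_split hq oU bU x y T0) => lower.
have : ((g^-1 * n)%:E <= occ U `]0%R, T[ x y + ((2 * g)^-1 * n)%:E)%E.
  by apply: le_trans lower _; rewrite leeD2l.
rewrite -leeBlDr// -EFinB; apply: le_trans; rewrite lee_fin.
have -> : g^-1 * n - (2 * g)^-1 * n = (2 * g)^-1 * n by field; rewrite gt_eqF.
rewrite ler_pM2l ?invr_gt0 ?mulr_gt0//.
apply: newton_antimono => //; first by rewrite eucl_dist_gt0.
rewrite (le_trans (eucl_dist_tri w _ _))// (splitr s) lerD// ltW//.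
by rewrite eucl_distC.
Qed.

(** Composing over a ball of radius of order s gains a volume s^d and loses a
    time s^2, which is what turns the product of two kernels of size s^(2-d)
    into one of the same size. *)
Lemma scale_identity (a b k K s : R) : 0 < K -> 0 < s ->
  (a * s ^ (2 - d%:Z)) * (b * s ^ (2 - d%:Z)) * (k * s) ^+ d / (K * s ^+ 2) =
  a * b * k ^+ d / K * s ^ (2 - d%:Z).
Proof.
move=> K0 s0; rewrite exprz_newton// exprMn.
have -> : s ^+ d = s ^+ (d - 2) * s ^+ 2 by rewrite -exprD subnK// ltnW.
by field; rewrite !gt_eqF// exprn_gt0.
Qed.

(** One composition over the half ball of radius s / 2 extends the bound to the
    diagonal, where [occupation_ball_offdiag] says nothing. *)
Lemma occupation_ball : exists K c : R, [/\ 0 < K, 0 < c &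
  forall D (w : 'rV[R]_d) s x y, open D -> bounded_set D -> 0 < s -> s <= r1 -> eball w s `<=` D ->
   eball w (s / 2) x -> eball w (s / 2) y ->
   ((c * s ^ (2 - d%:Z))%:E <= occ D `]0%R, (K * s ^+ 2)%R[ x y)%E].
Proof.
have [K [c [K0 c0 Kc]]] := occupation_ball_offdiag.
have k0 : 0 < d.+1%:R^-1 :> R by rewrite invr_gt0.
exists (K + K), (c * c * d.+1%:R^-1 ^+ d / K); split.
- exact: addr_gt0.
- by rewrite divr_gt0// !mulr_gt0// exprn_gt0.
move=> D w s x y oD bD s0 sr1 wD wx wy.
have bB : bounded_set (eball w s) by exact: eball_bounded.
have oB : open (eball w s) by exact: open_eball.
have T0 : 0 < K * s ^+ 2 by rewrite mulr_gt0// exprn_gt0.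
have cs0 : 0 <= c * s ^ (2 - d%:Z) by rewrite mulr_ge0 ?(ltW c0)// exprz_newton// invr_ge0 exprn_ge0// ltW.
have Kc' x' y' : eball w (s / 2) x' -> eball w (s / 2) y' -> x' != y' ->
   ((c * s ^ (2 - d%:Z))%:E <= occ D `]0%R, (K * s ^+ 2)%R[ x' y')%E.
  move=> wx' wy' xy'; apply: le_trans (Kc w s x' y' s0 sr1 wx' wy' xy') _.
  exact: (occupation_mono Xm XM Xc X0 hq).
rewrite mulrDl -scale_identity//.
have -> : d.+1%:R^-1 * s = 2 * (s / 2 / d.+1%:R) by field.
apply: (occupation_compose_ball (w := w)) => //; first by rewrite divr_gt0.
by move=> v wv vx vy; split; apply: Kc' => //; rewrite eq_sym.
Qed.

(** The step s / 4 keeps the balls of radius s / 4 about two consecutive centres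
    inside the ball of radius s / 2 about the second one. *)
Inductive chain D (s : R) : nat -> 'rV[R]_d -> 'rV[R]_d -> Prop :=
| chain0 x : eball x s `<=` D -> chain D s 0 x x
| chainS n x y z : chain D s n x y -> eball z s `<=` D -> eucl_dist y z <= s / 4 ->
    chain D s n.+1 x z.

Lemma chain_cat D s n m x y z : chain D s n x y -> chain D s m y z -> chain D s (m + n) x z.
Proof.
move=> xy yz; elim: yz xy => [a aD|k a b c ab IH cD bc] xy; first by rewrite add0n.
by rewrite addSn; exact: chainS (IH xy) cD bc.
Qed.

(** Each step composes with the bound in one more ball, over the midpoints at
    distance less than s / 4 from the previous centre. The end points x' and y'
    vary in balls, as the induction requires. *)
Lemma occupation_chain n : exists K c : R, [/\ 0 < K, 0 < c &
  forall D s x y x' y', open D -> bounded_set D -> 0 < s -> s <= r1 ->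
   chain D s n x y -> eball x (s / 4) x' -> eball y (s / 4) y' ->
   ((c * s ^ (2 - d%:Z))%:E <= occ D `]0%R, (K * s ^+ 2)%R[ x' y')%E].
Proof.
have [K0 [c0 [K00 c00 KcP]]] := occupation_ball.
have k0 : 0 < (2 * (4^-1 / d.+1%:R)) :> R by rewrite mulr_gt0// divr_gt0// invr_gt0.
elim: n => [|n [K [c [Kn0 cn0 IH]]]].
  exists K0, c0; split => // D s x y x' y' oD bD s0 sr1 ch xx' yy'.
  have xD : eball x s `<=` D by inversion ch.
  have yx : y = x by inversion ch.
  have h : s / 4 <= s / 2 by lra.
  apply: (KcP D x) => //; first exact: le_eball xx'.
  by rewrite yx in yy'; exact: le_eball yy'.
exists (K + K0), (c * c0 * (2 * (4^-1 / d.+1%:R)) ^+ d / K); split.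
- exact: addr_gt0.
- by rewrite divr_gt0// !mulr_gt0// exprn_gt0.
move=> D s x z x' z' oD bD s0 sr1 ch xx' zz'.
inversion ch as [|m a y b chy zD yz]; subst.
have sd0 : 0 <= s ^ (2 - d%:Z) by rewrite exprz_newton// invr_ge0 exprn_ge0// ltW.
rewrite -scale_identity// (mulrDl K K0).
have -> : 2 * (4^-1 / d.+1%:R) * s = 2 * (s / 4 / d.+1%:R) by field.
apply: (occupation_compose_ball (w := y)) => //.
- by rewrite divr_gt0.
- by rewrite mulr_ge0// ltW.
- by rewrite mulr_ge0// ltW.
- by rewrite mulr_gt0// exprn_gt0.
- by rewrite mulr_gt0// exprn_gt0.
move=> v yv _ _; split; first exact: IH chy _ _.
apply: (KcP D z) => //.
  have h : s / 2 = s / 4 + s / 4 by lra.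
  rewrite /eball /= h eucl_distC; apply: (le_lt_trans (eucl_dist_tri y _ _)).
  by apply: ltr_leD => //; rewrite eucl_distC.
by apply: le_eball zz'; lra.
Qed.

End chains.

(** * Distance to the boundary, and graph charts *)

Section boundary_distance.
Context {R : realType} {d : nat}.
Implicit Types (x y z Q : 'rV[R]_d) (s : R).
Variable D : set 'rV[R]_d.
Hypotheses (oD : open D) (bD : bounded_set D) (d0 : (0 < d)%N).
Notation rho := (dist_boundary D).

Lemma boundary_notin Q : boundary D Q -> ~ D Q.
Proof. by move=> [_ nI] DQ; apply: nI; apply: open_nbhs_nbhs. Qed.

Lemma eball_in_open x : D x -> exists2 r : R, 0 < r & eball x r `<=` D.
Proof. by move=> Dx; apply/nbhs_eballP; exact: open_nbhs_nbhs. Qed.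

(** The boundary point is the first point of the segment from x to z that does
    not belong to D. *)
Lemma boundary_between x z : D x -> ~ D z ->
  exists2 Q, boundary D Q & eucl_dist x Q <= eucl_dist x z.
Proof.
move=> Dx nDz; pose p (t : R) := x + t *: (z - x).
have pd t t' : eucl_dist (p t) (p t') = `|t - t'| * eucl_dist x z.
  rewrite /eucl_dist /p opprD addrACA subrr add0r -scalerBl eucl_normZ.
  by congr (_ * _); rewrite -opprB eucl_normN.
have p0 : p 0 = x by rewrite /p scale0r addr0.
have p1 : p 1 = z by rewrite /p scale1r addrC subrK.
have L0 : 0 < eucl_dist x z by rewrite eucl_dist_gt0; apply: contraPneq nDz => <-.
pose S := [set t : R | 0 <= t /\ ~ D (p t)].
have S1 : S 1 by rewrite /S /= p1.
have Slb : has_lbound S by exists 0 => t [].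
have hS : has_inf S by split => //; exists 1.
pose t0 := inf S.
have t00 : 0 <= t0 by apply: lb_le_inf; [exists 1|move=> t []].
have t01 : t0 <= 1 by exact: ge_inf.
have before t : 0 <= t -> t < t0 -> D (p t).
  move=> tp tt0; apply: contrapT => nD; move: tt0; rewrite ltNge => /negP; apply.
  by apply: ge_inf.
have nDt0 : ~ D (p t0).
  move=> /eball_in_open[r r0 rD].
  have e0 : 0 < r / eucl_dist x z by rewrite divr_gt0.
  have [t [tp nDt] tlt] := inf_adherent e0 hS.
  have t0t : t0 <= t by exact: ge_inf.
  apply: nDt; apply: rD; rewrite /eball /= pd -ltr_pdivlMr// distrC ger0_norm ?subr_ge0//.
  by rewrite ltrBlDl.
have t0gt : 0 < t0.
  by rewrite lt_neqAle t00 andbT; apply/eqP => t0E; apply: nDt0; rewrite -t0E p0.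
exists (p t0); last by rewrite -p0 pd sub0r normrN ger0_norm// p0 ler_piMl// ltW.
split; last by move=> /interior_subset.
move=> B /nbhs_eballP[r r0 rB].
pose t := Num.max 0 (t0 - r / eucl_dist x z / 2).
have tp : 0 <= t by rewrite le_max lexx.
have tt0 : t < t0.
  by rewrite gt_max t0gt ltrBlDr ltrDl !divr_gt0.
exists (p t); split; first exact: before.
apply: rB; rewrite /eball /= pd -ltr_pdivlMr// ger0_norm ?subr_ge0 ?(ltW tt0)//.
have : t0 - r / eucl_dist x z / 2 <= t by rewrite le_max lexx orbT.
have : 0 < r / eucl_dist x z by rewrite divr_gt0.
by lra.
Qed.

Lemma exists_outside : exists z, ~ D z.
Proof.
have [r r0 Dr] := bounded_set_eball bD.
exists (const_mx r) => /Dr; rewrite /eball /= /eucl_dist sub0r eucl_normN => h.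
have := le_lt_trans (coord_le_eucl_norm _ (Ordinal d0)) h.
by rewrite mxE ger0_norm ?ltxx// ltW.
Qed.

Lemma dist_boundary_le x Q : boundary D Q -> rho x <= eucl_dist x Q.
Proof.
move=> bQ; apply: ge_inf; last by exists Q.
by exists 0 => _ [z _ <-]; exact: eucl_dist_ge0.
Qed.

Lemma has_inf_dist x : D !=set0 -> has_inf [set eucl_dist x z | z in boundary D].
Proof.
move=> [x0 Dx0]; have [z nDz] := exists_outside; have [Q bQ _] := boundary_between Dx0 nDz.
split; first by exists (eucl_dist x Q), Q.
by exists 0 => _ [z' _ <-]; exact: eucl_dist_ge0.
Qed.

Lemma le_dist_boundary x s : D !=set0 -> (forall Q, boundary D Q -> s <= eucl_dist x Q) ->
  s <= rho x.
Proof.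
move=> D0 sQ; apply: lb_le_inf; first by have [] := has_inf_dist x D0.
by move=> _ [Q bQ <-]; exact: sQ.
Qed.

Lemma near_boundary x s : D !=set0 -> rho x < s -> exists2 Q, boundary D Q & eucl_dist x Q < s.
Proof.
move=> D0 xs; have e0 : 0 < s - rho x by rewrite subr_gt0.
have [_ [Q bQ <-]] := inf_adherent e0 (has_inf_dist x D0).
by rewrite addrC subrK => h; exists Q.
Qed.

Lemma eball_dist_boundary x s : D x -> s <= rho x -> eball x s `<=` D.
Proof.
move=> Dx sx z xz; apply: contrapT => nDz.
have [Q bQ Qz] := boundary_between Dx nDz.
have := dist_boundary_le x bQ; apply/negP; rewrite -ltNge.
by apply: le_lt_trans Qz _; exact: lt_le_trans xz sx.
Qed.

Lemma eball_le_dist_boundary x s : 0 < s -> eball x s `<=` D -> s <= rho x.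
Proof.
move=> s0 xD; apply: le_dist_boundary; first by exists x; apply: xD; exact: eballxx.
move=> Q bQ; rewrite leNgt; apply/negP => xQ; apply: (boundary_notin bQ).
exact: xD.
Qed.

Lemma dist_boundary_gt0 x : D x -> 0 < rho x.
Proof.
by move=> /eball_in_open[r r0 /(eball_le_dist_boundary r0)]; exact: lt_le_trans.
Qed.

Lemma dist_boundary_lip x y : D !=set0 -> rho x <= rho y + eucl_dist x y.
Proof.
move=> D0; rewrite -lerBlDr; apply: le_dist_boundary => // Q bQ.
rewrite lerBlDr addrC; apply: le_trans (dist_boundary_le x bQ) _.
exact: eucl_dist_tri.
Qed.

Lemma chain_segment s n x y : 0 < s ->
  (forall th : R, 0 <= th <= 1 -> eball (x + th *: (y - x)) s `<=` D) ->
  eucl_dist x y <= n%:R * (s / 4) -> chain D s n x y.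
Proof.
move=> s0 segD; case: n => [|n] xy.
  have -> : y = x.
    apply/eqP; rewrite eq_sym -[_ == _]negbK -eucl_dist_gt0 -leNgt.
    by rewrite (le_trans xy)// mul0r.
  by apply: chain0; have := segD 0; rewrite scale0r addr0 lexx ler01; apply.
have n0 : 0 < n.+1%:R :> R by [].
suff H i : (i <= n.+1)%N -> chain D s i x (x + (i%:R / n.+1%:R) *: (y - x)).
  have := H n.+1 (leqnn _); rewrite divff ?gt_eqF// scale1r.
  by rewrite [x + _]addrC subrK.
elim: i => [_|i IH iN].
  rewrite mul0r scale0r addr0; apply: chain0.
  by have := segD 0; rewrite scale0r addr0 lexx ler01; apply.
apply: chainS (IH (ltnW iN)) _ _.
  by apply: segD; rewrite divr_ge0//= ler_pdivrMr// mul1r ler_nat.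
rewrite /eucl_dist opprD addrACA subrr add0r -scalerBl -mulrBl eucl_normZ.
rewrite -natr1 opprD addrA subrr add0r normrM normrN1 mul1r ger0_norm ?invr_ge0//.
by rewrite -opprB eucl_normN ler_pdivrMl.
Qed.

End boundary_distance.

Section chart.
Context {R : realType} {d : nat}.
Implicit Types (x y z v Q : 'rV[R]_d).

Lemma mul_cV_coord n (v : 'rV[R]_n) (e : 'cV[R]_n) :
  (v *m e) 0 0 = \sum_i v 0 i * e i 0.
Proof. by rewrite mxE. Qed.

(** The columns of O are orthonormal, so O O^T preserves the norm of v O, and
    |v O|^2 is the inner product of v with v O O^T; Cauchy-Schwarz concludes. *)
Lemma eucl_norm_mulr_orth n m (O : 'M[R]_(n, m)) (v : 'rV[R]_n) :
  O^T *m O = 1%:M -> eucl_norm (v *m O) <= eucl_norm v.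
Proof.
move=> OO; set p := v *m O.
have sq k (u : 'rV[R]_k) : eucl_norm u ^+ 2 = (u *m u^T) 0 0.
  by rewrite eucl_norm_sqr mul_cV_coord; apply: eq_bigr => i _; rewrite mxE expr2.
have [p0|p0] := eqVneq (eucl_norm p) 0; first by rewrite p0 eucl_norm_ge0.
have pp : 0 < eucl_norm p by rewrite lt_neqAle eq_sym p0 eucl_norm_ge0.
pose w := p *m O^T.
have wp : eucl_norm w = eucl_norm p.
  apply/eqP; rewrite -(eqrXn2 (ltn0Sn 1)) ?eucl_norm_ge0// !sq /w trmx_mul trmxK.
  by rewrite mulmxA -(mulmxA p) OO mulmx1.
have pvw : eucl_norm p ^+ 2 = \sum_i v 0 i * w 0 i.
  rewrite sq /w /p trmx_mul [in LHS]mulmxA -(mulmxA v).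
  rewrite -mulmxA mul_cV_coord; apply: eq_bigr => i _; congr (_ * _).
  rewrite -[in RHS](trmxK (_ *m _)) [RHS]mxE; congr (fun_of_matrix _ _ _).
  by rewrite [RHS]trmx_mul trmx_mul trmxK.
have := cauchy_schwarz (fun i => v 0 i) (fun i => w 0 i).
rewrite -pvw -!eucl_norm_sqr wp -exprMn.
by rewrite ler_pXn2r ?nnegrE ?mulr_ge0 ?exprn_ge0 ?eucl_norm_ge0// expr2 ler_pM2r.
Qed.

Variables (D : set 'rV[R]_d) (Q : 'rV[R]_d) (R0 Lam : R).
Hypothesis Lam0 : 0 <= Lam.
Variables (phi : 'rV[R]_d.-1 -> R) (O : 'M[R]_(d, d.-1)) (e : 'cV[R]_d).
Hypotheses (phi_lip : forall a b, `|phi a - phi b| <= Lam * eucl_dist a b)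
  (OO : O^T *m O = 1%:M) (Oe : O^T *m e = 0) (ee : e^T *m e = 1%:M)
  (DE : eball Q R0 `&` D =
        eball Q R0 `&` [set y | phi ((y - Q) *m O) < ((y - Q) *m e) 0 0]).

Definition height y : R := ((y - Q) *m e) 0 0 - phi ((y - Q) *m O).

Lemma height_gt0 y : eball Q R0 y -> D y <-> 0 < height y.
Proof.
move=> Qy; rewrite /height subr_gt0; split=> [Dy|hy].
  by have [] : (eball Q R0 `&` [set y | phi ((y - Q) *m O) < ((y - Q) *m e) 0 0]) y by rewrite -DE.
by have [] : (eball Q R0 `&` D) y by rewrite DE.
Qed.

Lemma height_lip y z : `|height y - height z| <= (1 + Lam) * eucl_dist y z.
Proof.
have vE : ((y - Q) *m e) 0 0 - ((z - Q) *m e) 0 0 = ((y - z) *m e) 0 0.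
  have -> : y - z = (y - Q) - (z - Q) by rewrite opprB addrA subrK.
  by rewrite [in RHS]mulmxBl [RHS]mxE; congr (_ + _); rewrite [RHS]mxE.
have tE : (y - Q) *m O - (z - Q) *m O = (y - z) *m O.
  by rewrite -mulmxBl; congr (_ *m _); rewrite opprB addrA subrK.
rewrite /height (_ : _ - _ = ((y - z) *m e) 0 0 -
   (phi ((y - Q) *m O) - phi ((z - Q) *m O))); last by rewrite -vE; ring.
apply: le_trans (ler_normB _ _) _; rewrite mulrDl mul1r; apply: lerD.
  apply: le_trans (coord_le_eucl_norm ((y - z) *m e : 'rV_1) 0) _.
  exact: eucl_norm_mulr_orth.
apply: le_trans (phi_lip _ _) _; apply: ler_wpM2l => //.
by rewrite /eucl_dist tE; exact: eucl_norm_mulr_orth.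
Qed.

Lemma height_up y (t : R) : height (y + t *: e^T) = height y + t.
Proof.
rewrite /height (_ : y + t *: e^T - Q = (y - Q) + t *: e^T); last by rewrite addrAC.
rewrite !mulmxDl -!scalemxAl ee -[e^T *m O]trmxK trmx_mul trmxK Oe trmx0 scaler0 addr0.
by rewrite !mxE eqxx mulr1; ring.
Qed.

Lemma eucl_dist_up y (t : R) : eucl_dist y (y + t *: e^T) = `|t|.
Proof.
rewrite /eucl_dist opprD addrA subrr add0r eucl_normN eucl_normZ.
rewrite [X in _ * X](_ : _ = 1) ?mulr1//.
rewrite /eucl_norm (_ : \sum_i _ = 1) ?sqrtr1//.
have := congr1 (fun A : 'M[R]_1 => A 0 0) ee; rewrite mul_cV_coord [X in _ = X]mxE eqxx mulr1n => <-.
by apply: eq_bigr => i _; rewrite !mxE expr2.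
Qed.

(** Otherwise the point of the graph below y would lie in the ball about y,
    hence in D. *)
Lemma height_ge y (m : R) : eball y m `<=` D -> 0 < m -> eucl_dist Q y + m <= R0 ->
  m <= height y.
Proof.
move=> yD m0 ym; have Dy : D y by apply: yD; exact: eballxx.
have Qy : eball Q R0 y by rewrite /eball /=; apply: lt_le_trans ym; rewrite ltrDl.
have h0 : 0 < height y by apply/(height_gt0 Qy).
rewrite leNgt; apply/negP => hm.
pose z := y + (- height y) *: e^T.
have yz : eball y m z by rewrite /eball /= eucl_dist_up normrN ger0_norm// ltW.
have Qz : eball Q R0 z.
  by apply: (sub_eball ym).
have /(height_gt0 Qz) : D z by exact: yD.
by rewrite height_up subrr ltxx.
Qed.

Lemma eball_height y (m : R) : 0 < m -> m <= height y ->
  eucl_dist Q y + m <= R0 -> eball y (m / (1 + Lam)) `<=` D.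
Proof.
move=> m0 mh ym v yv; have L1 : 0 < 1 + Lam by rewrite ltr_wpDr.
have Qv : eball Q R0 v.
  apply: (sub_eball ym); apply: le_eball yv.
  by rewrite ler_pdivrMr// ler_peMr ?(ltW m0)// lerDl.
apply/(height_gt0 Qv).
have := height_lip y v; move: yv; rewrite /eball /= ltr_pdivlMr// mulrC => yv hl.
have := le_lt_trans hl yv; rewrite ltr_norml => /andP[_].
by lra.
Qed.

(** The segment from x to y may leave D. Lifting both end points by H m, where H m
    exceeds the variation of the height along that segment, makes it stay at
    height at least m; the chain goes up from x, across, and down to y. Since
    the height is (1 + Lam)-Lipschitz, height m leaves room for balls of radius
    m / (1 + Lam). The numbers n1 and n2 count the vertical and the horizontal
    steps. *)
Lemma chart_chain x y (K m : R) (n1 n2 : nat) : 0 < m -> 0 <= K ->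
  eball x m `<=` D -> eball y m `<=` D -> eucl_dist x y <= K * m ->
  eucl_dist Q x + (K + (1 + Lam) * K + 1) * m <= R0 ->
  4 * (1 + Lam) * ((1 + Lam) * K) <= n1%:R -> 4 * (1 + Lam) * K <= n2%:R ->
  chain D (m / (1 + Lam)) (n1 + (n2 + n1)) x y.
Proof.
move=> m0 K0 xD yD xy Qx hn1 hn2.
have L1 : 0 < 1 + Lam by rewrite ltr_wpDr.
set H := (1 + Lam) * K.
have H0 : 0 <= H by rewrite mulr_ge0// ltW.
have s0 : 0 < m / (1 + Lam) by rewrite divr_gt0.
have Km0 : 0 <= K * m by rewrite mulr_ge0// ltW.
have Hm0 : 0 <= H * m by rewrite mulr_ge0// ltW.
have {}Qx : eucl_dist Q x + K * m + H * m + m <= R0.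
  apply: le_trans Qx; rewrite le_eqVlt; apply/orP; left; apply/eqP.
  by rewrite /H; ring.
have Qy : eucl_dist Q y <= eucl_dist Q x + K * m.
  by apply: le_trans (eucl_dist_tri x _ _) _; rewrite lerD2l.
have hx : m <= height x by apply: height_ge => //; lra.
have hy : m <= height y by apply: height_ge => //; lra.
have up z (t : R) : m <= height z -> 0 <= t <= H * m -> eucl_dist Q z + H * m + m <= R0 ->
    eball (z + t *: e^T) (m / (1 + Lam)) `<=` D.
  move=> hz /andP[t0 tH] Qz; apply: eball_height => //.
    by rewrite height_up; lra.
  have : eucl_dist Q (z + t *: e^T) <= eucl_dist Q z + t.
    by apply: le_trans (eucl_dist_tri z _ _) _; rewrite eucl_dist_up ger0_norm.
  by lra.
have Hn : H * m <= n1%:R * (m / (1 + Lam) / 4).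
  have -> : n1%:R * (m / (1 + Lam) / 4) = n1%:R / (4 * (1 + Lam)) * m.
    by field; rewrite gt_eqF.
  by rewrite ler_pM2r// ler_pdivlMr ?mulr_gt0// mulrC.
have Kn : K * m <= n2%:R * (m / (1 + Lam) / 4).
  have -> : n2%:R * (m / (1 + Lam) / 4) = n2%:R / (4 * (1 + Lam)) * m.
    by field; rewrite gt_eqF.
  by rewrite ler_pM2r// ler_pdivlMr ?mulr_gt0// mulrC.
apply: (chain_cat (y := y + (H * m) *: e^T)); last first.
  apply: chain_segment => //; last by rewrite eucl_distC eucl_dist_up ger0_norm.
  move=> th /andP[th0 th1].
  have -> : y + (H * m) *: e^T + th *: (y - (y + (H * m) *: e^T)) = y + ((1 - th) * (H * m)) *: e^T.
    rewrite opprD addrA subrr add0r scalerN scalerA -addrA -scalerBl.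
    by congr (_ + _ *: _); ring.
  apply: up => //; last by lra.
  by rewrite mulr_ge0 ?subr_ge0//= ler_piMl// lerBlDr lerDl.
apply: (chain_cat (y := x + (H * m) *: e^T)).
  apply: chain_segment => //; last by rewrite eucl_dist_up ger0_norm.
  move=> th /andP[th0 th1].
  rewrite [x + (H * m) *: e^T]addrC addrK scalerA.
  apply: up => //; last by lra.
  by rewrite mulr_ge0//= ler_piMl.
apply: chain_segment => //; last first.
  by apply: le_trans Kn; apply: le_trans xy; rewrite /eucl_dist opprD addrACA subrr addr0.
move=> th /andP[th0 th1].
have -> : x + (H * m) *: e^T + th *: (y + (H * m) *: e^T - (x + (H * m) *: e^T)) =
   (x + th *: (y - x)) + (H * m) *: e^T.
  by rewrite opprD addrACA subrr addr0 addrAC.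
have xz : eucl_dist x (x + th *: (y - x)) <= K * m.
  rewrite /eucl_dist opprD addrA subrr add0r eucl_normN eucl_normZ ger0_norm//.
  rewrite -opprB eucl_normN; apply: le_trans xy; rewrite ler_piMl// eucl_norm_ge0//.
apply: eball_height => //.
  rewrite height_up; have := height_lip x (x + th *: (y - x)).
  have : (1 + Lam) * eucl_dist x (x + th *: (y - x)) <= H * m.
    by rewrite /H -mulrA ler_pM2l.
  rewrite ler_norml => h1 /andP[_ h2]; lra.
have : eucl_dist Q (x + th *: (y - x) + (H * m) *: e^T) <=
    eucl_dist Q x + K * m + H * m.
  apply: le_trans (eucl_dist_tri (x + th *: (y - x)) _ _) _; apply: lerD.
    by apply: le_trans (eucl_dist_tri x _ _) _; rewrite lerD2l.
  by rewrite eucl_dist_up ger0_norm.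
by lra.
Qed.

End chart.

(** * Lower bounds of the Green function away from the boundary *)

Section interior_bound.
Context {R : realType} {d : nat}.
Hypothesis hd : (2 < d)%N.
Implicit Types (t s : R) (x y z v : 'rV[R]_d).
Context {dO : measure_display} {Omega : measurableType dO}.
Variables (P : 'rV[R]_d -> probability Omega R) (X : R -> Omega -> 'rV[R]_d).
Hypotheses (Xm : forall t : R, 0 <= t -> measurable_fun setT (X t))
  (XM : strong_markov P X) (Xc : continuous_paths X)
  (X0 : forall x, {ae P x, forall w, X 0 w = x}).
Variables (q : set 'rV[R]_d -> R -> 'rV[R]_d -> 'rV[R]_d -> R).
Hypothesis hq : forall U : set 'rV[R]_d, open U -> bounded_set U ->
     is_killed_density P X U (q U).
Variables (r1 : R) (r10 : 0 < r1) (hball : green_ball_estimates q r1).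
Variables (D : set 'rV[R]_d) (oD : open D) (cD : connected D) (D0 : D !=set0)
  (bD : bounded_set D).
Notation occ := (occupation q).
Notation rho := (dist_boundary D).
Notation G := (green q D).

Let d0 : (0 < d)%N. Proof. exact: ltn_trans hd. Qed.

Lemma occupation_le_green x y (T : R) : D x -> D y ->
  (occ D `]0%R, T[ x y <= G x y)%E.
Proof.
move=> Dx Dy; rewrite greenE//; apply: (occupation_subset hq oD bD) => //.
by move=> t /=; rewrite !in_itv /= andbT => /andP[].
Qed.

(** Positivity is asked uniformly for end points near x and y: this makes the
    relation open, and leaves room for the composition in [reaches_trans]. *)
Definition reaches x y := exists del T c : R, [/\ 0 < del, 0 < T, 0 < c &
  forall x' y', eball x del x' -> eball y del y' -> (c%:E <= occ D `]0%R, T[ x' y')%E].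

Lemma reaches_near w s x y : 0 < s -> s <= r1 -> eball w s `<=` D ->
  eball w (s / 4) x -> eball w (s / 4) y -> reaches x y.
Proof.
move=> s0 sr1 wD wx wy; have [K [c [K0 c0 H]]] := occupation_ball hd Xm XM Xc X0 hq hball.
exists (s / 4), (K * s ^+ 2), (c * s ^ (2 - d%:Z)); split.
- by rewrite divr_gt0.
- by rewrite mulr_gt0// exprn_gt0.
- by rewrite mulr_gt0// exprz_newton// invr_gt0 exprn_gt0.
have sub z : eball w (s / 4) z -> eball z (s / 4) `<=` eball w (s / 2).
  by move=> wz; apply: sub_eball; move: wz; rewrite /eball /=; lra.
by move=> x' y' xx' yy'; apply: (H D w) => //; [apply: (sub x)|apply: (sub y)].
Qed.

Lemma reaches_trans x y z : reaches x y -> reaches y z -> reaches x z.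
Proof.
move=> [e1 [T1 [c1 [e10 T10 c10 H1]]]] [e2 [T2 [c2 [e20 T20 c20 H2]]]].
pose e := Num.min e1 e2; have e0 : 0 < e by rewrite lt_min e10.
have ee1 : e <= e1 by rewrite ge_min lexx.
have ee2 : e <= e2 by rewrite ge_min lexx orbT.
exists e, (T1 + T2), (c1 * c2 * (2 * (e / d.+1%:R)) ^+ d / T1); split => //.
- exact: addr_gt0.
- by rewrite divr_gt0// mulr_gt0// ?mulr_gt0// exprn_gt0// mulr_gt0// divr_gt0.
move=> x' z' xx' zz'.
apply: (occupation_compose_ball hd Xm XM Xc X0 hq (w := y)) => //; try exact: ltW.
move=> v yv _ _; split.
  by apply: H1; [exact: le_eball xx'|exact: le_eball yv].
by apply: H2; [exact: le_eball yv|exact: le_eball zz'].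
Qed.

Lemma small_ball x : D x -> exists s, [/\ 0 < s, s <= r1 & eball x s `<=` D].
Proof.
move=> /(eball_in_open oD)[r r0 rD]; exists (Num.min r r1); split.
- by rewrite lt_min r0.
- by rewrite ge_min lexx orbT.
- by apply: subset_trans rD; apply: le_eball; rewrite ge_min lexx.
Qed.

(** The set of points of D reached from x is open and closed in D, because any
    point of D and its neighbours reach each other through a small ball. *)
Lemma reaches_all x y : D x -> D y -> reaches x y.
Proof.
move=> Dx Dy; pose B := [set z | D z /\ reaches x z].
have step z1 z s : 0 < s -> s <= r1 -> eball z s `<=` D -> eball z (s / 4) z1 ->
    reaches z1 z /\ reaches z z1.
  move=> s0 sr1 zD zz1.
  have zz : eball z (s / 4) z by apply: eballxx; rewrite divr_gt0.
  by split; apply: (@reaches_near z s).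
have [s [s0 sr1 xD]] := small_ball Dx.
have Bx : B x.
  have s40 : 0 < s / 4 by rewrite divr_gt0.
  by split => //; have [] := step x x s s0 sr1 xD (eballxx _ s40).
suff BD : B = D by have [] : B y by rewrite BD.
apply: cD; first by exists x.
  exists B; last by apply/seteqP; split=> [z [Dz xz]|z []].
  rewrite openE => z [Dz xz]; have [e [e0 er1 zD]] := small_ball Dz.
  apply/nbhs_eballP; exists (e / 4); first by rewrite divr_gt0.
  move=> z' zz'; have Dz' : D z'.
    by apply: zD; apply: le_eball zz'; lra.
  split => //; apply: reaches_trans xz _.
  by have [] := step z' z e e0 er1 zD zz'.
exists (closure B); first exact: closed_closure.
apply/seteqP; split=> [z [Dz xz]|z [Dz clz]].
  by split => //; apply: subset_closure.
split => //; have [e [e0 er1 zD]] := small_ball Dz.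
have e40 : 0 < e / 4 by rewrite divr_gt0.
have [z1 [[_ xz1] zz1]] := clz _ (nbhs_eball z e40).
by apply: reaches_trans xz1 _; have [] := step z1 z e e0 er1 zD zz1.
Qed.

Lemma green_gt0 x y : D x -> D y -> (0 < G x y)%E.
Proof.
move=> Dx Dy; have [del [T [c [del0 T0 c0 H]]]] := reaches_all Dx Dy.
apply: lt_le_trans (occupation_le_green T Dx Dy).
by apply: lt_le_trans (H x y (eballxx _ del0) (eballxx _ del0)); rewrite lte_fin.
Qed.

(** The pairs of points at distance at least e from the complement of D form a
    compact set, and [reaches_all] gives a bound near each of them. *)
Lemma green_interior_bound (e : R) : 0 < e -> exists2 c : R, 0 < c &
  forall x y, D x -> D y -> e <= rho x -> e <= rho y -> (c%:E <= G x y)%E.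
Proof.
move=> e0; pose K := [set x | forall z, ~ D z -> e <= eucl_dist x z].
have KD : K `<=` D.
  by move=> x Kx; apply: contrapT => /Kx; rewrite eucl_distxx leNgt e0.
have rhoK x : D x -> e <= rho x -> K x.
  move=> Dx ex z nDz; rewrite leNgt; apply/negP => xz; apply: nDz.
  exact: (eball_dist_boundary oD Dx ex).
have clK : closed K.
  move=> x clx z nDz; rewrite leNgt; apply/negP; rewrite -subr_gt0 => ex.
  have [y [Ky xy]] := clx _ (nbhs_eball x ex).
  have := Ky z nDz; apply/negP; rewrite -ltNge.
  apply: (le_lt_trans (eucl_dist_tri x _ _)); move: xy; rewrite /eball /= eucl_distC.
  by lra.
have bK : bounded_set K.
  move: bD => [M [Mr MP]]; exists M; split => // N MN x /KD; exact: MP.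
have cK : compact K by exact: bounded_closed_compact.
have /compact_near_coveringP H := compact_setX cK cK.
have : \forall n \near \oo, (K `*` K) `<=` (fun xy => (n.+1%:R^-1%:E <= G xy.1 xy.2)%E \/ ~ (D xy.1 /\ D xy.2)).
  apply: H => -[x y] [/= /KD Dx /KD Dy].
  have [del [T [c [del0 T0 c0 HT]]]] := reaches_all Dx Dy.
  have [k kc] := small_inv c0.
  exists ([set xy | eball x del xy.1 /\ eball y del xy.2], [set n | (k <= n)%N]).
    split => /=; last by exists k.
    exists (eball x del, eball y del) => /=.
      by split; exact: nbhs_eball.
    by move=> [x' y'].
  move=> [[x' y'] n] /= [[xx' yy'] kn].
  have [[Dx' Dy']|] := pselect (D x' /\ D y'); [left|by right].
  apply: le_trans (occupation_le_green T Dx' Dy').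
  apply: le_trans (HT x' y' xx' yy'); rewrite lee_fin.
  by apply: le_trans (ltW kc); rewrite lef_pV2 ?posrE// ler_nat ltnS.
case=> n _ nP; exists n.+1%:R^-1; first by rewrite invr_gt0.
move=> x y Dx Dy ex ey.
have [h|[]] := nP n (leqnn n) (x, y) (conj (rhoK x Dx ex) (rhoK y Dy ey)).
  exact: h.
by [].
Qed.

Variables (R0 Lam0 : R) (R00 : 0 < R0)
  (charts : forall Q, boundary D Q -> lipschitz_chart D Q R0 Lam0).

(** Two interior points at comparable scale are joined by a chain of boundedly
    many balls of that scale: go up along the axis of a chart, across, and down. *)
Lemma green_chart_bound (K : R) : 0 < K -> exists m0 c : R, [/\ 0 < m0, 0 < c &
  forall x y (m : R), D x -> D y -> 0 < m -> m <= m0 -> m <= rho x -> m <= rho y ->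
    rho x <= K * m -> eucl_dist x y <= K * m -> ((c * m ^ (2 - d%:Z))%:E <= G x y)%E].
Proof.
move=> K0; pose L : R := `|Lam0|; have L0 : 0 <= L by exact: normr_ge0.
have L1 : 0 < 1 + L by rewrite ltr_wpDr.
pose n1 := (Num.truncn (4 * (1 + L) * ((1 + L) * K))).+1.
pose n2 := (Num.truncn (4 * (1 + L) * K)).+1.
have [T [c [T0 c0 H]]] := occupation_chain hd Xm XM Xc X0 hq hball (n1 + (n2 + n1)).
pose W := 2 * K + (K + (1 + L) * K + 1).
have W0 : 0 < W by rewrite addr_gt0 ?mulr_gt0// addr_gt0// addr_gt0// mulr_gt0.
exists (Num.min r1 (R0 / W)), c; split => //.
  by rewrite lt_min r10 divr_gt0.
move=> x y m Dx Dy m0; rewrite le_min => /andP[mr1 mW] mx my xK xy.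
have [Q bQ xQ] : exists2 Q, boundary D Q & eucl_dist x Q < 2 * K * m.
  apply: (near_boundary oD bD d0 D0); rewrite -mulrA mulr_natl mulr2n.
  by apply: (le_lt_trans xK); rewrite ltrDl mulr_gt0.
have [phi [bas [e [phi_lip OO Oe ee DE]]]] := charts bQ.
have phi_lip' a b : `|phi a - phi b| <= L * eucl_dist a b.
  apply: le_trans (phi_lip a b) _; apply: ler_wpM2r; first exact: eucl_dist_ge0.
  exact: ler_norm.
have s0 : 0 < m / (1 + L) by rewrite divr_gt0.
have ch : chain D (m / (1 + L)) (n1 + (n2 + n1)) x y.
  apply: (chart_chain L0 phi_lip' OO Oe ee DE (K := K)) => //; try exact: ltW.
  - exact: eball_dist_boundary.
  - exact: eball_dist_boundary.
  - move: mW; rewrite ler_pdivlMr// mulrC => mW; apply: le_trans mW; rewrite /W (mulrDl (2 * K)).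
    by rewrite lerD2r eucl_distC ltW.
  - by apply: ltW; exact: truncnS_gt.
  - by apply: ltW; exact: truncnS_gt.
have sm : m / (1 + L) <= m by rewrite ler_pdivrMr// ler_peMr ?(ltW m0)// lerDl.
have s40 : 0 < m / (1 + L) / 4 by rewrite divr_gt0.
apply: le_trans (occupation_le_green _ Dx Dy).
apply: le_trans (H D (m / (1 + L)) x y x y oD bD s0 (le_trans sm mr1) ch (eballxx _ s40) (eballxx _ s40)).
by rewrite lee_fin ler_pM2l//; exact: newton_antimono.
Qed.

Variables (C0 : R) (C00 : 0 < C0) (hgreen : green_estimates q D C0).

(** Three regimes. When 2 |x - y| is at most the larger distance to the boundary
    the bound is a hypothesis. Otherwise the distances to the boundary and
    |x - y| are all comparable to m, the smaller distance: for small m a chart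
    provides the chain, and for m bounded below both sides are of order 1. *)
Theorem green_nontangential_bound (K : R) : 0 < K -> exists2 c : R, 0 < c &
  forall x y, D x -> D y -> x != y ->
    eucl_dist x y <= K * rho x -> eucl_dist x y <= K * rho y ->
    ((c * newton x y)%:E <= G x y)%E.
Proof.
move=> K0; have K10 : 0 < 1 + K by rewrite addr_gt0.
have [m0 [c1 [m00 c10 H1]]] := green_chart_bound K10.
have [c2 c20 H2] := green_interior_bound m00.
(* The factors 2^-(d-2) and (m0 / 2)^(d-2) convert m^(2-d) and 1 into the
   kernel, as |x - y| is at least m / 2. *)
pose cc := c1 * 2 ^- (d - 2).
pose c3 := c2 * (m0 / 2) ^+ (d - 2).
have cc0 : 0 < cc by rewrite mulr_gt0// invr_gt0 exprn_gt0.
have c30 : 0 < c3 by rewrite mulr_gt0// exprn_gt0// divr_gt0.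
exists (Num.min C0^-1 (Num.min cc c3)); first by rewrite !lt_min invr_gt0 C00 cc0.
move=> x y Dx Dy xy xKx xKy.
have n0 : 0 < newton x y by exact: newton_gt0.
have [near|far] := leP (2 * eucl_dist x y) (Num.max (rho x) (rho y)).
  have [_ /(_ near)] := hgreen Dx Dy xy; apply: le_trans.
  by rewrite lee_fin ler_pM2r// ge_min lexx.
pose m := Num.min (rho x) (rho y).
have rx0 : 0 < rho x by exact: dist_boundary_gt0.
have ry0 : 0 < rho y by exact: dist_boundary_gt0.
have mp : 0 < m by rewrite lt_min rx0.
have mx : m <= rho x by rewrite ge_min lexx.
have my : m <= rho y by rewrite ge_min lexx orbT.
have mxy : m / 2 <= eucl_dist x y.
  move: far; rewrite gt_max => /andP[+ _]; lra.
have xyK : eucl_dist x y <= K * m.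
  by rewrite /m; case: (leP (rho x) (rho y)).
have xm : rho x <= (1 + K) * m.
  rewrite mulrDl mul1r /m; case: (leP (rho x) (rho y)) => h.
    by rewrite lerDl mulr_ge0// ltW.
  apply: le_trans (dist_boundary_lip oD bD d0 x y D0) _.
  by rewrite lerD2l.
have m2 : 0 < m / 2 by rewrite divr_gt0.
have [mm0|mm0] := leP m m0.
  have xyK' : eucl_dist x y <= (1 + K) * m.
    by apply: le_trans xyK _; rewrite ler_pM2r// lerDr.
  have := H1 x y m Dx Dy mp mm0 mx my xm xyK'; apply: le_trans.
  rewrite lee_fin; apply: (@le_trans _ _ (cc * newton x y)).
    by rewrite ler_pM2r// !ge_min lexx orbT.
  rewrite /cc -mulrA ler_pM2l//.
  apply: (@le_trans _ _ (2 ^- (d - 2) * (m / 2) ^ (2 - d%:Z))).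
    by rewrite ler_pM2l ?invr_gt0 ?exprn_gt0//; exact: newton_antimono.
  by rewrite !exprz_newton// -invfM -exprMn mulrC divfK.
have := H2 x y Dx Dy (ltW (lt_le_trans mm0 mx)) (ltW (lt_le_trans mm0 my)).
apply: le_trans; rewrite lee_fin; apply: (@le_trans _ _ (c3 * newton x y)).
  by rewrite ler_pM2r// !ge_min lexx !orbT.
rewrite /c3 -mulrA -[leRHS]mulr1 ler_pM2l// /newton exprz_newton//.
have m020 : 0 < m0 / 2 by rewrite divr_gt0.
rewrite ler_pdivrMr ?exprn_gt0 ?eucl_dist_gt0// mul1r lerXn2r ?nnegrE ?eucl_dist_ge0 ?(ltW m020)//.
by lra.
Qed.

End interior_bound.

(** * Moving one pole of the Green function *)

Section similar.
Context {R : realType}.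
Implicit Types a b c C : R.

Definition sim C a b := a <= C * b /\ b <= C * a.

Lemma sim_weak C C' a b : 0 < a -> 0 < b -> C <= C' -> sim C a b -> sim C' a b.
Proof.
move=> a0 b0 CC' [h1 h2]; split.
  by apply: le_trans h1 _; rewrite ler_pM2r.
by apply: le_trans h2 _; rewrite ler_pM2r.
Qed.

Lemma sim_trans C C' a b c : 0 < C -> 0 < C' -> sim C a b -> sim C' b c -> sim (C * C') a c.
Proof.
move=> C0 C'0 [h1 h2] [h3 h4]; split.
  by apply: le_trans h1 _; rewrite -mulrA ler_pM2l.
by apply: le_trans h4 _; rewrite (mulrC C) -mulrA ler_pM2l.
Qed.

Lemma sim_mul C C' a b a' b' : 0 < a -> 0 < b -> 0 < a' -> 0 < b' ->
  sim C a b -> sim C' a' b' -> sim (C * C') (a * a') (b * b').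
Proof.
move=> a0 b0 a'0 b'0 [h1 h2] [h3 h4]; split; rewrite mulrACA; apply: ler_pM => //; exact: ltW.
Qed.

Lemma sim_inv C a b : 0 < a -> 0 < b -> sim C a b -> sim C a^-1 b^-1.
Proof.
move=> a0 b0 [h1 h2]; split.
  by rewrite ler_pdivlMr// mulrC ler_pdivrMr// mulrC.
by rewrite ler_pdivlMr// mulrC ler_pdivrMr// mulrC.
Qed.

Lemma sim_div C C' a b a' b' : 0 < a -> 0 < b -> 0 < a' -> 0 < b' ->
  sim C a b -> sim C' a' b' -> sim (C * C') (a / a') (b / b').
Proof.
by move=> a0 b0 a'0 b'0 h h'; apply: sim_mul; rewrite ?invr_gt0//; exact: sim_inv.
Qed.

End similar.

(** Here k stands for the Green function or for its transpose, and h for the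
    function k(., z0) truncated near the pole z0. The hypothesis kQ is the
    comparison of quotients, with the denominators multiplied out. *)
Section one_sided.
Context {R : realType} {d : nat}.
Hypothesis hd : (2 < d)%N.
Implicit Types (s r : R) (x y z Q A : 'rV[R]_d).
Variables (D : set 'rV[R]_d) (oD : open D) (D0 : D !=set0) (bD : bounded_set D).
Notation rho := (dist_boundary D).
Variables (R0 kappa M r0 : R) (kappa0 : 0 < kappa) (kappa2 : kappa <= 2^-1)
  (balls : interior_balls D R0 kappa) (M2 : 2 <= M) (r00 : 0 < r0) (r0R0 : r0 <= R0).
Variables (k : 'rV[R]_d -> 'rV[R]_d -> R) (h : 'rV[R]_d -> R) (z0 : 'rV[R]_d) (C0 C1 cQ : R).
Hypotheses (Dz0 : D z0) (C00 : 0 < C0) (cQ1 : 1 < cQ)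
  (kpos : forall x y, D x -> D y -> x != y -> 0 < k x y)
  (kup : forall x y, D x -> D y -> x != y -> k x y <= C0 * newton x y)
  (klow : forall K, 0 < K -> exists2 c : R, 0 < c & forall x y, D x -> D y -> x != y ->
     eucl_dist x y <= K * rho x -> eucl_dist x y <= K * rho y -> c * newton x y <= k x y)
  (kQ : forall Q r x y z1 z2, boundary D Q -> 0 < r -> r < r0 ->
    D x -> r <= eucl_dist Q x -> D y -> r <= eucl_dist Q y ->
    D z1 -> eucl_dist Q z1 < r / M -> D z2 -> eucl_dist Q z2 < r / M ->
    k z1 x * k z2 y <= cQ * (k z2 x * k z1 y))
  (hE : forall x, D x -> rho x < rho z0 / 2 -> h x = k x z0)
  (hI : forall e : R, 0 < e -> exists2 c : R, 0 < c & forall x, D x -> e <= rho x -> c <= h x)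
  (hpos : forall x, D x -> 0 < h x) (hup : forall x, D x -> h x <= C1).

Let d0 : (0 < d)%N. Proof. exact: ltn_trans hd. Qed.
Let rhoz0 : 0 < rho z0. Proof. exact: dist_boundary_gt0. Qed.
Let M0 : 0 < M. Proof. by apply: lt_le_trans M2. Qed.
Let cQ0 : 0 < cQ. Proof. exact: lt_trans cQ1. Qed.

Lemma newton_scale (a b lam : R) : 0 < a -> 0 < b -> a <= lam * b ->
  b ^ (2 - d%:Z) <= lam ^+ (d - 2) * a ^ (2 - d%:Z).
Proof.
move=> a0 b0 ab; rewrite !exprz_newton// ler_pdivlMr ?exprn_gt0// mulrC ler_pdivrMr ?exprn_gt0//.
by rewrite -exprMn lerXn2r ?nnegrE ?(ltW a0)// (le_trans (ltW a0)).
Qed.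

Lemma interior_point Q r : boundary D Q -> 0 < r -> r < R0 ->
  exists y, [/\ D y, kappa * r <= rho y & eucl_dist Q y < r].
Proof.
move=> bQ rp rR; have [y yP] := balls bQ rp rR.
have kr : 0 < kappa * r by rewrite mulr_gt0.
have [Dy Qy] := yP y (eballxx y kr); exists y; split => //.
by apply: (eball_le_dist_boundary oD bD d0) => // z /yP[].
Qed.

Lemma rho_le_dist Q y : boundary D Q -> rho y <= eucl_dist Q y.
Proof. by move=> bQ; rewrite eucl_distC; exact: dist_boundary_le. Qed.

(** If x and A are far from the boundary, h is bounded above and below. If not,
    both lie in a ball about a boundary point Q whose radius is of order m, the
    smaller of their distances to the boundary, and the comparison of quotients
    with far poles z0 and y gives h x / h A <= cQ (k x y / k A y). The pole y is
    chosen at distance of order m from both and from the boundary, where k x y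
    and k A y are of the same order. *)
Lemma trunc_harnack (K : R) : 0 < K -> exists2 C : R, 0 < C &
  forall x A, D x -> D A -> eucl_dist x A <= K * rho x -> eucl_dist x A <= K * rho A ->
    h x <= C * h A.
Proof.
move=> K0; pose B := 3 * K + 2; have B0 : 0 < B by rewrite addr_gt0// mulr_gt0.
pose W := M * B / kappa.
have W0 : 0 < W by rewrite divr_gt0// mulr_gt0.
have MBW : M * B <= W.
  rewrite /W ler_pdivlMr//; apply: ler_piMr; first by rewrite mulr_ge0 ?ltW.
  by apply: le_trans kappa2 _; lra.
have BMB : 2 * B <= M * B by rewrite ler_pM2r.
pose r' := Num.min r0 (rho z0).
have r'0 : 0 < r' by rewrite lt_min r00.
pose m0 := r' / (2 * W).
have m00 : 0 < m0 by rewrite divr_gt0// mulr_gt0.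
have [cI cI0 HI] := hI m00.
have [cA cA0 HA] := klow (addr_gt0 B0 W0).
pose lam := (B + W) / B.
have lam0 : 0 < lam by rewrite divr_gt0// addr_gt0.
pose C2 := cQ * (C0 / cA * lam ^+ (d - 2)).
have C20 : 0 < C2 by rewrite !mulr_gt0 ?invr_gt0 ?exprn_gt0.
have C10 : 0 < C1 by apply: lt_le_trans (hpos Dz0) (hup Dz0).
(* C1 / cI serves far from the boundary and C2 near it, where
   lam bounds the ratio of the distances from A and from x to the pole y. *)
exists (Num.max (C1 / cI) C2); first by rewrite lt_max C20 orbT.
move=> x A Dx DA xAx xAA.
pose m := Num.min (rho x) (rho A).
have rx0 : 0 < rho x by exact: dist_boundary_gt0.
have rA0 : 0 < rho A by exact: dist_boundary_gt0.
have mp : 0 < m by rewrite lt_min rx0.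
have mx : m <= rho x by rewrite ge_min lexx.
have mA : m <= rho A by rewrite ge_min lexx orbT.
have xAm : eucl_dist x A <= K * m by rewrite /m; case: (leP (rho x) (rho A)).
have rxm : rho x <= m + K * m.
  rewrite {1}/m; case: (leP (rho x) (rho A)) => _; first by rewrite lerDl mulr_ge0// ltW.
  by apply: le_trans (dist_boundary_lip oD bD d0 x A D0) _; rewrite lerD2l.
have rAm : rho A <= m + K * m.
  rewrite {1}/m; case: (leP (rho x) (rho A)) => _; last by rewrite lerDl mulr_ge0// ltW.
  apply: le_trans (dist_boundary_lip oD bD d0 A x D0) _.
  by rewrite lerD2l eucl_distC.
have hA0 := hpos DA.
have [mm0|mm0] := leP m0 m.
  have cA' := HI A DA (le_trans mm0 mA).
  apply: (@le_trans _ _ (C1 / cI * h A)); last by rewrite ler_pM2r// le_max lexx.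
  apply: le_trans (hup Dx) _; rewrite mulrAC ler_pdivlMr//.
  by rewrite ler_pM2l.
have mW : m * (2 * W) < r'.
  by rewrite -ltr_pdivlMr; [exact: mm0|rewrite mulr_gt0].
have r'r0 : r' <= r0 by rewrite ge_min lexx.
have r'z : r' <= rho z0 by rewrite ge_min lexx orbT.
have Bm : B * m = 3 * (K * m) + 2 * m by rewrite /B; ring.
have Km0 : 0 < K * m by rewrite mulr_gt0.
have MBm : M * B * m <= W * m by rewrite ler_pM2r.
have BMBm : 2 * (B * m) <= M * B * m by rewrite mulrA ler_pM2r.
have mW' : 2 * (W * m) < r' by rewrite mulrA mulrC.
have [Q bQ xQ] : exists2 Q, boundary D Q & eucl_dist x Q < 2 * rho x.
  by apply: (near_boundary oD bD d0 D0); rewrite mulr_natl mulr2n ltrDl.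
have Qx : eucl_dist Q x < B * m by rewrite eucl_distC Bm; lra.
have QA : eucl_dist Q A < B * m.
  by apply: (le_lt_trans (eucl_dist_tri x _ _)); rewrite (eucl_distC Q) Bm; lra.
(* B m bounds the distances from Q to x and A, so they lie in the small ball
   of radius s / M. *)
pose s := M * B * m; have s0 : 0 < s by rewrite !mulr_gt0.
have sM : s / M = B * m by rewrite /s; field; rewrite gt_eqF.
have sr0 : s < r0 by rewrite /s; lra.
(* The interior ball of radius kappa W m = s puts y at distance s from the
   boundary, hence outside the ball of radius s about Q. *)
have [y [Dy sy Qy]] : exists y, [/\ D y, s <= rho y & eucl_dist Q y < W * m].
  have sk : 0 < W * m by rewrite mulr_gt0.
  have WR : W * m < R0 by apply: lt_le_trans r0R0; lra.
  have [y [Dy ry Qy]] := interior_point bQ sk WR.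
  exists y; split => //; apply: le_trans ry.
  by rewrite /s /W le_eqVlt; apply/orP; left; apply/eqP; field; rewrite gt_eqF.
have Qys : s <= eucl_dist Q y by apply: le_trans sy _; exact: rho_le_dist.
have Qz0 : s <= eucl_dist Q z0.
  by apply: le_trans (rho_le_dist z0 bQ); rewrite /s; lra.
have xy : B * m <= eucl_dist x y.
  have := eucl_dist_tri x Q y; rewrite /s in Qys; lra.
have Bm0 : 0 < B * m by rewrite mulr_gt0.
have xny : x != y by rewrite -eucl_dist_gt0 (lt_le_trans Bm0).
have Ay : eucl_dist A y <= (B + W) * m.
  apply: le_trans (eucl_dist_tri Q _ _) _; rewrite (mulrDl B) eucl_distC; lra.
have BmAy : B * m <= eucl_dist A y.
  have := eucl_dist_tri A Q y; rewrite /s in Qys; lra.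
have Any : A != y by rewrite -eucl_dist_gt0 (lt_le_trans Bm0).
have rz : rho z0 / 2 > m + K * m.
  have : 2 * (m + K * m) <= B * m by rewrite Bm; lra.
  lra.
rewrite (hE Dx (le_lt_trans rxm rz)) (hE DA (le_lt_trans rAm rz)).
have Az0 : A != z0.
  by apply: contraTN (le_lt_trans rAm rz) => /eqP ->; rewrite -leNgt; lra.
have kAz := kpos DA Dz0 Az0.
have BW0 : 0 < B + W by rewrite addr_gt0.
have kAy : cA * newton A y <= k A y.
  apply: HA => //; first by apply: le_trans Ay _; rewrite ler_pM2l.
  apply: le_trans Ay _; rewrite ler_pM2l//; apply: le_trans sy.
  have : m <= B * m by rewrite ler_peMl ?(ltW mp)// /B; lra.
  by rewrite /s; lra.
have kAy0 := kpos DA Dy Any.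
apply: (@le_trans _ _ (C2 * k A z0)); last by rewrite ler_pM2r// le_max lexx orbT.
have nAy : newton x y <= lam ^+ (d - 2) * newton A y.
  apply: (@le_trans _ _ ((B * m) ^ (2 - d%:Z))); first exact: newton_antimono.
  apply: newton_scale => //; first by rewrite eucl_dist_gt0.
  rewrite (_ : lam * (B * m) = (B + W) * m)// /lam; field.
  by rewrite gt_eqF.
have kxy : k x y <= C0 / cA * lam ^+ (d - 2) * k A y.
  apply: le_trans (kup Dx Dy xny) _.
  have -> : C0 / cA * lam ^+ (d - 2) * k A y = C0 * (lam ^+ (d - 2) * (cA^-1 * k A y)).
    by ring.
  rewrite ler_pM2l//; apply: le_trans nAy _; rewrite ler_pM2l ?exprn_gt0//.
  by rewrite ler_pdivlMl.
have QxM : eucl_dist Q x < s / M by rewrite sM.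
have QAM : eucl_dist Q A < s / M by rewrite sM.
have kk := kQ bQ s0 sr0 Dz0 Qz0 Dy Qys Dx QxM DA QAM.
rewrite -(ler_pM2r kAy0); apply: le_trans kk _.
have -> : C2 * k A z0 * k A y = cQ * (k A z0 * (C0 / cA * lam ^+ (d - 2) * k A y)).
  by rewrite /C2; ring.
by rewrite ler_pM2l// ler_pM2l.
Qed.

(** If x is far from the boundary, x' = x will do. If not, x and an interior point
    x' both lie close to a boundary point Q, and the quotients are compared with
    far poles y and z0. *)
Lemma boundary_reduction s x : 0 < s -> s < r0 -> s <= rho z0 -> D x ->
  exists x', [/\ D x', kappa * (s / M) <= rho x', eucl_dist x x' <= s &
    forall y, D y -> 2 * s <= eucl_dist x y -> sim cQ (k x y * h x') (k x' y * h x)].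
Proof.
move=> s0 sr0 sz Dx.
have sM0 : 0 < s / M by rewrite divr_gt0.
have sMs : 2 * (s / M) <= s.
  by rewrite mulrCA -[leRHS]mulr1 ler_pM2l// ler_pdivrMr// mul1r.
have [big|small] := leP (s / M / 2) (rho x).
  exists x; split=> [//|||y Dy xy].
  - by apply: le_trans big; rewrite mulrC ler_pM2l.
  - by rewrite eucl_distxx ltW.
  - have xny : x != y by rewrite -eucl_dist_gt0; apply: lt_le_trans xy; rewrite mulr_gt0.
    have p0 : 0 < k x y * h x by rewrite mulr_gt0 ?kpos ?hpos.
    by split; rewrite ler_peMl// ltW.
have [Q bQ xQ] : exists2 Q, boundary D Q & eucl_dist x Q < s / M / 2.
  exact: (near_boundary oD bD d0 D0).
have sR : s / M < R0 by apply: lt_le_trans r0R0; lra.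
have [x' [Dx' kx' Qx']] := interior_point bQ sM0 sR.
have Qx : eucl_dist Q x < s / M by rewrite eucl_distC; lra.
have xx' : eucl_dist x x' <= s.
  by apply: le_trans (eucl_dist_tri Q _ _) _; lra.
exists x'; split => // y Dy xy.
have rx' : rho x' < rho z0 / 2.
  by apply: (le_lt_trans (rho_le_dist x' bQ)); lra.
have rx : rho x < rho z0 / 2 by lra.
have Qy : s <= eucl_dist Q y.
  by have := eucl_dist_tri Q x y; rewrite (eucl_distC x Q); lra.
have Qz0 : s <= eucl_dist Q z0 by exact: le_trans (rho_le_dist z0 bQ).
rewrite (hE Dx rx) (hE Dx' rx'); split.
  by have := kQ bQ s0 sr0 Dy Qy Dz0 Qz0 Dx Qx Dx' Qx'.
by have := kQ bQ s0 sr0 Dy Qy Dz0 Qz0 Dx' Qx' Dx Qx.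
Qed.

End one_sided.

(** * Moving both poles *)

Section two_sided.
Context {R : realType} {d : nat}.
Hypothesis hd : (2 < d)%N.
Implicit Types (s r : R) (x y z Q A : 'rV[R]_d).
Variables (D : set 'rV[R]_d) (oD : open D) (D0 : D !=set0) (bD : bounded_set D).
Notation rho := (dist_boundary D).
Variables (R0 kappa M r0 : R) (kappa0 : 0 < kappa) (kappa2 : kappa <= 2^-1)
  (balls : interior_balls D R0 kappa) (M2 : 2 <= M) (r00 : 0 < r0) (r0R0 : r0 <= R0).
Variables (g : 'rV[R]_d -> 'rV[R]_d -> R) (h1 h2 : 'rV[R]_d -> R) (z0 : 'rV[R]_d)
  (C0 C1 cQ : R).
Hypotheses (Dz0 : D z0) (C00 : 0 < C0) (cQ1 : 1 < cQ)
  (gpos : forall x y, D x -> D y -> x != y -> 0 < g x y)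
  (gup : forall x y, D x -> D y -> x != y -> g x y <= C0 * newton x y)
  (gnear : forall x y, D x -> D y -> x != y -> 2 * eucl_dist x y <= Num.max (rho x) (rho y) ->
     C0^-1 * newton x y <= g x y)
  (glow : forall K, 0 < K -> exists2 c : R, 0 < c & forall x y, D x -> D y -> x != y ->
     eucl_dist x y <= K * rho x -> eucl_dist x y <= K * rho y -> c * newton x y <= g x y)
  (gQ1 : forall Q r x y z1 z2, boundary D Q -> 0 < r -> r < r0 ->
    D x -> r <= eucl_dist Q x -> D y -> r <= eucl_dist Q y ->
    D z1 -> eucl_dist Q z1 < r / M -> D z2 -> eucl_dist Q z2 < r / M ->
    g z1 x * g z2 y <= cQ * (g z2 x * g z1 y))
  (gQ2 : forall Q r x y z1 z2, boundary D Q -> 0 < r -> r < r0 ->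
    D x -> r <= eucl_dist Q x -> D y -> r <= eucl_dist Q y ->
    D z1 -> eucl_dist Q z1 < r / M -> D z2 -> eucl_dist Q z2 < r / M ->
    g x z1 * g y z2 <= cQ * (g x z2 * g y z1))
  (h1E : forall x, D x -> rho x < rho z0 / 2 -> h1 x = g x z0)
  (h2E : forall x, D x -> rho x < rho z0 / 2 -> h2 x = g z0 x)
  (h1I : forall e : R, 0 < e -> exists2 c : R, 0 < c & forall x, D x -> e <= rho x -> c <= h1 x)
  (h2I : forall e : R, 0 < e -> exists2 c : R, 0 < c & forall x, D x -> e <= rho x -> c <= h2 x)
  (h1pos : forall x, D x -> 0 < h1 x) (h1up : forall x, D x -> h1 x <= C1)
  (h2pos : forall x, D x -> 0 < h2 x) (h2up : forall x, D x -> h2 x <= C1).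

Let gt x y := g y x.

Let gtpos x y : D x -> D y -> x != y -> 0 < gt x y.
Proof. by move=> Dx Dy xy; apply: gpos; rewrite // eq_sym. Qed.

Let gtup x y : D x -> D y -> x != y -> gt x y <= C0 * newton x y.
Proof. by move=> Dx Dy xy; rewrite newtonC; apply: gup; rewrite // eq_sym. Qed.

Let gtlow K : 0 < K -> exists2 c : R, 0 < c & forall x y, D x -> D y -> x != y ->
     eucl_dist x y <= K * rho x -> eucl_dist x y <= K * rho y -> c * newton x y <= gt x y.
Proof.
move=> /glow[c c0 H]; exists c => // x y Dx Dy xy xK yK.
by rewrite newtonC; apply: H; rewrite // 1?eq_sym// eucl_distC.
Qed.

Let reduction1 := boundary_reduction hd oD D0 bD kappa0 kappa2 balls M2 r0R0 Dz0 cQ1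
  gpos gQ1 h1E h1pos.
Let reduction2 := boundary_reduction hd oD D0 bD kappa0 kappa2 balls M2 r0R0 Dz0 cQ1
  gtpos (fun Q r x y z1 z2 bQ rp rr Dx Qx Dy Qy Dz1 Qz1 Dz2 Qz2 =>
    gQ2 bQ rp rr Dx Qx Dy Qy Dz1 Qz1 Dz2 Qz2) h2E h2pos.

Let harnack1 := trunc_harnack hd oD D0 bD kappa0 kappa2 balls M2 r00 r0R0 Dz0 C00 cQ1
  gpos gup glow gQ1 h1E h1I h1pos h1up.
Let harnack2 := trunc_harnack hd oD D0 bD kappa0 kappa2 balls M2 r00 r0R0 Dz0 C00 cQ1
  gtpos gtup gtlow (fun Q r x y z1 z2 bQ rp rr Dx Qx Dy Qy Dz1 Qz1 Dz2 Qz2 =>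
    gQ2 bQ rp rr Dx Qx Dy Qy Dz1 Qz1 Dz2 Qz2) h2E h2I h2pos h2up.

Let d0 : (0 < d)%N. Proof. exact: ltn_trans hd. Qed.
Let cQ0 : 0 < cQ. Proof. exact: lt_trans cQ1. Qed.
Let M0 : 0 < M. Proof. by apply: lt_le_trans M2. Qed.

Lemma interior_trunc_sim (K : R) : 0 < K -> exists2 C : R, 0 < C &
  forall x A, D x -> D A -> eucl_dist x A <= K * rho x -> eucl_dist x A <= K * rho A ->
    sim C (h1 x) (h1 A) /\ sim C (h2 x) (h2 A).
Proof.
move=> K0; have [c1 c10 H1] := harnack1 K0; have [c2 c20 H2] := harnack2 K0.
exists (Num.max c1 c2); first by rewrite lt_max c10.
have l1 : c1 <= Num.max c1 c2 by rewrite le_max lexx.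
have l2 : c2 <= Num.max c1 c2 by rewrite le_max lexx orbT.
move=> x A Dx DA xA Ax; split.
  apply: (sim_weak (h1pos Dx) (h1pos DA) l1); split; first exact: H1.
  by apply: H1; rewrite // eucl_distC.
apply: (sim_weak (h2pos Dx) (h2pos DA) l2); split; first exact: H2.
by apply: H2; rewrite // eucl_distC.
Qed.

Definition profile x y A := h1 x * h2 y / (h1 A * h2 A) * newton x y.

Lemma sim_ratio (C a b n : R) : 0 < b -> 0 < n -> sim C a b -> sim C n (a / b * n).
Proof.
move=> b0 n0 [ab ba]; split.
  by rewrite mulrA -[leLHS]mul1r ler_pM2r// mulrA ler_pdivlMr// mul1r.
by rewrite ler_pM2r// ler_pdivrMr.
Qed.

(** The Green function is comparable to the kernel, and the truncated functions
    at x and y are comparable to those at A. *)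
Lemma near_diagonal (K : R) : 0 < K -> exists2 C : R, 0 < C &
  forall x y A, D x -> D y -> D A -> x != y ->
    2 * eucl_dist x y <= Num.max (rho x) (rho y) ->
    eucl_dist x A <= K * rho x -> eucl_dist y A <= K * rho y ->
    eucl_dist x A <= K * rho A -> eucl_dist y A <= K * rho A ->
    sim C (g x y) (profile x y A).
Proof.
move=> K0; have [C C00' H] := interior_trunc_sim K0.
exists (C0 * (C * C)); first by rewrite !mulr_gt0.
move=> x y A Dx Dy DA xy near xAx yAy xA yA.
have [h1s _] := H x A Dx DA xAx xA; have [_ h2s] := H y A Dy DA yAy yA.
have [px py pA1 pA2] := And4 (h1pos Dx) (h2pos Dy) (h1pos DA) (h2pos DA).
apply: (sim_trans (b := newton x y)) => //; first by rewrite mulr_gt0.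
  split; first exact: gup.
  by have := gnear Dx Dy xy near; rewrite ler_pdivrMl.
apply: sim_ratio; first by rewrite mulr_gt0.
  exact: newton_gt0.
exact: sim_mul.
Qed.

Lemma sim_divr (C a b e : R) : 0 < b -> sim C (a * b) e -> sim C a (e / b).
Proof.
by move=> b0 [H1 H2]; split; rewrite ?mulrA ?ler_pdivlMr ?ler_pdivrMr// -mulrA.
Qed.

Lemma sim_refl (a : R) : sim 1 a a.
Proof. by split; rewrite mul1r. Qed.

(** Both poles are moved inside at scale s: first x to x' with y fixed, then y to
    y' with x' fixed. The poles stay 2 s apart, as s is at most a quarter of
    |x - y|. At x' and y' the Green function is comparable to the kernel, which
    hardly changes under these moves, and h1 x' and h2 y' are comparable to
    their values at A. *)
Lemma off_diagonal (K : R) : 0 < K -> exists2 C : R, 0 < C &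
  forall s x y A, 0 < s -> s < r0 -> s <= rho z0 -> D x -> D y -> D A ->
    4 * s <= eucl_dist x y -> eucl_dist x y <= K * s ->
    eucl_dist x A <= K * s -> eucl_dist y A <= K * s -> s <= K * rho A ->
    sim C (g x y) (profile x y A).
Proof.
move=> K0; pose K2 := (K + 2) * (M / kappa).
have Mk0 : 0 < M / kappa by rewrite divr_gt0.
have K20 : 0 < K2 by rewrite mulr_gt0// addr_gt0.
have [cA cA0 HA] := glow K20.
pose K3 := Num.max K2 ((K + 2) * K).
have K30 : 0 < K3 by rewrite lt_max K20.
have [Ch Ch0 HCh] := interior_trunc_sim K30.
pose e := 2 ^+ (d - 2) : R; have e0 : 0 < e by rewrite exprn_gt0.
pose Cn := Num.max (C0 * e) (e / cA).
have Cn0 : 0 < Cn by rewrite lt_max mulr_gt0.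
exists (cQ * 1 * (cQ * 1 * (Cn * (Ch * Ch)))); first by rewrite !mulr_gt0.
move=> s x y A s0 sr0 sz Dx Dy DA sxy xyK xAK yAK sA.
have xy0 : 0 < eucl_dist x y by apply: lt_le_trans sxy; rewrite mulr_gt0.
have xny : x != y by rewrite -eucl_dist_gt0.
have [x' [Dx' rx' xx' simx]] := reduction1 s0 sr0 sz Dx.
have [y' [Dy' ry' yy' simy]] := reduction2 s0 sr0 sz Dy.
have s2 : 2 * s <= eucl_dist x y by lra.
have x'y : eucl_dist x y <= eucl_dist x' y + s.
  apply: le_trans (eucl_dist_tri x' _ _) _; lra.
have yx' : 2 * s <= eucl_dist y x' by rewrite eucl_distC; lra.
have x'y' : eucl_dist x' y <= eucl_dist x' y' + s.
  by apply: le_trans (eucl_dist_tri y' _ _) _; rewrite lerD2l eucl_distC.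
have x'y'2 : eucl_dist x' y' <= eucl_dist x y + 2 * s.
  apply: le_trans (eucl_dist_tri x _ _) _; rewrite (eucl_distC x').
  by have := eucl_dist_tri y x y'; lra.
have x'y'0 : 0 < eucl_dist x' y' by lra.
have x'ny' : x' != y' by rewrite -eucl_dist_gt0.
have x'ny : x' != y by rewrite -eucl_dist_gt0; lra.
have [px py] := (h1pos Dx, h2pos Dy); have [px' py'] := (h1pos Dx', h2pos Dy').
have [pA1 pA2] := (h1pos DA, h2pos DA).
have n0 : 0 < newton x y by exact: newton_gt0.
have sK2 z : kappa * (s / M) <= rho z -> (K + 2) * s <= K2 * rho z.
  move=> rz; rewrite /K2 -mulrA ler_pM2l ?addr_gt0//.
  apply: (@le_trans _ _ (M / kappa * (kappa * (s / M)))); last by rewrite ler_pM2l.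
  by rewrite le_eqVlt; apply/orP; left; apply/eqP; field; rewrite !gt_eqF.
have x'y'K : eucl_dist x' y' <= (K + 2) * s by rewrite mulrDl; lra.
have simn : sim Cn (g x' y') (newton x y).
  split.
    apply: (@le_trans _ _ (C0 * e * newton x y)); last by rewrite ler_pM2r// le_max lexx.
    apply: le_trans (gup Dx' Dy' x'ny') _; rewrite -mulrA ler_pM2l//.
    by apply: newton_scale => //; lra.
  apply: (@le_trans _ _ (e / cA * g x' y')); last first.
    by rewrite ler_pM2r ?gpos// le_max lexx orbT.
  have := HA x' y' Dx' Dy' x'ny' (le_trans x'y'K (sK2 _ rx')) (le_trans x'y'K (sK2 _ ry')).
  rewrite -ler_pdivlMl// -[X in _ -> _ <= X]mulrA => H.
  apply: (@le_trans _ _ (e * newton x' y')); last by rewrite ler_pM2l.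
  by apply: newton_scale => //; lra.
have near z z' : eucl_dist z z' <= s -> eucl_dist z A <= K * s -> kappa * (s / M) <= rho z' ->
    eucl_dist z' A <= K3 * rho z' /\ eucl_dist z' A <= K3 * rho A.
  move=> zz' zA rz'.
  have rz'0 : 0 <= rho z' by apply: le_trans rz'; rewrite mulr_ge0 ?divr_ge0// ltW.
  have rA0 : 0 <= rho A by rewrite -(pmulr_rge0 _ K0); apply: le_trans sA; exact: ltW.
  have z'A : eucl_dist z' A <= (K + 2) * s.
    by apply: le_trans (eucl_dist_tri z _ _) _; rewrite eucl_distC mulrDl; lra.
  split; apply: le_trans z'A _.
    by apply: le_trans (sK2 _ rz') _; rewrite ler_wpM2r// le_max lexx.
  apply: (@le_trans _ _ ((K + 2) * K * rho A)).
    by rewrite -mulrA ler_pM2l// addr_gt0.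
  by rewrite ler_wpM2r// le_max lexx orbT.
have [nx1 nx2] := near x x' xx' xAK rx'; have [ny1 ny2] := near y y' yy' yAK ry'.
have [sh1 _] := HCh x' A Dx' DA nx1 nx2; have [_ sh2] := HCh y' A Dy' DA ny1 ny2.
have step1 := sim_divr px' (simx y Dy s2).
have step2 := sim_divr py' (simy x' Dx' yx').
have simxy : sim (Cn * (Ch * Ch)) (g x' y' * (h2 y / h2 y') * (h1 x / h1 x')) (profile x y A).
  rewrite (_ : g x' y' * (h2 y / h2 y') * (h1 x / h1 x') =
      g x' y' * (h1 x * h2 y / (h1 x' * h2 y'))); last first.
    by field; rewrite !gt_eqF.
  rewrite /profile [X in sim _ _ X]mulrC; apply: sim_mul => //.
  - exact: gpos.
  - by rewrite !mulr_gt0// invr_gt0 mulr_gt0.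
  - by rewrite !mulr_gt0// invr_gt0 mulr_gt0.
  - rewrite -[Ch * Ch]mul1r; apply: sim_div; rewrite ?mulr_gt0//; first exact: sim_refl.
    exact: sim_mul.
apply: (sim_trans (b := g x' y * (h1 x / h1 x'))); rewrite ?mulr_gt0//.
  by rewrite mulr1 mulrA.
apply: (sim_trans (b := g x' y' * (h2 y / h2 y') * (h1 x / h1 x'))); rewrite ?mulr_gt0//.
have step2' : sim cQ (g x' y) (g x' y' * (h2 y / h2 y')) by rewrite mulrA.
have r1p : 0 < h1 x / h1 x' by rewrite divr_gt0.
have r2p : 0 < g x' y' * (h2 y / h2 y') by rewrite mulr_gt0 ?gpos// divr_gt0.
exact: (sim_mul (gpos Dx' Dy x'ny) r2p r1p r1p step2' (sim_refl _)).
Qed.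

Lemma max_half (a b t r : R) : r <= Num.max a b -> 2 * t <= Num.max a b ->
  a <= b + t -> b <= a + t -> r / 2 <= a /\ r / 2 <= b.
Proof. by case: (leP a b) => _ *; split; lra. Qed.

(** The two cases are split according to whether 2 |x - y| is at most the larger
    of the distances of x and y to the boundary. In each of them A is either an
    interior point at scale r = rmax D x y, or z0 when r is at least the fixed
    length e1; then e1 serves as the scale. *)
Lemma green_profile : r0 / M < rho z0 -> exists2 C : R, 0 < C &
  forall x y A, D x -> D y -> x != y -> Bset D r0 M z0 x y A ->
    sim C (g x y) (profile x y A).
Proof.
move=> rzM; have [rD rD0 DrD] := bounded_set_eball bD.
pose L := 2 * rD; have L0 : 0 < L by rewrite mulr_gt0.
have DL x y : D x -> D y -> eucl_dist x y <= L.
  move=> /DrD x0 /DrD y0; apply: le_trans (eucl_dist_tri 0 _ _) _.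
  rewrite /L mulr_natl mulr2n lerD//; last exact: ltW.
  by rewrite eucl_distC ltW.
pose e1 := r0 / (12 * M); have e10 : 0 < e1 by rewrite divr_gt0// mulr_gt0.
have e1M : 12 * (e1 * M) = r0 by rewrite /e1; field; rewrite gt_eqF.
have rz0 : 0 < rho z0 by apply: lt_trans rzM; rewrite divr_gt0.
have e1z : e1 <= rho z0.
  apply: ltW; apply: le_lt_trans rzM; rewrite /e1 ler_pM2l// lef_pV2 ?posrE ?mulr_gt0//.
  by rewrite ler_peMl ?(ltW M0)// ler1n.
(* 40 M serves when A is at scale r: then x and y are within 5 r = 40 (r / 8)
   of A, and M times the distance of A to the boundary exceeds r. When A = z0,
   all distances are at most L, which is 8 L / e1 times e1 / 8. *)
pose K := Num.max (40 * M) (8 * (L / e1)).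
have K1 : 40 * M <= K by rewrite le_max lexx.
have K2 : 8 * (L / e1) <= K by rewrite le_max lexx orbT.
have K0 : 0 < K by apply: lt_le_trans K1; rewrite mulr_gt0.
have K80 : 80 <= K.
  by apply: le_trans K1; rewrite (_ : 80 = 40 * 2) ?ler_pM2l//; ring.
have KL u : e1 / 8 <= u -> L <= K * u.
  move=> u8; have u0 : 0 < u by apply: lt_le_trans u8; rewrite divr_gt0.
  apply: (@le_trans _ _ (8 * (L / e1) * u)); last by rewrite ler_pM2r.
  apply: (@le_trans _ _ (8 * (L / e1) * (e1 / 8))); last first.
    by rewrite ler_pM2l// mulr_gt0// divr_gt0.
  rewrite (_ : 8 * (L / e1) * (e1 / 8) = L)//.
  by field; rewrite gt_eqF.
have Kr u v : 0 <= u -> u <= 80 * v -> 0 <= v -> u <= K * v.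
  by move=> _ uv v0; apply: le_trans uv _; exact: ler_wpM2r.
have [Cn Cn0 near] := near_diagonal K0; have [Cf Cf0 far] := off_diagonal K0.
exists (Num.max Cn Cf); first by rewrite lt_max Cn0.
move=> x y A Dx Dy xy BA.
have DA : D A.
  by move: BA; rewrite /Bset; case: ifPn => _; [case|move=> ->].
have gxy := gpos Dx Dy xy.
have P0 : 0 < profile x y A.
  rewrite /profile; apply: mulr_gt0; last exact: newton_gt0.
  by apply: divr_gt0; apply: mulr_gt0; rewrite ?h1pos ?h2pos.
have rA0 : 0 < rho A by exact: dist_boundary_gt0.
have r_gt0 : 0 < rmax D x y.
  by rewrite /rmax lt_max eucl_dist_gt0 xy orbT.
have xyr : eucl_dist x y <= rmax D x y by rewrite /rmax le_max lexx orbT.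
have KA : rmax D x y / M < rho A -> 40 * rmax D x y <= K * rho A.
  rewrite ltr_pdivrMr// => rA; apply: (@le_trans _ _ (40 * M * rho A)).
    by rewrite -mulrA ler_pM2l// mulrC ltW.
  by rewrite ler_pM2r.
have [nr|fr] := leP (2 * eucl_dist x y) (Num.max (rho x) (rho y)).
  have rmx : rmax D x y <= Num.max (rho x) (rho y).
    rewrite {1}/rmax ge_max lexx /=; apply: le_trans nr.
    by rewrite ler_peMl ?eucl_dist_ge0// ler1n.
  have [hx hy] : rmax D x y / 2 <= rho x /\ rmax D x y / 2 <= rho y.
    apply: (max_half rmx nr); first exact: (dist_boundary_lip oD bD d0 x y D0).
    by rewrite eucl_distC; exact: (dist_boundary_lip oD bD d0 y x D0).
  apply: (sim_weak gxy P0 (_ : Cn <= _)); first by rewrite le_max lexx.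
  have lift u v : u <= K * (rmax D x y / 2) -> rmax D x y / 2 <= v -> u <= K * v.
    by move=> uK rv; apply: le_trans uK _; rewrite ler_pM2l.
  move: BA; rewrite /Bset; case: ifPn => [_ [_ rA]|rbig zA].
    rewrite gt_max => /andP[xA yA]; rewrite mulrC in rA; have {}KA := KA rA.
    have r5 : 5 * rmax D x y <= K * (rmax D x y / 2).
      by apply: Kr; lra.
    have r5A : 5 * rmax D x y <= K * rho A by lra.
    by apply: near => //; [apply: lift hx|apply: lift hy| |]; apply: ltW;
      [exact: lt_le_trans r5|exact: lt_le_trans r5|
       exact: lt_le_trans r5A|exact: lt_le_trans r5A].
  rewrite -leNgt -/e1 in rbig; rewrite zA.
  have e1r : e1 / 8 <= rmax D x y / 2 by lra.
  have e1z' : e1 / 8 <= rho z0 by lra.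
  by apply: near => //; rewrite -?zA//; apply: le_trans (DL _ _ _ _) _ => //;
    apply: KL; rewrite ?zA//; exact: le_trans e1r _.
apply: (sim_weak gxy P0 (_ : Cf <= _)); first by rewrite le_max lexx orbT.
have r2 : rmax D x y <= 2 * eucl_dist x y.
  by rewrite {1}/rmax ge_max (ltW fr) /= ler_peMl ?eucl_dist_ge0// ler1n.
move: BA; rewrite /Bset; case: ifPn => [rsm [_ rA]|rbig zA].
  rewrite -/e1 in rsm; rewrite gt_max => /andP[xA yA]; rewrite mulrC in rA.
  have {}KA := KA rA.
  have rr0 : rmax D x y < r0.
    have : e1 * 2 <= e1 * M by rewrite ler_pM2l.
    by lra.
  have rz : rmax D x y <= rho z0 by apply: ltW; exact: lt_le_trans e1z.
  have K40 : 40 * (rmax D x y / 8) <= K * (rmax D x y / 8).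
    by apply: Kr; lra.
  have xA' := ltW xA; have yA' := ltW yA.
  (* |x - y| is at least r / 2, hence four times r / 8. *)
  by apply: (far (rmax D x y / 8)) => //; lra.
rewrite -leNgt -/e1 in rbig; rewrite zA.
have e1r0 : e1 < r0.
  have : e1 * 2 <= e1 * M by rewrite ler_pM2l.
  by lra.
have K1e : 80 * rho z0 <= K * rho z0 by rewrite ler_pM2r.
have LK := KL _ (lexx (e1 / 8)).
apply: (far (e1 / 8)) => //.
- by rewrite divr_gt0.
- by lra.
- by lra.
- by lra.
- exact: le_trans (DL x y Dx Dy) LK.
- exact: le_trans (DL x z0 Dx Dz0) LK.
- exact: le_trans (DL y z0 Dy Dz0) LK.
- by lra.
Qed.

End two_sided.

(** * The two-sided estimate *)

Unset Implicit Arguments.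
Set Printing Implicit Defensive.

Theorem theorem2p12 (R : realType) (d : nat) (hd : (3 <= d)%N)
  (mu : 'I_d -> signed_measure 'rV[R]_d R)
  (hmu : forall i, kato_class 1 (mu i))
  (L : generator_form) (a : 'rV[R]_d -> 'M[R]_d)
  (haC1 : forall i j, C1_fun (fun x => a x i j))
  (hell : uniformly_elliptic a)
  (phi : 'rV[R]_d -> R) (hphi : mollifier phi)
  (dO : measure_display) (Omega : measurableType dO)
  (P : 'rV[R]_d -> probability Omega R) (X : R -> Omega -> 'rV[R]_d)
  (hX : is_diffusion P X phi L a mu)
  (q : set 'rV[R]_d -> R -> 'rV[R]_d -> 'rV[R]_d -> R)
  (hq : forall U : set 'rV[R]_d, open U -> bounded_set U ->
     is_killed_density P X U (q U))
  (D : set 'rV[R]_d) (R0 Lambda0 : R) (hD : lipschitz_domain D R0 Lambda0)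
  (kappa0 : R) (hkappa0 : 0 < kappa0 <= 2^-1)
  (hballs : interior_balls D R0 kappa0)
  (r1 : R) (hr1 : 0 < r1) (hgreen_ball : green_ball_estimates q r1)
  (r2 : R) (hr2 : 0 < r2) (hharnack : harnack P X r2)
  (M1 r3 : R) (hM1 : 1 < M1) (hr3 : 0 < r3)
  (hbhp : boundary_harnack P X D M1 r3)
  (M r0 : R) (hM : kappa0^-1 < M) (hr0 : 0 < r0)
  (hr4 : let M2 := 2 * (1 + M1) * Num.sqrt (1 + Lambda0 ^+ 2) + 2 in
         r0 <= M2^-1 * Num.min (Num.min R0 r1) (Num.min r2 r3))
  (hquot : green_quotients q D M r0)
  (C0 : R) (hC0 : 0 < C0) (hgreen : green_estimates q D C0)
  (z0 : 'rV[R]_d) (hz0 : D z0) (hz0r : r0 / M < dist_boundary D z0 < r0) :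
  exists2 c : R, 0 < c &
    forall x y : 'rV[R]_d, D x -> D y -> x != y ->
    forall A, Bset D r0 M z0 x y A ->
      let F := g1 q D C0 z0 x * g2 q D C0 z0 y
               / (g1 q D C0 z0 A * g2 q D C0 z0 A)
               * eucl_dist x y ^ (2 - d%:Z) in
      ((c^-1 * F)%:E <= green q D x y)%E /\ (green q D x y <= (c * F)%:E)%E.
Proof.
have [Xm Xc XM X0 _] := hX.
have [oD cD D0 bD [R00 charts]] := hD.
have /andP[kap0 kap2] := hkappa0.
have d0 : (0 < d)%N by exact: ltn_trans hd.
have M2 : 2 <= M.
  apply: ltW; apply: le_lt_trans hM; rewrite -[2]invrK lef_pV2 ?posrE//.
have M0 : 0 < M by apply: lt_le_trans M2.
have r0R0 : r0 <= R0.
  set N := Num.min (Num.min R0 r1) (Num.min r2 r3).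
  have N0 : 0 < N by rewrite !lt_min R00 hr1 hr2 hr3.
  apply: le_trans hr4 _; apply: (@le_trans _ _ N); last by rewrite /N !ge_min lexx.
  rewrite ler_pdivrMl; last first.
    by rewrite ltr_wpDl// !mulr_ge0 ?sqrtr_ge0// addr_ge0// ltW// (lt_trans _ hM1).
  rewrite ler_peMl ?(ltW N0)//.
  have : 0 <= 2 * (1 + M1) * Num.sqrt (1 + Lambda0 ^+ 2).
    by rewrite !mulr_ge0 ?sqrtr_ge0// addr_ge0// ltW// (lt_trans _ hM1).
  by move: (2 * _ * _) => b; lra.
pose rho := dist_boundary D.
have [rzM rzr] : r0 / M < rho z0 /\ rho z0 < r0 by case/andP: hz0r.
have rz0 : 0 < rho z0 by exact: dist_boundary_gt0.
pose G := green q D; pose g x y := fine (G x y).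
have Gpos x y : D x -> D y -> (0 < G x y)%E.
  exact: (green_gt0 hd Xm XM Xc X0 hq hr1 hgreen_ball oD cD bD).
have GE x y : D x -> D y -> x != y -> G x y = (g x y)%:E.
  move=> Dx Dy xy; rewrite fineK// ge0_fin_numE; last exact: ltW (Gpos x y Dx Dy).
  by have [up _] := hgreen x y Dx Dy xy; apply: le_lt_trans up _; rewrite ltry.
have gpos x y : D x -> D y -> x != y -> 0 < g x y.
  by move=> Dx Dy xy; rewrite -lte_fin -GE//; exact: Gpos.
have gup x y : D x -> D y -> x != y -> g x y <= C0 * newton x y.
  by move=> Dx Dy xy; have [] := hgreen x y Dx Dy xy; rewrite -/(G x y) GE.
have gnear x y : D x -> D y -> x != y -> 2 * eucl_dist x y <= Num.max (rho x) (rho y) ->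
    C0^-1 * newton x y <= g x y.
  by move=> Dx Dy xy near; have [_ /(_ near)] := hgreen x y Dx Dy xy; rewrite -/(G x y) GE.
have glow K : 0 < K -> exists2 c : R, 0 < c & forall x y, D x -> D y -> x != y ->
    eucl_dist x y <= K * rho x -> eucl_dist x y <= K * rho y -> c * newton x y <= g x y.
  move=> K0; have [c c0 H] := green_nontangential_bound hd Xm XM Xc X0 hq hr1 hgreen_ball oD cD D0 bD
    R00 charts hC0 hgreen K0.
  exists c => // x y Dx Dy xy xK yK.
  by have := H x y Dx Dy xy xK yK; rewrite -/(G x y) GE.
have [cQ cQ1 HQ] := hquot.
(* The points of the small ball differ from those outside the large one, so
   the quotients are those of finite positive values of G. *)
have outside (Q x z : 'rV[R]_d) (r : R) : r <= eucl_dist Q x -> eucl_dist Q z < r / M -> 0 < r -> x != z.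
  move=> rx zr rp; apply: contraTneq zr => <-; rewrite -leNgt; apply: le_trans rx.
  by rewrite ler_pdivrMr// ler_peMr ?(ltW rp)//; lra.
have ratio (u v u' v' c : R) : 0 < u -> 0 < v -> 0 < u' -> 0 < v' ->
    (u%:E / v%:E <= c%:E * (u'%:E / v'%:E))%E -> u * v' <= c * (u' * v).
  move=> u0 v0 u'0 v'0; rewrite !inver !gt_eqF// -!EFinM lee_fin.
  by rewrite ler_pdivrMr// mulrA mulrAC ler_pdivlMr// mulrA.
have gQ1 Q r x y z1 z2 : boundary D Q -> 0 < r -> r < r0 ->
    D x -> r <= eucl_dist Q x -> D y -> r <= eucl_dist Q y ->
    D z1 -> eucl_dist Q z1 < r / M -> D z2 -> eucl_dist Q z2 < r / M ->
    g z1 x * g z2 y <= cQ * (g z2 x * g z1 y).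
  move=> bQ rp rr Dx Qx Dy Qy Dz1 Qz1 Dz2 Qz2.
  have notin z : r <= eucl_dist Q z -> ~ eball Q r z by rewrite /eball /= leNgt => /negP.
  have [_] := HQ Q r x y z1 z2 bQ rp rr (conj Dx (notin _ Qx)) (conj Dy (notin _ Qy))
    (conj Dz1 Qz1) (conj Dz2 Qz2).
  have o1 := outside Q x z1 r Qx Qz1 rp; have o2 := outside Q x z2 r Qx Qz2 rp.
  have o3 := outside Q y z1 r Qy Qz1 rp; have o4 := outside Q y z2 r Qy Qz2 rp.
  rewrite -!/(G _ _) !GE 1?eq_sym//.
  by apply: ratio; apply: gpos; rewrite // eq_sym.
have gQ2 Q r x y z1 z2 : boundary D Q -> 0 < r -> r < r0 ->
    D x -> r <= eucl_dist Q x -> D y -> r <= eucl_dist Q y ->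
    D z1 -> eucl_dist Q z1 < r / M -> D z2 -> eucl_dist Q z2 < r / M ->
    g x z1 * g y z2 <= cQ * (g x z2 * g y z1).
  move=> bQ rp rr Dx Qx Dy Qy Dz1 Qz1 Dz2 Qz2.
  have notin z : r <= eucl_dist Q z -> ~ eball Q r z by rewrite /eball /= leNgt => /negP.
  have [+ _] := HQ Q r x y z1 z2 bQ rp rr (conj Dx (notin _ Qx)) (conj Dy (notin _ Qy))
    (conj Dz1 Qz1) (conj Dz2 Qz2).
  have o1 := outside Q x z1 r Qx Qz1 rp; have o2 := outside Q x z2 r Qx Qz2 rp.
  have o3 := outside Q y z1 r Qy Qz1 rp; have o4 := outside Q y z2 r Qy Qz2 rp.
  rewrite -!/(G _ _) !GE//.
  by apply: ratio; exact: gpos.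
pose h1 := g1 q D C0 z0; pose h2 := g2 q D C0 z0; pose C1 := truncation_level D C0 z0.
(* The truncation level is the upper bound of the Green function at distance
   rho z0 / 2 from z0; hence the truncation is only felt closer to z0. *)
have C1E : C1 = C0 * (rho z0 / 2) ^ (2 - d%:Z).
  rewrite /C1 /truncation_level -/(rho z0) -mulrA; congr (_ * _).
  rewrite !exprz_newton// expr_div_n invf_div; congr (_ * _).
  by have -> : d%:Z - 2 = (d - 2)%N%:Z by rewrite -subzn// ltnW.
have C10 : 0 < C1.
  by rewrite C1E mulr_gt0// exprz_newton// invr_gt0 exprn_gt0// divr_gt0.
have trunc (u : \bar R) : (0 < u)%E ->
    0 < fine (Order.min u C1%:E) <= C1 /\ forall c, (c%:E <= u)%E -> Num.min c C1 <= fine (Order.min u C1%:E).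
  move=> u0; case: u u0 => [u| |]//.
    rewrite lte_fin -EFin_min /= => u0; split; first by rewrite lt_min u0 C10 ge_min lexx orbT.
    by move=> c; rewrite lee_fin => cu; rewrite le_min !ge_min cu lexx orbT.
  by move=> _; rewrite minye /=; split; [rewrite C10 lexx|move=> c _; rewrite ge_min lexx orbT].
have truncE x y : D x -> D y -> rho z0 / 2 <= eucl_dist x y ->
    fine (Order.min (G x y) C1%:E) = g x y.
  move=> Dx Dy xy; have xy0 : 0 < eucl_dist x y by apply: lt_le_trans xy; rewrite divr_gt0.
  have xny : x != y by rewrite -eucl_dist_gt0.
  rewrite GE// -EFin_min /= min_l//; apply: le_trans (gup x y Dx Dy xny) _.
  by rewrite C1E ler_pM2l//; apply: newton_antimono => //; rewrite divr_gt0.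
have far x : D x -> rho x < rho z0 / 2 -> rho z0 / 2 <= eucl_dist x z0.
  move=> Dx rx; have := dist_boundary_lip oD bD d0 z0 x D0.
  by rewrite -/(rho z0) -/(rho x) (eucl_distC z0); lra.
have h1E x : D x -> rho x < rho z0 / 2 -> h1 x = g x z0.
  by move=> Dx rx; apply: truncE => //; exact: far.
have h2E x : D x -> rho x < rho z0 / 2 -> h2 x = g z0 x.
  by move=> Dx rx; apply: truncE => //; rewrite eucl_distC; exact: far.
have h1pos x : D x -> 0 < h1 x by move=> Dx; have [/andP[]] := trunc _ (Gpos x z0 Dx hz0).
have h1up x : D x -> h1 x <= C1 by move=> Dx; have [/andP[]] := trunc _ (Gpos x z0 Dx hz0).
have h2pos x : D x -> 0 < h2 x by move=> Dx; have [/andP[]] := trunc _ (Gpos z0 x hz0 Dx).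
have h2up x : D x -> h2 x <= C1 by move=> Dx; have [/andP[]] := trunc _ (Gpos z0 x hz0 Dx).
have interior (e : R) : 0 < e -> exists2 c : R, 0 < c & forall x, D x -> e <= rho x ->
    c <= h1 x /\ c <= h2 x.
  move=> e0; have e'0 : 0 < Num.min e (rho z0) by rewrite lt_min e0.
  have [c c0 H] := green_interior_bound hd Xm XM Xc X0 hq hr1 hgreen_ball oD cD bD e'0.
  exists (Num.min c C1); first by rewrite lt_min c0.
  have ez : Num.min e (rho z0) <= rho z0 by rewrite ge_min lexx orbT.
  move=> x Dx ex; have ex' : Num.min e (rho z0) <= rho x by rewrite ge_min ex.
  split.
    by have [_ tr] := trunc _ (Gpos x z0 Dx hz0); apply: tr; exact: H.
  by have [_ tr] := trunc _ (Gpos z0 x hz0 Dx); apply: tr; exact: H.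
have h1I (e : R) : 0 < e -> exists2 c : R, 0 < c & forall x, D x -> e <= rho x -> c <= h1 x.
  by move=> /interior[c c0 H]; exists c => // x Dx ex; have [] := H x Dx ex.
have h2I (e : R) : 0 < e -> exists2 c : R, 0 < c & forall x, D x -> e <= rho x -> c <= h2 x.
  by move=> /interior[c c0 H]; exists c => // x Dx ex; have [] := H x Dx ex.
have [C C00 H] := green_profile hd oD D0 bD kap0 kap2 hballs M2 hr0 r0R0 hz0 hC0 cQ1
  gpos gup gnear glow gQ1 gQ2 h1E h2E h1I h2I h1pos h1up h2pos h2up rzM.
exists C => // x y Dx Dy xy A BA; have [H1 H2] := H x y A Dx Dy xy BA.
rewrite /= -/(G x y) GE//; split; rewrite lee_fin; last exact: H1.
by rewrite -/h1 -/h2 ler_pdivrMl; [exact: H2|].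
Qed.
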